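(* Let $k$ be a real number with $0<k^2<1$. If the series below converges, then $$\sum_{n=0}^{\infty} \frac{(-1)^{\lfloor n/2\rfloor}(2n+1)^2}{e^{(2n+1)\frac{K'}{K}\pi}-1} = \frac32+\frac{4\left(k^2(3+k')-3(1+k')\right)K^3}{\left(\sqrt{1-k}+\sqrt{1+k}\right)\pi^3}.$$
   Context: For the elliptic modulus $k$ (with $0<k^2<1$), write $k'=\sqrt{1-k^2}$. The complete elliptic integral of the first kind is $K=K(k)=\int_0^{\pi/2}\frac{d\theta}{\sqrt{1-k^2\sin^2\theta}}$, and $K'=K(k')$. *)

(* Defs.v *)
From Stdlib Require Import Reals.
From Coquelicot Require Import Coquelicot.

Local Open Scope R_scope.

Definition complementary_modulus (k : R) : R := sqrt (1 - k ^ 2).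

(* The argument is the modulus [k], not the parameter [m = k ^ 2]. For
   [k ^ 2 < 1] the integrand is continuous on [0, PI / 2], so the total
   operator [RInt] is the genuine Riemann integral. *)
Definition ellipticK (k : R) : R :=
  RInt (fun theta : R => / sqrt (1 - k ^ 2 * sin theta ^ 2)) 0 (PI / 2).

(* [Nat.div] is floor division, so [(-1) ^ Nat.div n 2] has the sign pattern
   +, +, -, -, +, +, ... *)
Definition lambert_term (k : R) (n : nat) : R :=
  (-1) ^ Nat.div n 2 * INR (2 * n + 1) ^ 2 /
  (exp (INR (2 * n + 1) *
        (ellipticK (complementary_modulus k) / ellipticK k) * PI) - 1).

(* Main.v *)
Require Import Defs.
From Stdlib Require Import Reals Lra Lia ZArith.
From Coquelicot Require Import Coquelicot.

(** Write K and K' for the two integrals of the statement, x = PI K'/K and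
    q = exp (-x), so that the n-th term is +- (2n+1)^2 q^(2n+1)/(1 - q^(2n+1)).
    The signs are sqrt 2 times the values of sin ((2n+1) z) at z = PI/4, and
    this makes the sum a second derivative of a Jacobi elliptic function: in
    the variable z = PI u/(2K), the functions ns, ds, cs of u are, up to the
    factor PI/(2K), the sums over odd or even integers

      N(z) = 1/sin z + 4 sum q^m/(1 - q^m) sin mz        (m odd)
      D(z) = 1/sin z - 4 sum q^m/(1 + q^m) sin mz        (m odd)
      C(z) = cot z - 4 sum q^m/(1 + q^m) sin mz          (m even)

    and N' = - C D, D' = - N C, C' = - N D give N'' = N (C^2 + D^2). No
    function theory is used for these identities. Each of N, C, D is a
    bilateral series in powers of exp (i z) whose coefficients have the form
    1/(1 - e q^m) with e = 1 or -1, and a product of two such coefficients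
    splits by partial fractions ([pole_mult]). A convolution of two coefficient
    sequences thus becomes a multiple of a sum of differences, which counts a
    shift ([conv_damp]). The series converge in an annulus, where convolving
    coefficients is legitimate ([sumZ_conv_bounded]), and the point z = PI/4
    lies on its boundary; it is reached by an Abel limit ([abel_limit]). With a
    sign (-1)^j inserted, the same convolutions give C(z) N(z + PI/2) and
    C(z) D(z + PI/2) as constant multiples of D(z) and N(z). At z = PI/4 all
    this becomes [lambert_relations].

    The values at PI/4 and PI/2 are Lambert series A, B, P, Q in q; in terms of
    theta constants, A = theta3^2 and B = theta4^2. Replacing x by 2x squares
    q, and turns (A, B) into its arithmetic and geometric means
    ([lambertA_double], [lambertB_double]). Everything tends to 1 as x grows,
    so quantities that do not change under x -> 2x are evaluated in the limit.
    This gives P^2 = A (A + B)/2, and the sum in terms of A and B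
    ([lambertS_closed_form]).

    It remains to identify A and B with elliptic integrals. The integral
    I(a, b) of 1/sqrt (a^2 cos^2 + b^2 sin^2) over [0, PI/2] is invariant under
    the arithmetic-geometric mean ([gaussI_landen]), whence I(A, B) = PI/2
    ([gaussI_lambert]). The companion I(A, sqrt (A^2 - B^2)) is doubled when x
    is, and its logarithmic growth determines it: it equals x/2
    ([gaussI_complementary_lambert]). So the modulus k0 with k0' = B/A has
    PI K'(k0)/K(k0) = x. As K'/K is strictly decreasing in the modulus, k0 is
    the modulus one started from ([jacobi_inversion]), and an identity between
    algebraic functions of A and B is left. *)

Local Open Scope R_scope.

(** * Series of real numbers *)

Lemma ex_series_dominated (a b : nat -> R) :
  (forall n, Rabs (a n) <= b n) -> ex_series b -> ex_series a.
Proof. intros H. exact (@ex_series_le R_AbsRing R_CompleteNormedModule a b H). Qed.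

Lemma ex_series_Rplus (a b : nat -> R) :
  ex_series a -> ex_series b -> ex_series (fun n => a n + b n).
Proof. exact (@ex_series_plus R_AbsRing R_NormedModule a b). Qed.

Lemma ex_series_Rmult (c : R) (a : nat -> R) :
  ex_series a -> ex_series (fun n => c * a n).
Proof. exact (@ex_series_scal_l R_AbsRing R_NormedModule c a). Qed.

Lemma ex_series_Rext (a b : nat -> R) :
  (forall n, a n = b n) -> ex_series a -> ex_series b.
Proof. exact (@ex_series_ext R_AbsRing R_NormedModule a b). Qed.

Lemma sum_n_le_Series (a : nat -> R) (N : nat) :
  (forall n, 0 <= a n) -> ex_series a -> sum_n a N <= Series a.
Proof.
intros Ha Ea.
apply (is_lim_seq_incr_compare (sum_n a)).
- exact (Series_correct a Ea).
- intros n. rewrite sum_Sn. unfold plus; simpl. specialize (Ha (S n)). lra.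
Qed.

Lemma Series_nonneg (a : nat -> R) : (forall n, 0 <= a n) -> ex_series a -> 0 <= Series a.
Proof.
intros Ha Ea. apply Rle_trans with (sum_n a 0).
- rewrite sum_O. apply Ha.
- now apply sum_n_le_Series.
Qed.

Lemma ex_series_bounded_sums (a : nat -> R) (M : R) :
  (forall n, 0 <= a n) -> (forall N, sum_n a N <= M) ->
  ex_series a /\ Series a <= M.
Proof.
intros Ha HM.
assert (Hinc : forall n, sum_n a n <= sum_n a (S n)).
{ intros n. rewrite sum_Sn. unfold plus; simpl. specialize (Ha (S n)). lra. }
destruct (ex_finite_lim_seq_incr (sum_n a) M Hinc HM) as [l Hl].
assert (Hs : is_series a l) by exact Hl.
split; [now exists l|].
rewrite (is_series_unique _ _ Hs).
apply (is_lim_seq_le (sum_n a) (fun _ => M) l M HM Hl).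
apply is_lim_seq_const.
Qed.

Lemma Series_sum_n_swap (a : nat -> nat -> R) (J : nat) :
  (forall j, ex_series (fun i => a i j)) ->
  ex_series (fun i => sum_n (a i) J) /\
  Series (fun i => sum_n (a i) J) = sum_n (fun j => Series (fun i => a i j)) J.
Proof.
intros H. induction J as [|J [IH1 IH2]].
- split.
  + apply ex_series_Rext with (2 := H 0%nat). intros n. now rewrite sum_O.
  + rewrite sum_O. apply Series_ext. intros n. now rewrite sum_O.
- assert (E : forall i, sum_n (a i) (S J) = sum_n (a i) J + a i (S J))
    by (intros i; now rewrite sum_Sn).
  split.
  + apply ex_series_Rext with (fun i => sum_n (a i) J + a i (S J));
      [intros i; now rewrite E|]. apply ex_series_Rplus; [exact IH1|apply H].
  + rewrite (Series_ext _ _ E), Series_plus by (trivial; apply H).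
    rewrite IH2, sum_Sn. reflexivity.
Qed.

(** A finite number of columns can be summed first, and the total bounds them. *)
Lemma Series_swap_nonneg_le (a : nat -> nat -> R) :
  (forall i j, 0 <= a i j) ->
  (forall i, ex_series (a i)) -> ex_series (fun i => Series (a i)) ->
  (forall j, ex_series (fun i => a i j)) /\
  ex_series (fun j => Series (fun i => a i j)) /\
  Series (fun j => Series (fun i => a i j)) <= Series (fun i => Series (a i)).
Proof.
intros Hp H1 H2.
assert (H3 : forall j, ex_series (fun i => a i j)).
{ intros j. apply ex_series_dominated with (2 := H2). intros i.
  rewrite Rabs_pos_eq by apply Hp.
  apply Rle_trans with (sum_n (a i) j); [|apply sum_n_le_Series; auto].
  destruct j; [rewrite sum_O; lra|rewrite sum_Sn; unfold plus; simpl].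
  assert (0 <= sum_n (a i) j); [|lra].
  clear -Hp. induction j; [rewrite sum_O; apply Hp|].
  rewrite sum_Sn; unfold plus; simpl. specialize (Hp i (S j)). lra. }
split; [exact H3|].
apply ex_series_bounded_sums.
- intros j. apply Series_nonneg; auto.
- intros J. destruct (Series_sum_n_swap a J H3) as [E1 E2]. rewrite <- E2.
  apply Series_le; [|exact H2]. intros i. split.
  + clear -Hp. induction J; [rewrite sum_O; apply Hp|].
    rewrite sum_Sn; unfold plus; simpl. specialize (Hp i (S J)). lra.
  + apply sum_n_le_Series; auto.
Qed.

Lemma Series_swap_nonneg (a : nat -> nat -> R) :
  (forall i j, 0 <= a i j) ->
  (forall i, ex_series (a i)) -> ex_series (fun i => Series (a i)) ->
  (forall j, ex_series (fun i => a i j)) /\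
  ex_series (fun j => Series (fun i => a i j)) /\
  Series (fun j => Series (fun i => a i j)) = Series (fun i => Series (a i)).
Proof.
intros Hp H1 H2.
destruct (Series_swap_nonneg_le a Hp H1 H2) as [K1 [K2 K3]].
destruct (Series_swap_nonneg_le (fun j i => a i j) (fun j i => Hp i j) K1 K2) as [_ [_ K4]].
repeat split; trivial. apply Rle_antisym; assumption.
Qed.

(** Absolute convergence reduces the exchange to the nonnegative families |a| and
    a + |a|, whose difference is a. *)
Lemma Series_swap (a : nat -> nat -> R) :
  (forall i, ex_series (fun j => Rabs (a i j))) ->
  ex_series (fun i => Series (fun j => Rabs (a i j))) ->
  (forall j, ex_series (fun i => a i j)) /\
  Series (fun j => Series (fun i => a i j)) = Series (fun i => Series (a i)).
Proof.
intros H1 H2.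
assert (H1' : forall i, ex_series (a i)) by (intros i; now apply ex_series_Rabs).
assert (Hb : forall i j, 0 <= a i j + Rabs (a i j) <= 2 * Rabs (a i j)).
{ intros i j. generalize (Rle_abs (a i j)) (Rle_abs (- a i j)). rewrite Rabs_Ropp. lra. }
assert (H2' : ex_series (fun i => Series (a i))).
{ apply ex_series_dominated with (2 := H2). intros i. now apply Series_Rabs. }
destruct (Series_swap_nonneg (fun i j => Rabs (a i j))) as [A1 [A2 A3]]; trivial.
{ intros; apply Rabs_pos. }
destruct (Series_swap_nonneg (fun i j => a i j + Rabs (a i j))) as [B1 [B2 B3]].
{ intros; apply Hb. }
{ intros i. now apply ex_series_Rplus. }
{ apply ex_series_Rext with (fun i => Series (a i) + Series (fun j => Rabs (a i j))).
  - intros i. now rewrite Series_plus.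
  - now apply ex_series_Rplus. }
assert (C1 : forall j, ex_series (fun i => a i j)) by (intros j; now apply ex_series_Rabs).
split; [exact C1|].
rewrite (Series_ext (fun j => Series (fun i => a i j))
  (fun j => Series (fun i => a i j + Rabs (a i j)) - Series (fun i => Rabs (a i j)))).
2: { intros j. rewrite Series_plus by trivial. ring. }
rewrite Series_minus, A3, B3 by trivial.
rewrite (Series_ext (fun i => Series (fun j => a i j + Rabs (a i j)))
  (fun i => Series (a i) + Series (fun j => Rabs (a i j)))).
2: { intros i. now rewrite Series_plus. }
rewrite Series_plus by trivial. ring.
Qed.

(** Tannery's theorem. *)
Lemma is_lim_seq_Series_dominated (u : nat -> nat -> R) (l M : nat -> R) :
  (forall i n, Rabs (u i n) <= M n) -> ex_series M ->
  (forall n, is_lim_seq (fun i => u i n) (l n)) ->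
  is_lim_seq (fun i => Series (u i)) (Series l).
Proof.
intros Hu HM Hl.
assert (HlM : forall n, Rabs (l n) <= M n).
{ intros n. apply (is_lim_seq_le (fun i => Rabs (u i n)) (fun _ => M n) (Rabs (l n)) (M n)).
  - intros i. apply Hu.
  - apply (is_lim_seq_abs _ _ (Hl n)).
  - apply is_lim_seq_const. }
assert (Eu : forall i, ex_series (u i)) by (intros i; now apply ex_series_dominated with M).
assert (El : ex_series l) by now apply ex_series_dominated with M.
apply is_lim_seq_spec. intros eps.
(* N cuts off a tail of the dominating series, hence of all series involved *)
assert (HT : exists N, Series (fun k => M (S N + k)%nat) < eps / 3).
{ pose proof (Series_correct _ HM) as HS.
  apply (is_lim_seq_spec (sum_n M) (Series M)) in HS.
  destruct (HS (mkposreal (eps / 3) ltac:(destruct eps; simpl; lra))) as [N HN].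
  exists N. specialize (HN N (Nat.le_refl N)). simpl in HN.
  rewrite (Series_incr_n M (S N)) in HN by (trivial; lia).
  simpl pred in HN. rewrite sum_n_Reals in HN.
  apply Rabs_def2 in HN. lra. }
destruct HT as [N HN].
assert (Hhead : is_lim_seq (fun i => sum_n (u i) N) (sum_n l N)).
{ clear HN. induction N.
  - apply is_lim_seq_ext with (fun i => u i O); [intros; now rewrite sum_O|].
    rewrite sum_O. apply Hl.
  - apply is_lim_seq_ext with (fun i => sum_n (u i) N + u i (S N));
      [intros; now rewrite sum_Sn|].
    rewrite sum_Sn. apply is_lim_seq_plus'; [exact IHN|apply Hl]. }
apply is_lim_seq_spec in Hhead.
destruct (Hhead (mkposreal (eps / 3) ltac:(destruct eps; simpl; lra))) as [i0 Hi0].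
exists i0. intros i Hi. specialize (Hi0 i Hi). simpl in Hi0.
assert (Htail : forall v : nat -> R, (forall n, Rabs (v n) <= M n) ->
  ex_series v /\ Rabs (Series v - sum_n v N) < eps / 3).
{ intros v Hv. assert (Ev : ex_series v) by now apply ex_series_dominated with M.
  split; [exact Ev|].
  rewrite (Series_incr_n v (S N)) by (trivial; lia). simpl pred.
  rewrite sum_n_Reals.
  replace (_ + _ - _) with (Series (fun k => v (S N + k)%nat)) by ring.
  apply Rle_lt_trans with (2 := HN).
  assert (EM : ex_series (fun k => M (S N + k)%nat))
    by (apply (proj1 (ex_series_incr_n M (S N))); exact HM).
  apply Rle_trans with (Series (fun k => Rabs (v (S N + k)%nat))).
  - apply Series_Rabs. apply ex_series_dominated with (2 := EM).
    intros n. rewrite Rabs_Rabsolu. apply Hv.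
  - apply Series_le; trivial. intros n. split; [apply Rabs_pos|apply Hv]. }
destruct (Htail (u i) (Hu i)) as [_ T1]. destruct (Htail l HlM) as [_ T2].
apply Rabs_def2 in T1. apply Rabs_def2 in T2. apply Rabs_def2 in Hi0.
apply Rabs_def1; lra.
Qed.

Lemma is_series_telescope (T : nat -> R) :
  is_lim_seq T 0 -> is_series (fun n => T n - T (S n)) (T O).
Proof.
intros HT.
assert (H : is_lim_seq (sum_n (fun n => T n - T (S n))) (T O)); [|exact H].
apply is_lim_seq_ext with (fun n => T O - T (S n)).
- intros n. induction n.
  + now rewrite sum_O.
  + rewrite sum_Sn, <- IHn. unfold plus; simpl. ring.
- replace (Finite (T O)) with (Finite (T O - 0)) by (f_equal; ring).
  apply is_lim_seq_minus'; [apply is_lim_seq_const|].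
  apply is_lim_seq_incr_1 in HT. exact HT.
Qed.

(** Leibniz: consecutive partial sums of an alternating series enclose it. *)
Lemma Series_alternating_bounds (U : nat -> R) :
  (forall n, U (S n) <= U n) -> ex_series U ->
  U O - U 1%nat <= Series (fun n => (-1) ^ n * U n) <= U O.
Proof.
intros Hd Hs.
assert (HU0 : is_lim_seq U 0) by now apply ex_series_lim_0.
assert (Hp : forall n, 0 <= U n).
{ intros n. apply (is_lim_seq_decr_compare U 0 HU0 Hd). }
assert (Ea : ex_series (fun n => (-1) ^ n * U n)).
{ apply ex_series_dominated with (2 := Hs). intros n.
  rewrite Rabs_mult, pow_1_abs, Rmult_1_l, Rabs_pos_eq by apply Hp. lra. }
pose proof (Series_correct _ Ea) as HS.
apply is_series_Reals in HS.
destruct (alternated_series_ineq U (Series (fun n => (-1) ^ n * U n)) 0) as [L1 L2].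
- exact Hd.
- apply is_lim_seq_Reals. exact HU0.
- intros eps He. destruct (HS eps He) as [N HN]. exists N. intros n Hn.
  exact (HN n Hn).
- unfold tg_alt in *. simpl in *. lra.
Qed.

Lemma Series_odd_terms (a : nat -> R) :
  ex_series a -> (forall n, a (2 * n)%nat = 0) ->
  Series a = Series (fun n => a (2 * n + 1)%nat).
Proof.
intros Ea H0.
symmetry. apply is_series_unique.
pose proof (Series_correct _ Ea) as HS.
assert (H : is_lim_seq (sum_n (fun n => a (2 * n + 1)%nat)) (Series a)); [|exact H].
apply is_lim_seq_ext with (fun n => sum_n a (2 * n + 1)).
- intros n. induction n.
  + simpl. rewrite sum_Sn, !sum_O. rewrite (H0 0%nat : a 0%nat = 0).
    unfold plus; simpl; ring.
  + replace (2 * S n + 1)%nat with (S (S (2 * n + 1))) by lia.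
    rewrite !sum_Sn, IHn.
    replace (S (2 * n + 1)) with (2 * (S n))%nat by lia. rewrite H0.
    replace (2 * S n + 1)%nat with (S (2 * S n)) by lia.
    unfold plus; simpl; ring.
- apply (is_lim_seq_subseq (sum_n a) _ (fun n => (2 * n + 1)%nat)); [|exact HS].
  apply eventually_subseq. intros n. lia.
Qed.

(** * Absolutely convergent sums over the integers *)

(** The integers are enumerated in pairs k, -1 - k with k >= 0. This pairing is
    the natural one below: it exchanges the odd numbers 2k + 1 and -(2k + 1). *)
Definition fold_at (a : Z -> R) (n : nat) : R :=
  a (Z.of_nat n) + a (-1 - Z.of_nat n)%Z.

Definition sumZ (a : Z -> R) : R := Series (fold_at a).

Definition summableZ (a : Z -> R) : Prop :=
  ex_series (fold_at (fun k => Rabs (a k))).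

Lemma Z_fold_ind (Q : Z -> Prop) :
  (forall n : nat, Q (Z.of_nat n)) -> (forall n : nat, Q (-1 - Z.of_nat n)%Z) ->
  forall k, Q k.
Proof.
intros H1 H2 k. destruct (Z.le_gt_cases 0 k).
- rewrite <- (Z2Nat.id k) by lia. apply H1.
- replace k with (-1 - Z.of_nat (Z.to_nat (-1 - k)))%Z by lia. apply H2.
Qed.

Lemma sumZ_ext (a b : Z -> R) : (forall k, a k = b k) -> sumZ a = sumZ b.
Proof. intros H. apply Series_ext. intros n. unfold fold_at. now rewrite !H. Qed.

Lemma summableZ_ext (a b : Z -> R) : (forall k, a k = b k) -> summableZ a -> summableZ b.
Proof. intros H. apply ex_series_Rext. intros n. unfold fold_at. now rewrite !H. Qed.

Lemma summableZ_dominated (a b : Z -> R) :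
  (forall k, Rabs (a k) <= Rabs (b k)) -> summableZ b -> summableZ a.
Proof.
intros H. apply ex_series_dominated. intros n. unfold fold_at.
rewrite Rabs_pos_eq; [now apply Rplus_le_compat|].
generalize (Rabs_pos (a (Z.of_nat n))) (Rabs_pos (a (-1 - Z.of_nat n)%Z)); lra.
Qed.

Lemma summableZ_abs (a : Z -> R) : summableZ a -> summableZ (fun k => Rabs (a k)).
Proof. apply summableZ_dominated. intros k. rewrite Rabs_Rabsolu. lra. Qed.

Lemma summableZ_plus (a b : Z -> R) :
  summableZ a -> summableZ b -> summableZ (fun k => a k + b k).
Proof.
intros Ha Hb. apply ex_series_dominated with (2 := ex_series_Rplus _ _ Ha Hb).
intros n. unfold fold_at. rewrite Rabs_pos_eq.
- generalize (Rabs_triang (a (Z.of_nat n)) (b (Z.of_nat n)))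
    (Rabs_triang (a (-1 - Z.of_nat n)%Z) (b (-1 - Z.of_nat n)%Z)); lra.
- generalize (Rabs_pos (a (Z.of_nat n) + b (Z.of_nat n)))
    (Rabs_pos (a (-1 - Z.of_nat n)%Z + b (-1 - Z.of_nat n)%Z)); lra.
Qed.

Lemma summableZ_scal (c : R) (a : Z -> R) : summableZ a -> summableZ (fun k => c * a k).
Proof.
intros Ha. apply ex_series_Rext with (2 := ex_series_Rmult (Rabs c) _ Ha).
intros n. unfold fold_at. rewrite !Rabs_mult. ring.
Qed.

Lemma summableZ_minus (a b : Z -> R) :
  summableZ a -> summableZ b -> summableZ (fun k => a k - b k).
Proof.
intros Ha Hb. apply summableZ_ext with (fun k => a k + (-1) * b k); [intros; ring|].
apply summableZ_plus; [assumption|now apply summableZ_scal].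
Qed.

Lemma summableZ_bounded_mult (t a : Z -> R) :
  (forall k, Rabs (t k) <= 1) -> summableZ a -> summableZ (fun k => a k * t k).
Proof.
intros Ht. apply summableZ_dominated. intros k. rewrite Rabs_mult.
rewrite <- (Rmult_1_r (Rabs (a k))) at 2.
apply Rmult_le_compat_l; [apply Rabs_pos|apply Ht].
Qed.

Lemma summableZ_nat (a : Z -> R) :
  summableZ a <->
  ex_series (fun n => Rabs (a (Z.of_nat n))) /\
  ex_series (fun n => Rabs (a (-1 - Z.of_nat n)%Z)).
Proof.
split.
- intros H. split; apply ex_series_dominated with (2 := H); intros n;
  unfold fold_at; rewrite Rabs_Rabsolu;
  generalize (Rabs_pos (a (Z.of_nat n))) (Rabs_pos (a (-1 - Z.of_nat n)%Z)); lra.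
- intros [H1 H2]. now apply ex_series_Rplus.
Qed.

Lemma ex_series_fold (a : Z -> R) : summableZ a -> ex_series (fold_at a).
Proof. apply ex_series_dominated. intros n. apply Rabs_triang. Qed.

Lemma sumZ_plus (a b : Z -> R) :
  summableZ a -> summableZ b -> sumZ (fun k => a k + b k) = sumZ a + sumZ b.
Proof.
intros Ha Hb. unfold sumZ. rewrite <- Series_plus by now apply ex_series_fold.
apply Series_ext. intros n. unfold fold_at. ring.
Qed.

Lemma sumZ_minus (a b : Z -> R) :
  summableZ a -> summableZ b -> sumZ (fun k => a k - b k) = sumZ a - sumZ b.
Proof.
intros Ha Hb. unfold sumZ. rewrite <- Series_minus by now apply ex_series_fold.
apply Series_ext. intros n. unfold fold_at. ring.
Qed.

Lemma sumZ_scal (c : R) (a : Z -> R) : sumZ (fun k => c * a k) = c * sumZ a.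
Proof.
unfold sumZ. rewrite <- Series_scal_l. apply Series_ext. intros n. unfold fold_at. ring.
Qed.

Lemma sumZ_nat (a : Z -> R) : summableZ a ->
  sumZ a = Series (fun n => a (Z.of_nat n)) + Series (fun n => a (-1 - Z.of_nat n)%Z).
Proof.
intros H. apply summableZ_nat in H. destruct H.
unfold sumZ. rewrite <- Series_plus by (now apply ex_series_Rabs). reflexivity.
Qed.

Lemma sumZ_abs (a : Z -> R) : summableZ a -> Rabs (sumZ a) <= sumZ (fun k => Rabs (a k)).
Proof.
intros H. eapply Rle_trans; [apply Series_Rabs|].
- apply ex_series_dominated with (2 := H). intros n. rewrite Rabs_Rabsolu. apply Rabs_triang.
- apply Series_le; [|exact H]. intros n. split; [apply Rabs_pos|apply Rabs_triang].
Qed.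

(** One term passes from the series over k < 0 to the series over k >= 0. *)
Lemma shift_pred (a : Z -> R) :
  summableZ a -> summableZ (fun k => a (k - 1)%Z) /\ sumZ (fun k => a (k - 1)%Z) = sumZ a.
Proof.
intros Ha. pose proof Ha as Ha'. apply summableZ_nat in Ha'. destruct Ha' as [H1 H2].
assert (E1 : forall n, a (Z.of_nat (S n) - 1)%Z = a (Z.of_nat n))
  by (intros; f_equal; lia).
assert (E2 : forall n, a (-1 - Z.of_nat n - 1)%Z = a (-1 - Z.of_nat (S n))%Z)
  by (intros; f_equal; lia).
assert (K : summableZ (fun k => a (k - 1)%Z)).
{ apply summableZ_nat. split.
  - apply ex_series_incr_1. apply ex_series_Rext with (2 := H1).
    intros n. now rewrite E1.
  - apply (proj1 (ex_series_incr_1 _)) in H2. apply ex_series_Rext with (2 := H2).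
    intros n. now rewrite E2. }
split; [exact K|].
rewrite (sumZ_nat _ K), (sumZ_nat _ Ha).
rewrite (Series_incr_1 (fun n => a (Z.of_nat n - 1)%Z)).
2: { apply summableZ_nat in K. destruct K as [K _]. now apply ex_series_Rabs. }
rewrite (Series_incr_1 (fun n => a (-1 - Z.of_nat n)%Z)) by now apply ex_series_Rabs.
rewrite (Series_ext _ _ E1), (Series_ext _ _ E2). simpl. ring.
Qed.

Lemma shift_succ (a : Z -> R) :
  summableZ a -> summableZ (fun k => a (k + 1)%Z) /\ sumZ (fun k => a (k + 1)%Z) = sumZ a.
Proof.
intros Ha.
(* the involution k -> -1 - k exchanges the two halves of the sum *)
assert (F : forall b : Z -> R, summableZ b ->
  summableZ (fun k => b (-1 - k)%Z) /\ sumZ (fun k => b (-1 - k)%Z) = sumZ b).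
{ intros b Hb. split.
  - apply ex_series_Rext with (2 := Hb). intros n. unfold fold_at. rewrite Rplus_comm.
    now replace (-1 - (-1 - Z.of_nat n))%Z with (Z.of_nat n) by lia.
  - apply Series_ext. intros n. unfold fold_at. rewrite Rplus_comm.
    now replace (-1 - (-1 - Z.of_nat n))%Z with (Z.of_nat n) by lia. }
destruct (F a Ha) as [F1 F2]. destruct (shift_pred _ F1) as [G1 G2].
destruct (F _ G1) as [K1 K2].
assert (E : forall k, a (-1 - ((-1 - k) - 1))%Z = a (k + 1)%Z) by (intros; f_equal; lia).
split.
- exact (summableZ_ext _ _ E K1).
- rewrite <- (sumZ_ext _ _ E). now rewrite K2, G2.
Qed.

Lemma summableZ_sumZ_shift (m : Z) (a : Z -> R) :
  summableZ a -> summableZ (fun k => a (k + m)%Z) /\ sumZ (fun k => a (k + m)%Z) = sumZ a.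
Proof.
intros Ha. induction m using Z.peano_ind.
- split.
  + apply summableZ_ext with (2 := Ha). intros k. f_equal. lia.
  + apply sumZ_ext. intros k. f_equal. lia.
- destruct IHm as [I1 I2]. destruct (shift_succ _ I1) as [J1 J2].
  assert (E : forall k, a (k + 1 + m)%Z = a (k + Z.succ m)%Z) by (intros; f_equal; lia).
  split; [exact (summableZ_ext _ _ E J1)|].
  now rewrite <- (sumZ_ext _ _ E), J2.
- destruct IHm as [I1 I2]. destruct (shift_pred _ I1) as [J1 J2].
  assert (E : forall k, a (k - 1 + m)%Z = a (k + Z.pred m)%Z) by (intros; f_equal; lia).
  split; [exact (summableZ_ext _ _ E J1)|].
  now rewrite <- (sumZ_ext _ _ E), J2.
Qed.

Lemma summableZ_shift (m : Z) (a : Z -> R) :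
  summableZ a -> summableZ (fun k => a (k + m)%Z).
Proof. intros H. now apply summableZ_sumZ_shift. Qed.

Lemma sumZ_shift (m : Z) (a : Z -> R) :
  summableZ a -> sumZ (fun k => a (k + m)%Z) = sumZ a.
Proof. intros H. now apply summableZ_sumZ_shift. Qed.

Lemma sumZ_swap (F : Z -> Z -> R) :
  (forall i, summableZ (F i)) ->
  summableZ (fun i => sumZ (fun j => Rabs (F i j))) ->
  (forall j, summableZ (fun i => F i j)) ->
  sumZ (fun j => sumZ (fun i => F i j)) = sumZ (fun i => sumZ (F i)).
Proof.
intros H1 H2 H3.
pose (a := fun i j : nat => fold_at (F (Z.of_nat i)) j + fold_at (F (-1 - Z.of_nat i)%Z) j).
assert (P : forall i, 0 <= sumZ (fun j => Rabs (F i j))).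
{ intros i. apply Series_nonneg; [|apply H1]. intros n. unfold fold_at.
  generalize (Rabs_pos (F i (Z.of_nat n))) (Rabs_pos (F i (-1 - Z.of_nat n)%Z)); lra. }
assert (A1 : forall i, ex_series (fun j => Rabs (a i j))).
{ intros i.
  apply ex_series_dominated with
    (2 := ex_series_Rplus _ _ (H1 (Z.of_nat i)) (H1 (-1 - Z.of_nat i)%Z)).
  intros j. rewrite Rabs_Rabsolu. unfold a.
  eapply Rle_trans; [apply Rabs_triang|]. apply Rplus_le_compat; apply Rabs_triang. }
assert (A2 : ex_series (fun i => Series (fun j => Rabs (a i j)))).
{ apply ex_series_dominated with (2 := H2). intros i.
  rewrite Rabs_pos_eq by (apply Series_nonneg; [intros; apply Rabs_pos|apply A1]).
  unfold fold_at at 1. rewrite !(Rabs_pos_eq (sumZ _)) by apply P.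
  unfold sumZ. rewrite <- Series_plus by apply H1.
  apply Series_le; [|apply ex_series_Rplus; apply H1].
  intros j. split; [apply Rabs_pos|]. unfold a.
  eapply Rle_trans; [apply Rabs_triang|]. apply Rplus_le_compat; apply Rabs_triang. }
destruct (Series_swap a A1 A2) as [_ E].
unfold sumZ at 1 3.
rewrite (Series_ext (fold_at (fun j => sumZ (fun i => F i j)))
  (fun j => Series (fun i => a i j))).
2: { intros j. unfold fold_at at 1, sumZ.
  rewrite <- Series_plus by (apply ex_series_fold, H3).
  apply Series_ext. intros i. unfold a, fold_at. ring. }
rewrite E. apply Series_ext. intros i. unfold fold_at at 1, sumZ.
rewrite <- Series_plus by (apply ex_series_fold, H1). reflexivity.
Qed.

Definition conv (a b : Z -> R) (n : Z) : R := sumZ (fun j => a j * b (n - j)%Z).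

Lemma summableZ_conv_term (a b : Z -> R) (n : Z) :
  summableZ a -> summableZ b -> summableZ (fun j => a j * b (n - j)%Z).
Proof.
intros Ha Hb.
assert (HB : exists M, forall k, Rabs (b k) <= M).
{ exists (Series (fold_at (fun k => Rabs (b k)))).
  assert (Q : forall i, fold_at (fun k => Rabs (b k)) i
    <= Series (fold_at (fun k => Rabs (b k)))).
  { assert (Q0 : forall i, 0 <= fold_at (fun k => Rabs (b k)) i).
    { intros i. unfold fold_at. generalize (Rabs_pos (b (Z.of_nat i)))
      (Rabs_pos (b (-1 - Z.of_nat i)%Z)); lra. }
    intros i. eapply Rle_trans; [|apply sum_n_le_Series with (N := i); trivial].
    destruct i; [rewrite sum_O; lra|]. rewrite sum_Sn. unfold plus; simpl.
    assert (0 <= sum_n (fold_at (fun k => Rabs (b k))) i); [|lra].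
    clear -Q0. induction i; [rewrite sum_O; apply Q0|].
    rewrite sum_Sn; unfold plus; simpl. specialize (Q0 (S i)). lra. }
  apply Z_fold_ind; intros n'; eapply Rle_trans; [|apply (Q n')| |apply (Q n')];
  unfold fold_at; generalize (Rabs_pos (b (Z.of_nat n'))) (Rabs_pos (b (-1 - Z.of_nat n')%Z)); lra. }
destruct HB as [M HM].
apply summableZ_dominated with (2 := summableZ_scal M _ Ha).
intros k. rewrite !Rabs_mult, Rmult_comm.
apply Rmult_le_compat_r; [apply Rabs_pos|].
eapply Rle_trans; [apply HM|apply Rle_abs].
Qed.

(** Fubini for the product family a_j b_m t_(j+m). Taking for t the real and
    imaginary parts of a character turns this into multiplicativity of the
    corresponding complex series. *)
Lemma sumZ_conv_bounded (t a b : Z -> R) :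
  (forall k, Rabs (t k) <= 1) -> summableZ a -> summableZ b ->
  sumZ (fun n => conv a b n * t n) =
  sumZ (fun j => a j * sumZ (fun m => b m * t (m + j)%Z)).
Proof.
intros Ht Ha Hb.
assert (Htb : forall j, summableZ (fun m => b m * t (m + j)%Z))
  by (intros j; now apply summableZ_bounded_mult).
assert (S1 : forall j, summableZ (fun n => a j * (b (n - j)%Z * t n))).
{ intros j. apply summableZ_scal, summableZ_bounded_mult; trivial.
  now apply (summableZ_shift (- j)). }
rewrite (sumZ_ext (fun n => conv a b n * t n)
  (fun n => sumZ (fun j => a j * (b (n - j)%Z * t n)))).
2: { intros n. unfold conv. rewrite Rmult_comm, <- sumZ_scal.
  apply sumZ_ext. intros j. ring. }
rewrite (sumZ_swap (fun j n => a j * (b (n - j)%Z * t n))).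
- apply sumZ_ext. intros j. rewrite sumZ_scal. f_equal.
  rewrite <- (sumZ_shift (- j) (fun m => b m * t (m + j)%Z)) by trivial.
  apply sumZ_ext. intros n. f_equal. f_equal. lia.
- exact S1.
- apply summableZ_dominated with
    (b := fun j => sumZ (fun k => Rabs (b k)) * Rabs (a j)).
  2: now apply summableZ_scal, summableZ_abs.
  intros j.
  assert (Hsj : summableZ (fun n => b (n - j)%Z)) by now apply (summableZ_shift (- j)).
  rewrite Rabs_pos_eq.
  2: { apply Series_nonneg; [|apply (S1 j)]. intros n. unfold fold_at.
    apply Rplus_le_le_0_compat; apply Rabs_pos. }
  rewrite (Rabs_pos_eq (_ * _)).
  2: { apply Rmult_le_pos; [|apply Rabs_pos]. apply Series_nonneg; [|exact Hb].
    intros n. unfold fold_at. apply Rplus_le_le_0_compat; apply Rabs_pos. }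
  rewrite (Rmult_comm (sumZ _)), <- (sumZ_shift (- j) _ (summableZ_abs _ Hb)), <- sumZ_scal.
  apply Series_le.
  2: apply ex_series_fold, summableZ_scal, summableZ_abs; exact Hsj.
  assert (Hle : forall n, Rabs (a j * (b (n - j)%Z * t n)) <= Rabs (a j) * Rabs (b (n + - j)%Z)).
  { intros n. rewrite !Rabs_mult. apply Rmult_le_compat_l; [apply Rabs_pos|].
    rewrite <- (Rmult_1_r (Rabs (b (n + - j)%Z))).
    apply Rmult_le_compat_l; [apply Rabs_pos|apply Ht]. }
  intros n. unfold fold_at. split.
  + apply Rplus_le_le_0_compat; apply Rabs_pos.
  + apply Rplus_le_compat; apply Hle.
- intros n. apply summableZ_ext with (fun j => t n * (a j * b (n - j)%Z));
    [intros; ring|]. now apply summableZ_scal, summableZ_conv_term.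
Qed.

Lemma sumZ_nonneg (a : Z -> R) : (forall k, 0 <= a k) -> summableZ a -> 0 <= sumZ a.
Proof.
intros Hp Ha. apply Series_nonneg; [|now apply ex_series_fold].
intros n. now apply Rplus_le_le_0_compat.
Qed.

Lemma summableZ_swap_nonneg (F : Z -> Z -> R) :
  (forall i j, 0 <= F i j) -> (forall i, summableZ (F i)) ->
  summableZ (fun i => sumZ (F i)) -> (forall j, summableZ (fun i => F i j)) ->
  summableZ (fun j => sumZ (fun i => F i j)).
Proof.
intros Hp H1 H2 H3.
pose (a := fun i j : nat => fold_at (F (Z.of_nat i)) j + fold_at (F (-1 - Z.of_nat i)%Z) j).
destruct (Series_swap_nonneg a) as [_ [E _]].
- intros i j. unfold a, fold_at. repeat apply Rplus_le_le_0_compat; apply Hp.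
- intros i. apply ex_series_Rplus; apply ex_series_fold, H1.
- apply ex_series_Rext with (2 := ex_series_fold _ H2). intros i. unfold fold_at at 1, sumZ, a.
  now rewrite <- Series_plus by apply ex_series_fold, H1.
- apply ex_series_Rext with (2 := E). intros j. unfold fold_at.
  rewrite !Rabs_pos_eq by (apply sumZ_nonneg; [intros; apply Hp|apply H3]).
  unfold sumZ. rewrite <- Series_plus by apply ex_series_fold, H3.
  apply Series_ext. intros i. unfold a, fold_at. ring.
Qed.

(** Needed to split the series of a sum of two convolutions. *)
Lemma summableZ_conv (a b : Z -> R) : summableZ a -> summableZ b -> summableZ (conv a b).
Proof.
intros Ha Hb. apply summableZ_abs in Ha as Ha'. apply summableZ_abs in Hb as Hb'.
assert (Hsj : forall j, summableZ (fun n => Rabs (b (n - j)%Z)))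
  by (intros j; now apply (summableZ_shift (- j) (fun k => Rabs (b k)))).
apply summableZ_dominated with
  (b := fun n => sumZ (fun j => Rabs (a j) * Rabs (b (n - j)%Z))).
- intros n. eapply Rle_trans; [apply sumZ_abs; now apply summableZ_conv_term|].
  eapply Rle_trans; [|apply Rle_abs]. apply Req_le. apply sumZ_ext.
  intros j. apply Rabs_mult.
- apply (summableZ_swap_nonneg (fun j n => Rabs (a j) * Rabs (b (n - j)%Z))).
  + intros i j. apply Rmult_le_pos; apply Rabs_pos.
  + intros j. now apply summableZ_scal.
  + apply summableZ_ext with (fun j => sumZ (fun k => Rabs (b k)) * Rabs (a j)).
    * intros j. rewrite sumZ_scal, Rmult_comm. f_equal. symmetry.
      exact (sumZ_shift (- j) (fun k => Rabs (b k)) Hb').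
    * now apply summableZ_scal.
  + intros n. exact (summableZ_conv_term (fun k => Rabs (a k)) (fun k => Rabs (b k)) n Ha' Hb').
Qed.

(** * Geometric decay *)

(** The bound is stated along the enumeration of [fold_at], so that r is the
    decay rate at both ends. *)
Definition geometric (r : R) (a : Z -> R) : Prop :=
  exists M, forall n : nat,
    Rabs (a (Z.of_nat n)) <= M * r ^ n /\ Rabs (a (-1 - Z.of_nat n)%Z) <= M * r ^ n.

Definition subquadratic (w : Z -> R) : Prop :=
  forall n : nat,
    Rabs (w (Z.of_nat n)) <= (INR n + 1) ^ 2 /\
    Rabs (w (-1 - Z.of_nat n)%Z) <= (INR n + 1) ^ 2.

(** The weights come from two derivations of the series. *)
Lemma ex_series_quadratic_geometric (r : R) :
  0 <= r < 1 -> ex_series (fun n => (INR n + 1) ^ 2 * r ^ n).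
Proof.
intros Hr.
(* For s ^ 4 = r' the factor (n + 1) s ^ n is bounded, by Bernoulli's inequality.
   The rate r' > r is nonzero even if r is not. *)
set (r' := (1 + r) / 2). assert (Hr' : r < r' < 1) by (unfold r'; lra).
set (s := sqrt (sqrt r')).
assert (Hq : 0 < sqrt r' < 1).
{ split; [apply sqrt_lt_R0; lra|]. rewrite <- sqrt_1. apply sqrt_lt_1; lra. }
assert (Hs : 0 < s < 1).
{ split; [apply sqrt_lt_R0; lra|]. unfold s. rewrite <- sqrt_1. apply sqrt_lt_1; lra. }
set (h := / s - 1).
assert (Hh : 0 < h).
{ unfold h. assert (1 < / s); [|lra]. rewrite <- Rinv_1. apply Rinv_lt_contravar; lra. }
assert (Hb : forall n, (INR n + 1) * s ^ n <= 1 + / h).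
{ intros n. pose proof (poly n h Hh) as HB.
  replace (1 + h) with (/ s) in HB by (unfold h; ring).
  rewrite pow_inv in HB.
  assert (Hsn : 0 < s ^ n) by (apply pow_lt; lra).
  apply (Rmult_le_compat_l (s ^ n)) in HB; [|lra].
  rewrite Rinv_r in HB by lra.
  assert (s ^ n <= 1).
  { rewrite <- (pow1 n). apply pow_incr. lra. }
  assert (INR n * s ^ n <= / h); [|lra].
  apply Rmult_le_reg_l with h; [lra|]. rewrite Rinv_r by lra. lra. }
apply ex_series_dominated with (fun n => (1 + / h) ^ 2 * sqrt r' ^ n).
2: { apply ex_series_Rmult. apply ex_series_geom. rewrite Rabs_pos_eq; lra. }
intros n.
assert (H0 : 0 <= r ^ n <= r' ^ n).
{ split; [apply pow_le; lra|apply pow_incr; lra]. }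
assert (Es : r' ^ n = (s ^ n) ^ 2 * sqrt r' ^ n).
{ rewrite <- pow_mult, Nat.mul_comm, pow_mult, <- Rpow_mult_distr. f_equal.
  unfold s. rewrite pow2_sqrt by lra. now rewrite sqrt_sqrt by lra. }
assert (Hn : 0 <= INR n) by apply pos_INR.
rewrite Rabs_pos_eq by (apply Rmult_le_pos; [apply pow_le; lra|apply H0]).
apply Rle_trans with ((INR n + 1) ^ 2 * r' ^ n).
{ apply Rmult_le_compat_l; [apply pow_le; lra|apply H0]. }
rewrite Es, <- Rmult_assoc, <- Rpow_mult_distr.
apply Rmult_le_compat_r; [apply pow_le; lra|].
apply pow_incr. split; [|apply Hb].
apply Rmult_le_pos; [lra|apply pow_le; lra].
Qed.

Lemma summableZ_weighted_geometric (r : R) (w a : Z -> R) :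
  0 <= r < 1 -> subquadratic w -> geometric r a -> summableZ (fun k => w k * a k).
Proof.
intros Hr Hw [M HM]. pose proof (ex_series_quadratic_geometric r Hr) as HE.
apply (ex_series_Rmult M) in HE.
assert (HP : forall u v n, Rabs u <= (INR n + 1) ^ 2 -> Rabs v <= M * r ^ n ->
  Rabs (Rabs (u * v)) <= M * ((INR n + 1) ^ 2 * r ^ n)).
{ intros u v n Hu Hv. rewrite Rabs_Rabsolu, Rabs_mult.
  replace (M * _) with ((INR n + 1) ^ 2 * (M * r ^ n)) by ring.
  apply Rmult_le_compat; trivial; apply Rabs_pos. }
apply summableZ_nat. split; apply ex_series_dominated with (2 := HE);
  intros n; apply HP; apply Hw || apply HM.
Qed.

Lemma subquadratic_1 : subquadratic (fun _ => 1).
Proof.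
intros n. rewrite Rabs_R1. assert (H := pos_INR n).
split; nra.
Qed.

Lemma summableZ_geometric (r : R) (a : Z -> R) :
  0 <= r < 1 -> geometric r a -> summableZ a.
Proof.
intros Hr Ha. apply summableZ_ext with (fun k => 1 * a k); [intros; ring|].
exact (summableZ_weighted_geometric r _ _ Hr subquadratic_1 Ha).
Qed.

Lemma IZR_minus_one_minus (n : nat) : IZR (-1 - Z.of_nat n) = -1 - INR n.
Proof. now rewrite minus_IZR, <- INR_IZR_INZ. Qed.

Lemma subquadratic_index : subquadratic IZR.
Proof.
intros n. rewrite IZR_minus_one_minus, <- INR_IZR_INZ. assert (H := pos_INR n).
split; apply Rabs_le; split; nra.
Qed.

Lemma subquadratic_half_index : subquadratic (fun k => IZR k + / 2).
Proof.
intros n. rewrite IZR_minus_one_minus, <- INR_IZR_INZ. assert (H := pos_INR n).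
split; apply Rabs_le; split; nra.
Qed.

Lemma subquadratic_half_index_sq : subquadratic (fun k => (IZR k + / 2) ^ 2).
Proof.
intros n. rewrite IZR_minus_one_minus, <- INR_IZR_INZ. assert (H := pos_INR n).
split; apply Rabs_le; split; nra.
Qed.

(** * Powers of -1 and of i *)

Definition alt (k : Z) : R := if Z.even k then 1 else -1.
(** [re4] and [im4] are the real and imaginary parts of i^k. A series with real
    coefficients evaluated at i times a real number is handled through its real
    and imaginary parts, [reSum] and [imSum]. *)
Definition re4 (k : Z) : R := cos (IZR k * (PI / 2)).
Definition im4 (k : Z) : R := sin (IZR k * (PI / 2)).

Lemma alt_add (k m : Z) : alt (k + m) = alt k * alt m.
Proof. unfold alt. rewrite Z.even_add. destruct (Z.even k), (Z.even m); simpl; ring. Qed.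

Lemma alt_opp (k : Z) : alt (- k) = alt k.
Proof. unfold alt. now rewrite Z.even_opp. Qed.

Lemma alt_sq (k : Z) : alt k * alt k = 1.
Proof. unfold alt. destruct (Z.even k); ring. Qed.

Lemma alt_nat (n : nat) : alt (Z.of_nat n) = (-1) ^ n.
Proof.
induction n; [reflexivity|].
rewrite Nat2Z.inj_succ, <- Z.add_1_r, alt_add, IHn. unfold alt; simpl. ring.
Qed.

Lemma alt_neg (n : nat) : alt (-1 - Z.of_nat n) = - (-1) ^ n.
Proof.
rewrite <- alt_nat. unfold Z.sub. rewrite alt_add, alt_opp. unfold alt at 1; simpl. ring.
Qed.

Lemma alt_bounded (k : Z) : Rabs (alt k) <= 1.
Proof. unfold alt. destruct (Z.even k); [rewrite Rabs_R1|rewrite Rabs_m1]; lra. Qed.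

Lemma re4_bounded (k : Z) : Rabs (re4 k) <= 1.
Proof. apply Rabs_le, COS_bound. Qed.

Lemma im4_bounded (k : Z) : Rabs (im4 k) <= 1.
Proof. apply Rabs_le, SIN_bound. Qed.

Lemma re4_add (k m : Z) : re4 (k + m) = re4 k * re4 m - im4 k * im4 m.
Proof. unfold re4, im4. rewrite plus_IZR, Rmult_plus_distr_r. apply cos_plus. Qed.

Lemma im4_add (k m : Z) : im4 (k + m) = re4 k * im4 m + im4 k * re4 m.
Proof. unfold re4, im4. rewrite plus_IZR, Rmult_plus_distr_r, sin_plus. ring. Qed.

Lemma re4_opp (k : Z) : re4 (- k) = re4 k.
Proof. unfold re4. rewrite opp_IZR, Ropp_mult_distr_l_reverse. apply cos_neg. Qed.

Lemma im4_opp (k : Z) : im4 (- k) = - im4 k.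
Proof. unfold im4. rewrite opp_IZR, Ropp_mult_distr_l_reverse. apply sin_neg. Qed.

Lemma re4_succ (k : Z) : re4 (k + 1) = - im4 k.
Proof.
rewrite re4_add. unfold re4, im4. rewrite !Rmult_1_l, cos_PI2, sin_PI2. ring.
Qed.

Lemma im4_succ (k : Z) : im4 (k + 1) = re4 k.
Proof.
rewrite im4_add. unfold re4, im4. rewrite !Rmult_1_l, cos_PI2, sin_PI2. ring.
Qed.

Lemma re4_neg (n : nat) : re4 (-1 - Z.of_nat n) = - im4 (Z.of_nat n).
Proof. rewrite <- re4_succ, <- re4_opp. f_equal. lia. Qed.

Lemma im4_neg (n : nat) : im4 (-1 - Z.of_nat n) = - re4 (Z.of_nat n).
Proof. rewrite <- im4_succ, <- im4_opp. f_equal. lia. Qed.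

Lemma re4_im4_double (k : Z) :
  im4 (2 * k) = 0 /\ re4 (2 * k + 1) = 0.
Proof.
assert (H : im4 (2 * k) = 0).
{ unfold im4. rewrite mult_IZR. replace (2 * IZR k * (PI / 2)) with (IZR k * PI) by field.
  apply sin_eq_0_1. now exists k. }
split; [exact H|]. rewrite re4_succ, H. ring.
Qed.

(** Multiplication by (-1)^k conjugates i^k. *)
Lemma alt_re4_im4 (k : Z) : alt k * re4 k = re4 k /\ alt k * im4 k = - im4 k.
Proof.
unfold alt. destruct (Z.even k) eqn:Ev.
- apply Z.even_spec in Ev. destruct Ev as [m ->].
  destruct (re4_im4_double m) as [H _]. rewrite H. split; ring.
- assert (Od : Z.odd k = true) by now rewrite <- Z.negb_even, Ev.
  apply Z.odd_spec in Od. destruct Od as [m ->].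
  destruct (re4_im4_double m) as [_ H]. rewrite H. split; ring.
Qed.

Lemma re4_0 : re4 0 = 1.
Proof. unfold re4. now rewrite Rmult_0_l, cos_0. Qed.

Lemma im4_0 : im4 0 = 0.
Proof. unfold im4. now rewrite Rmult_0_l, sin_0. Qed.

(** The sign pattern of the Lambert series is sqrt 2 cos ((n - 1/2) PI/2); it
    arises when the terms k = n and k = -1 - n are put together. *)
Lemma re4_plus_im4 (n : nat) :
  re4 (Z.of_nat n) + im4 (Z.of_nat n) = (-1) ^ Nat.div n 2.
Proof.
induction n as [[|[|n]] IH] using (well_founded_induction lt_wf).
- simpl Z.of_nat. rewrite re4_0, im4_0. simpl. ring.
- replace (Z.of_nat 1) with (0 + 1)%Z by reflexivity.
  rewrite re4_succ, im4_succ, re4_0, im4_0. simpl. ring.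
- replace (Z.of_nat (S (S n))) with (Z.of_nat n + 1 + 1)%Z by lia.
  rewrite !re4_succ, !im4_succ, re4_succ.
  replace (S (S n)) with (n + 1 * 2)%nat by lia. rewrite Nat.div_add by lia.
  rewrite Nat.add_1_r, <- tech_pow_Rmult, <- (IH n) by lia. ring.
Qed.

Lemma im4_odd (l : nat) : im4 (Z.of_nat (2 * l + 1)) = (-1) ^ l.
Proof.
induction l.
- replace (Z.of_nat (2 * 0 + 1)) with (0 + 1)%Z by reflexivity.
  now rewrite im4_succ, re4_0.
- replace (Z.of_nat (2 * S l + 1)) with (Z.of_nat (2 * l + 1) + 1 + 1)%Z by lia.
  rewrite im4_succ, re4_succ, IHl. simpl. ring.
Qed.

Definition reSum (a : Z -> R) : R := sumZ (fun k => a k * re4 k).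
Definition imSum (a : Z -> R) : R := sumZ (fun k => a k * im4 k).

Lemma reSum_ext (a b : Z -> R) : (forall k, a k = b k) -> reSum a = reSum b.
Proof. intros H. apply sumZ_ext. intros k. now rewrite H. Qed.

Lemma imSum_ext (a b : Z -> R) : (forall k, a k = b k) -> imSum a = imSum b.
Proof. intros H. apply sumZ_ext. intros k. now rewrite H. Qed.

Lemma summableZ_re4 (a : Z -> R) : summableZ a -> summableZ (fun k => a k * re4 k).
Proof. apply summableZ_bounded_mult, re4_bounded. Qed.

Lemma summableZ_im4 (a : Z -> R) : summableZ a -> summableZ (fun k => a k * im4 k).
Proof. apply summableZ_bounded_mult, im4_bounded. Qed.

Lemma reSum_plus (a b : Z -> R) : summableZ a -> summableZ b ->
  reSum (fun k => a k + b k) = reSum a + reSum b.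
Proof.
intros Ha Hb. unfold reSum. rewrite <- sumZ_plus by now apply summableZ_re4.
apply sumZ_ext. intros k. ring.
Qed.

Lemma reSum_scal (c : R) (a : Z -> R) : reSum (fun k => c * a k) = c * reSum a.
Proof. unfold reSum. rewrite <- sumZ_scal. apply sumZ_ext. intros; ring. Qed.

Lemma imSum_scal (c : R) (a : Z -> R) : imSum (fun k => c * a k) = c * imSum a.
Proof. unfold imSum. rewrite <- sumZ_scal. apply sumZ_ext. intros; ring. Qed.

Lemma reSum_conv (a b : Z -> R) : summableZ a -> summableZ b ->
  reSum (conv a b) = reSum a * reSum b - imSum a * imSum b.
Proof.
intros Ha Hb. unfold reSum at 1.
rewrite (sumZ_conv_bounded re4) by (trivial; apply re4_bounded).
rewrite (sumZ_ext _ (fun j => reSum b * (a j * re4 j) - imSum b * (a j * im4 j))).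
- rewrite sumZ_minus, !sumZ_scal; [unfold reSum, imSum; ring| |];
  apply summableZ_scal; [now apply summableZ_re4|now apply summableZ_im4].
- intros j.
  rewrite (sumZ_ext _ (fun m => re4 j * (b m * re4 m) - im4 j * (b m * im4 m)))
    by (intros m; rewrite re4_add; ring).
  rewrite sumZ_minus, !sumZ_scal; [unfold reSum, imSum; ring| |];
  apply summableZ_scal; [now apply summableZ_re4|now apply summableZ_im4].
Qed.

Lemma imSum_conv (a b : Z -> R) : summableZ a -> summableZ b ->
  imSum (conv a b) = reSum a * imSum b + imSum a * reSum b.
Proof.
intros Ha Hb. unfold imSum at 1.
rewrite (sumZ_conv_bounded im4) by (trivial; apply im4_bounded).
rewrite (sumZ_ext _ (fun j => imSum b * (a j * re4 j) + reSum b * (a j * im4 j))).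
- rewrite sumZ_plus, !sumZ_scal; [unfold reSum, imSum; ring| |];
  apply summableZ_scal; [now apply summableZ_re4|now apply summableZ_im4].
- intros j.
  rewrite (sumZ_ext _ (fun m => re4 j * (b m * im4 m) + im4 j * (b m * re4 m)))
    by (intros m; rewrite im4_add; ring).
  rewrite sumZ_plus, !sumZ_scal; [unfold reSum, imSum; ring| |];
  apply summableZ_scal; [now apply summableZ_im4|now apply summableZ_re4].
Qed.

(** For real coefficients, passing from the point Y to -Y on the imaginary axis
    is complex conjugation. *)
Lemma reSum_alt (a : Z -> R) : reSum (fun k => a k * alt k) = reSum a.
Proof.
apply sumZ_ext. intros k. rewrite Rmult_assoc. now destruct (alt_re4_im4 k) as [-> _].
Qed.

Lemma imSum_alt (a : Z -> R) : imSum (fun k => a k * alt k) = - imSum a.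
Proof.
unfold imSum. rewrite <- (Rmult_1_l (sumZ (fun k => a k * im4 k))).
rewrite Ropp_mult_distr_l, <- sumZ_scal. apply sumZ_ext. intros k.
rewrite Rmult_assoc. destruct (alt_re4_im4 k) as [_ ->]. ring.
Qed.

Lemma reSum_pred (a : Z -> R) : summableZ a -> reSum (fun k => a (k - 1)%Z) = - imSum a.
Proof.
intros Ha. unfold reSum, imSum.
rewrite <- (sumZ_shift 1 (fun k => a (k - 1)%Z * re4 k)).
- rewrite <- (Rmult_1_l (sumZ (fun k => a k * im4 k))).
  rewrite Ropp_mult_distr_l, <- sumZ_scal. apply sumZ_ext. intros k.
  rewrite re4_succ. replace (k + 1 - 1)%Z with k by lia. ring.
- apply summableZ_re4. now apply (summableZ_shift (-1)).
Qed.

Lemma imSum_pred (a : Z -> R) : summableZ a -> imSum (fun k => a (k - 1)%Z) = reSum a.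
Proof.
intros Ha. unfold reSum, imSum.
rewrite <- (sumZ_shift 1 (fun k => a (k - 1)%Z * im4 k)).
- apply sumZ_ext. intros k.
  rewrite im4_succ. replace (k + 1 - 1)%Z with k by lia. ring.
- apply summableZ_im4. now apply (summableZ_shift (-1)).
Qed.

(** * Regularized sums *)

Definition step (k : Z) : R := if (0 <=? k)%Z then 1 else 0.

Lemma step_nat (n : nat) : step (Z.of_nat n) = 1.
Proof. unfold step. destruct (Z.leb_spec 0 (Z.of_nat n)); [reflexivity|lia]. Qed.

Lemma step_neg (n : nat) : step (-1 - Z.of_nat n) = 0.
Proof. unfold step. destruct (Z.leb_spec 0 (-1 - Z.of_nat n)); [lia|reflexivity]. Qed.

Definition excess (b : Z -> R) (k : Z) : R := b k - step k.
(** The coefficients below tend to 1 at +oo and to 0 at -oo, so that neither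
    their sum nor their alternating sum converges. Subtracting [step] and adding
    back a conventional value for it repairs both: 0 for the plain sum, and the
    Abel value 1/2 of 1 - 1 + 1 - ... for the alternating one. *)
Definition sigmoid (b : Z -> R) : Prop := summableZ (excess b).

Definition regSum (b : Z -> R) : R := sumZ (excess b).
Definition regAlt (b : Z -> R) : R := / 2 + sumZ (fun k => excess b k * alt k).

Lemma step_pred_support (k : Z) : k <> 0%Z -> step (k - 1) - step k = 0.
Proof.
intros Hk. unfold step.
destruct (Z.leb_spec 0 (k - 1)), (Z.leb_spec 0 k); try lia; ring.
Qed.

Lemma is_series_single (a : nat -> R) : (forall n, a (S n) = 0) -> is_series a (a O).
Proof.
intros H. apply is_series_decr_1.
apply is_series_ext with (fun n => 0 * (/ 2) ^ n).
- intros n. rewrite H. apply Rmult_0_l.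
- unfold plus, opp; simpl. replace (a O + - a O) with (0 * / (1 - / 2)) by ring.
  apply (@is_series_scal R_AbsRing R_NormedModule). apply is_series_geom. rewrite Rabs_pos_eq; lra.
Qed.

Lemma supported_at_0 (a : Z -> R) :
  (forall k, k <> 0%Z -> a k = 0) -> summableZ a /\ sumZ a = a 0%Z.
Proof.
intros H.
assert (E : forall n, fold_at a n = match n with O => a 0%Z | _ => 0 end).
{ intros n. unfold fold_at. rewrite (H (-1 - Z.of_nat n)%Z) by lia.
  destruct n; simpl Z.of_nat; [ring|]. rewrite H by lia. ring. }
split.
- exists (Rabs (a 0%Z)).
  apply is_series_ext with (fun n => match n with O => Rabs (a 0%Z) | _ => 0 end).
  + intros n. unfold fold_at. rewrite (H (-1 - Z.of_nat n)%Z) by lia. rewrite Rabs_R0.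
    destruct n; [symmetry; apply Rplus_0_r|].
    rewrite H by lia. rewrite Rabs_R0. symmetry; apply Rplus_0_r.
  + apply (is_series_single (fun n => match n with O => Rabs (a 0%Z) | _ => 0 end)).
    reflexivity.
- unfold sumZ. rewrite (Series_ext _ _ E). apply is_series_unique.
  apply (is_series_single (fun n => match n with O => a 0%Z | _ => 0 end)). reflexivity.
Qed.

Lemma step_pred_twisted (t : Z -> R) :
  summableZ (fun k => (step (k - 1) - step k) * t k) /\
  sumZ (fun k => (step (k - 1) - step k) * t k) = - t 0%Z.
Proof.
destruct (supported_at_0 (fun k => (step (k - 1) - step k) * t k)) as [H1 H2].
- intros k Hk. rewrite step_pred_support by trivial. ring.
- split; [exact H1|]. rewrite H2. unfold step; simpl. ring.
Qed.

Lemma excess_pred (b : Z -> R) (k : Z) :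
  excess (fun j => b (j - 1)%Z) k = excess b (k - 1) + (step (k - 1) - step k) * 1.
Proof. unfold excess. ring. Qed.

Lemma sigmoid_pred (b : Z -> R) : sigmoid b -> sigmoid (fun k => b (k - 1)%Z).
Proof.
intros Hb. apply summableZ_ext with (1 := fun k => eq_sym (excess_pred b k)).
apply summableZ_plus; [now apply (summableZ_shift (-1))|].
apply (step_pred_twisted (fun _ => 1)).
Qed.

Lemma sigmoid_succ (b : Z -> R) : sigmoid b -> sigmoid (fun k => b (k + 1)%Z).
Proof.
intros Hb. destruct (step_pred_twisted (fun _ => 1)) as [H _].
apply summableZ_ext with
  (fun k => excess b (k + 1) - (step (k + 1 - 1) - step (k + 1)) * 1).
- intros k. unfold excess. replace (k + 1 - 1)%Z with k by lia. ring.
- apply summableZ_minus; [now apply (summableZ_shift 1)|].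
  exact (summableZ_shift 1 _ H).
Qed.

Lemma sigmoid_ext (a b : Z -> R) : (forall k, a k = b k) -> sigmoid a -> sigmoid b.
Proof. intros H. apply summableZ_ext. intros k. unfold excess. now rewrite H. Qed.

Lemma regSum_ext (a b : Z -> R) : (forall k, a k = b k) -> regSum a = regSum b.
Proof. intros H. apply sumZ_ext. intros k. unfold excess. now rewrite H. Qed.

Lemma regAlt_ext (a b : Z -> R) : (forall k, a k = b k) -> regAlt a = regAlt b.
Proof. intros H. unfold regAlt. f_equal. apply sumZ_ext. intros k. unfold excess. now rewrite H. Qed.

Lemma regSum_pred (b : Z -> R) : sigmoid b -> regSum (fun k => b (k - 1)%Z) = regSum b - 1.
Proof.
intros Hb. unfold regSum. rewrite (sumZ_ext _ _ (excess_pred b)).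
rewrite sumZ_plus; [|now apply (summableZ_shift (-1))|apply (step_pred_twisted (fun _ => 1))].
destruct (step_pred_twisted (fun _ => 1)) as [_ ->].
rewrite (sumZ_shift (-1) (excess b) Hb : sumZ (fun k => excess b (k - 1)%Z) = _). ring.
Qed.

Lemma summableZ_alt (a : Z -> R) : summableZ a -> summableZ (fun k => a k * alt k).
Proof. apply summableZ_bounded_mult, alt_bounded. Qed.

Lemma sumZ_alt_pred (a : Z -> R) : summableZ a ->
  sumZ (fun k => a (k - 1)%Z * alt k) = - sumZ (fun k => a k * alt k).
Proof.
intros Ha. rewrite <- (sumZ_shift 1 (fun k => a (k - 1)%Z * alt k)).
- rewrite <- (Rmult_1_l (sumZ (fun k => a k * alt k))).
  rewrite Ropp_mult_distr_l, <- sumZ_scal. apply sumZ_ext. intros k.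
  rewrite alt_add. replace (k + 1 - 1)%Z with k by lia. unfold alt at 2; simpl. ring.
- apply summableZ_alt. now apply (summableZ_shift (-1)).
Qed.

Lemma regAlt_pred (b : Z -> R) : sigmoid b -> regAlt (fun k => b (k - 1)%Z) = - regAlt b.
Proof.
intros Hb. unfold regAlt.
rewrite (sumZ_ext _
  (fun k => excess b (k - 1) * alt k + (step (k - 1) - step k) * alt k)).
2: { intros k. rewrite excess_pred. ring. }
destruct (step_pred_twisted alt) as [H1 H2].
rewrite sumZ_plus; [|apply summableZ_alt; now apply (summableZ_shift (-1))|exact H1].
rewrite H2, sumZ_alt_pred by trivial.
replace (alt 0) with 1 by reflexivity. lra.
Qed.

(** Regularization has a price: a shift by m changes the plain sum by - m, since
    m terms of the step are lost. The alternating sum only picks up the sign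
    (-1)^m, which is what its conventional value 1/2 ensures. *)
Lemma regularized_shift (m : Z) (b : Z -> R) : sigmoid b ->
  sigmoid (fun k => b (k - m)%Z) /\
  regSum (fun k => b (k - m)%Z) = regSum b - IZR m /\
  regAlt (fun k => b (k - m)%Z) = alt m * regAlt b.
Proof.
intros Hb. induction m using Z.peano_ind.
- assert (E : forall k, b k = b (k - 0)%Z) by (intros; f_equal; lia).
  rewrite <- (regSum_ext _ _ E), <- (regAlt_ext _ _ E).
  split; [exact (sigmoid_ext _ _ E Hb)|]. unfold alt; simpl. split; ring.
- destruct IHm as [I1 [I2 I3]].
  assert (E : forall k, b (k - 1 - m)%Z = b (k - Z.succ m)%Z) by (intros; f_equal; lia).
  rewrite <- (regSum_ext _ _ E), <- (regAlt_ext _ _ E).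
  pose proof (regSum_pred _ I1) as J2. pose proof (regAlt_pred _ I1) as J3. cbv beta in J2, J3.
  split; [exact (sigmoid_ext _ _ E (sigmoid_pred _ I1))|].
  rewrite J2, J3, I2, I3, <- Z.add_1_r, plus_IZR, alt_add.
  unfold alt at 3; simpl. split; ring.
- destruct IHm as [I1 [I2 I3]].
  assert (E : forall k, b (k + 1 - m)%Z = b (k - Z.pred m)%Z) by (intros; f_equal; lia).
  assert (E' : forall k, b (k - m)%Z = b (k - 1 + 1 - m)%Z) by (intros; f_equal; lia).
  rewrite <- (regSum_ext _ _ E), <- (regAlt_ext _ _ E).
  assert (J1 : sigmoid (fun k => b (k + 1 - m)%Z)) by exact (sigmoid_succ _ I1).
  pose proof (regSum_pred _ J1) as J2. pose proof (regAlt_pred _ J1) as J3. cbv beta in J2, J3.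
  rewrite <- (regSum_ext _ _ E') in J2. rewrite <- (regAlt_ext _ _ E') in J3.
  split; [exact (sigmoid_ext _ _ E J1)|].
  unfold Z.pred. rewrite plus_IZR, alt_add. unfold alt at 2; simpl. split; lra.
Qed.

Lemma sumZ_sigmoid_minus (a b : Z -> R) : sigmoid a -> sigmoid b ->
  summableZ (fun k => a k - b k) /\
  sumZ (fun k => a k - b k) = regSum a - regSum b /\
  sumZ (fun k => (a k - b k) * alt k) = regAlt a - regAlt b.
Proof.
intros Ha Hb.
assert (E : forall k, excess a k - excess b k = a k - b k) by (intros; unfold excess; ring).
split; [|split].
- apply summableZ_ext with (1 := E). now apply summableZ_minus.
- rewrite <- (sumZ_ext _ _ E). now apply sumZ_minus.
- rewrite (sumZ_ext _ (fun k => excess a k * alt k - excess b k * alt k)).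
  + rewrite sumZ_minus by (now apply summableZ_alt). unfold regAlt. ring.
  + intros k. rewrite <- E. ring.
Qed.

(** * Coefficients and partial fractions *)

(** With q = exp (-x) this is 1/(1 - e q^t), used for e = 1 and e = -1. *)
Definition pole (x e t : R) : R := / (1 - e * exp (- (x * t))).

(** Coefficients of the series of ns, ds and cs: up to a factor, these functions
    are the sums of coefN k y^(2k+1), coefD k y^(2k+1) and coefC k y^(2k) over all
    integers k, where y = exp (i z). *)
Definition coefN (x : R) (k : Z) : R := pole x 1 (2 * IZR k + 1).
Definition coefD (x : R) (k : Z) : R := pole x (-1) (2 * IZR k + 1).
Definition coefC (x : R) (k : Z) : R := pole x (-1) (2 * IZR k).

Lemma pole_opp (x e t : R) : e * e = 1 -> 1 - e * exp (- (x * t)) <> 0 ->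
  pole x e (- t) = 1 - pole x e t.
Proof.
intros He H. unfold pole.
rewrite <- Ropp_mult_distr_r, Ropp_involutive.
assert (Hp : 0 < exp (- (x * t))) by apply exp_pos.
assert (Ei : exp (x * t) = / exp (- (x * t))) by (rewrite exp_Ropp, Rinv_inv; reflexivity).
rewrite Ei. set (u := exp (- (x * t))) in *.
assert (H' : u - e <> 0).
{ intros K. apply H. replace u with e by lra. lra. }
assert (K : e = 1 \/ e = -1) by (assert ((e-1)*(e+1)=0) by nra; destruct (Rmult_integral _ _ H0); lra).
destruct K as [-> | ->]; field; repeat split; lra.
Qed.

(** Partial fractions: with u = e q^s and v = d q^t,
    1/((1 - u)(1 - v)) = 1/(1 - u v) (1/(1 - u) + v/(1 - v)), and v/(1 - v) is
    minus the coefficient at - t. *)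
Lemma pole_mult (x e d s t : R) : d * d = 1 ->
  1 - e * exp (- (x * s)) <> 0 -> 1 - d * exp (- (x * t)) <> 0 ->
  1 - e * d * exp (- (x * (s + t))) <> 0 ->
  pole x e s * pole x d t = pole x (e * d) (s + t) * (pole x e s - pole x d (- t)).
Proof.
intros Hd H1 H2 H3. rewrite pole_opp by trivial. unfold pole.
replace (- (x * (s + t))) with (- (x * s) + - (x * t)) in * by ring.
rewrite exp_plus in *.
field. now repeat split.
Qed.

Lemma pole_minus_nonzero (x t : R) : 1 - -1 * exp (- (x * t)) <> 0.
Proof. generalize (exp_pos (- (x * t))). lra. Qed.

Lemma odd_IZR_nonzero (k : Z) : 2 * IZR k + 1 <> 0.
Proof.
intros H. rewrite <- mult_IZR, <- plus_IZR in H. apply eq_IZR in H. lia.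
Qed.

Lemma pole_plus_nonzero (x : R) (k : Z) : 0 < x ->
  1 - 1 * exp (- (x * (2 * IZR k + 1))) <> 0.
Proof.
intros Hx H. assert (E : exp (- (x * (2 * IZR k + 1))) = exp 0) by (rewrite exp_0; lra).
apply exp_inv in E. pose proof (odd_IZR_nonzero k).
assert (x * (2 * IZR k + 1) = 0) by lra. destruct (Rmult_integral _ _ H1); lra.
Qed.

(** The index j occurs on the right only in a difference of two sigmoids. The sum
    over j is therefore a difference of regularized sums. *)
Lemma coefC_coefD (x : R) (j n : Z) : 0 < x ->
  coefC x j * coefD x (n - j) = coefN x n * (coefC x j - coefD x (j - (n + 1))).
Proof.
intros Hx. unfold coefC, coefD, coefN.
replace (2 * IZR (j - (n + 1)) + 1) with (- (2 * IZR (n - j) + 1))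
  by (rewrite !minus_IZR, plus_IZR; ring).
rewrite pole_mult; try apply pole_minus_nonzero; [|ring|].
- f_equal. f_equal; [ring|rewrite minus_IZR; ring].
- replace (2 * IZR j + (2 * IZR (n - j) + 1)) with (2 * IZR n + 1)
    by (rewrite minus_IZR; ring).
  replace (-1 * -1) with 1 by ring. now apply pole_plus_nonzero.
Qed.

Lemma coefN_coefD (x : R) (j n : Z) : 0 < x ->
  coefN x j * coefD x (n - j) = coefC x (n + 1) * (coefN x j - coefD x (j - (n + 1))).
Proof.
intros Hx. unfold coefC, coefD, coefN.
replace (2 * IZR (j - (n + 1)) + 1) with (- (2 * IZR (n - j) + 1))
  by (rewrite !minus_IZR, plus_IZR; ring).
rewrite pole_mult; try apply pole_minus_nonzero; [|ring| |].
- f_equal. f_equal; [ring|rewrite minus_IZR, plus_IZR; ring].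
- now apply pole_plus_nonzero.
- rewrite Rmult_1_l. apply pole_minus_nonzero.
Qed.

Lemma coefN_coefC (x : R) (j n : Z) : 0 < x ->
  coefN x j * coefC x (n - j) = coefD x n * (coefN x j - coefC x (j - n)).
Proof.
intros Hx. unfold coefC, coefD, coefN.
replace (2 * IZR (j - n)) with (- (2 * IZR (n - j))) by (rewrite !minus_IZR; ring).
rewrite pole_mult; try apply pole_minus_nonzero; [|ring| |].
- f_equal. f_equal; [ring|rewrite minus_IZR; ring].
- now apply pole_plus_nonzero.
- rewrite Rmult_1_l. apply pole_minus_nonzero.
Qed.

Lemma coefC_coefN (x : R) (j n : Z) : 0 < x ->
  coefC x j * coefN x (n - j) = coefD x n * (coefC x j - coefN x (j - (n + 1))).
Proof.
intros Hx. unfold coefC, coefD, coefN.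
replace (2 * IZR (j - (n + 1)) + 1) with (- (2 * IZR (n - j) + 1))
  by (rewrite !minus_IZR, plus_IZR; ring).
rewrite pole_mult; try apply pole_minus_nonzero; [|ring| |].
- f_equal. f_equal; [ring|rewrite minus_IZR; ring].
- now apply pole_plus_nonzero.
- rewrite Rmult_1_r. apply pole_minus_nonzero.
Qed.

(** [bose] and [fermi] are q^t/(1 - q^t) and q^t/(1 + q^t), the deviations of
    1/(1 - q^t) and 1/(1 + q^t) from 1 up to sign. *)
Definition bose (x t : R) : R := / (exp (x * t) - 1).
Definition fermi (x t : R) : R := / (exp (x * t) + 1).

Lemma exp_pow (y : R) (n : nat) : exp y ^ n = exp (INR n * y).
Proof.
induction n.
- simpl. now rewrite Rmult_0_l, exp_0.
- rewrite <- tech_pow_Rmult, IHn, <- exp_plus. f_equal. rewrite S_INR. ring.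
Qed.

Lemma exp_gt_1 (y : R) : 0 < y -> 1 < exp y.
Proof. intros H. rewrite <- exp_0. now apply exp_increasing. Qed.

Lemma excess_coefN (x : R) (n : nat) : 0 < x ->
  excess (coefN x) (Z.of_nat n) = bose x (2 * INR n + 1) /\
  excess (coefN x) (-1 - Z.of_nat n) = - bose x (2 * INR n + 1).
Proof.
intros Hx. unfold excess. rewrite step_nat, step_neg.
unfold coefN. rewrite IZR_minus_one_minus, <- INR_IZR_INZ.
replace (2 * (-1 - INR n) + 1) with (- (2 * INR n + 1)) by ring.
assert (Hn : 0 < x * (2 * INR n + 1)) by (generalize (pos_INR n); nra).
pose proof (exp_gt_1 _ Hn) as He.
unfold bose, pole.
rewrite <- Ropp_mult_distr_r, Ropp_involutive, exp_Ropp.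
split; field; lra.
Qed.

Lemma excess_coefD (x : R) (n : nat) : 0 < x ->
  excess (coefD x) (Z.of_nat n) = - fermi x (2 * INR n + 1) /\
  excess (coefD x) (-1 - Z.of_nat n) = fermi x (2 * INR n + 1).
Proof.
intros Hx. unfold excess. rewrite step_nat, step_neg.
unfold coefD. rewrite IZR_minus_one_minus, <- INR_IZR_INZ.
replace (2 * (-1 - INR n) + 1) with (- (2 * INR n + 1)) by ring.
pose proof (exp_pos (x * (2 * INR n + 1))) as He.
unfold fermi, pole.
rewrite <- Ropp_mult_distr_r, Ropp_involutive, exp_Ropp.
split; field; lra.
Qed.

Lemma excess_coefC (x : R) (n : nat) : 0 < x ->
  excess (coefC x) (Z.of_nat n) = - fermi x (2 * INR n) /\
  excess (coefC x) (-1 - Z.of_nat n) = fermi x (2 * INR (S n)).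
Proof.
intros Hx. unfold excess. rewrite step_nat, step_neg.
unfold coefC. rewrite IZR_minus_one_minus, <- INR_IZR_INZ.
replace (2 * (-1 - INR n)) with (- (2 * INR (S n))) by (rewrite S_INR; ring).
pose proof (exp_pos (x * (2 * INR n))) as He.
pose proof (exp_pos (x * (2 * INR (S n)))) as He'.
unfold fermi, pole.
rewrite <- Ropp_mult_distr_r, Ropp_involutive, exp_Ropp.
split; field; lra.
Qed.

Lemma fermi_bound (x t : R) : 0 < fermi x t <= exp (- (x * t)).
Proof.
unfold fermi. rewrite exp_Ropp. pose proof (exp_pos (x * t)).
split; [apply Rinv_0_lt_compat; lra|]. apply Rinv_le_contravar; lra.
Qed.

Lemma bose_bound (x : R) (n : nat) : 0 < x ->
  0 < bose x (2 * INR n + 1) <= / (exp x - 1) * exp (- (2 * x)) ^ n.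
Proof.
intros Hx. unfold bose. pose proof (exp_gt_1 x Hx) as H1.
replace (x * (2 * INR n + 1)) with (x + INR n * (2 * x)) by ring.
rewrite exp_plus, exp_Ropp, pow_inv, exp_pow.
assert (H2 : 1 <= exp (INR n * (2 * x))).
{ rewrite <- exp_0. destruct (Req_dec (INR n * (2 * x)) 0) as [->|K]; [lra|].
  left. apply exp_increasing. generalize (pos_INR n); nra. }
rewrite <- Rinv_mult. split; [apply Rinv_0_lt_compat; nra|].
apply Rinv_le_contravar; nra.
Qed.

Lemma geometric_intro (M r : R) (a : Z -> R) :
  (forall n, Rabs (a (Z.of_nat n)) <= M * r ^ n) ->
  (forall n, Rabs (a (-1 - Z.of_nat n)%Z) <= M * r ^ n) -> geometric r a.
Proof. intros H1 H2. exists M. intros n. split; auto. Qed.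

Lemma geometric_excess_coefN (x : R) : 0 < x ->
  geometric (exp (- (2 * x))) (excess (coefN x)).
Proof.
intros Hx. apply geometric_intro with (/ (exp x - 1)); intros n;
destruct (excess_coefN x n Hx) as [E1 E2]; rewrite ?E1, ?E2;
destruct (bose_bound x n Hx); rewrite ?Rabs_Ropp, Rabs_pos_eq; lra.
Qed.

Lemma exp_odd_bound (x : R) (n : nat) : 0 < x ->
  exp (- (x * (2 * INR n + 1))) <= 1 * exp (- (2 * x)) ^ n.
Proof.
intros Hx. rewrite exp_pow, Rmult_1_l.
left. apply exp_increasing. lra.
Qed.

Lemma geometric_excess_coefD (x : R) : 0 < x ->
  geometric (exp (- (2 * x))) (excess (coefD x)).
Proof.
intros Hx. apply geometric_intro with 1; intros n;
destruct (excess_coefD x n Hx) as [E1 E2]; rewrite ?E1, ?E2;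
destruct (fermi_bound x (2 * INR n + 1));
pose proof (exp_odd_bound x n Hx); rewrite ?Rabs_Ropp, Rabs_pos_eq; lra.
Qed.

Lemma geometric_excess_coefC (x : R) : 0 < x ->
  geometric (exp (- (2 * x))) (excess (coefC x)).
Proof.
intros Hx. apply geometric_intro with 1; intros n;
destruct (excess_coefC x n Hx) as [E1 E2]; rewrite ?E1, ?E2, exp_pow, Rmult_1_l;
[destruct (fermi_bound x (2 * INR n)) | destruct (fermi_bound x (2 * INR (S n)))];
rewrite ?Rabs_Ropp, Rabs_pos_eq by lra.
- replace (INR n * - (2 * x)) with (- (x * (2 * INR n))) by ring. lra.
- apply Rle_trans with (1 := H0). left. apply exp_increasing. rewrite S_INR. lra.
Qed.

Lemma exp_neg_range (y : R) : 0 < y -> 0 <= exp (- y) < 1.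
Proof.
intros H. split; [left; apply exp_pos|]. rewrite <- exp_0. apply exp_increasing. lra.
Qed.

Lemma sigmoid_geometric (x : R) (b : Z -> R) : 0 < x ->
  geometric (exp (- (2 * x))) (excess b) -> sigmoid b.
Proof. intros Hx. apply summableZ_geometric. apply exp_neg_range. lra. Qed.

(** * Convolutions of damped coefficients *)

(** This is rho^k for rho = exp (- x tau), a radius that tends to 1 from below
    with tau -> 0+. *)
Definition weight (x tau : R) (k : Z) : R := exp (- (x * tau * IZR k)).

Definition damp (x tau : R) (b : Z -> R) (k : Z) : R := b k * weight x tau k.

Lemma weight_add (x tau : R) (k m : Z) :
  weight x tau (k + m) = weight x tau k * weight x tau m.
Proof. unfold weight. rewrite plus_IZR, <- exp_plus. f_equal. ring. Qed.

Lemma weight_split (x tau : R) (j n : Z) :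
  weight x tau j * weight x tau (n - j) = weight x tau n.
Proof. rewrite <- weight_add. f_equal. lia. Qed.

(** Both convolutions of two damped sigmoids come down to their regularized sums
    as soon as the products of coefficients split by partial fractions. *)
Lemma conv_damp (x tau : R) (a b : Z -> R) (K : R) (n m : Z) :
  sigmoid a -> sigmoid b ->
  (forall j, a j * b (n - j)%Z = K * (a j - b (j - m)%Z)) ->
  conv (damp x tau a) (damp x tau b) n =
    (regSum a - regSum b + IZR m) * (K * weight x tau n) /\
  conv (damp x tau a) (fun k => damp x tau b k * alt k) n =
    (regAlt a - alt m * regAlt b) * alt n * (K * weight x tau n).
Proof.
intros Ha Hb H. destruct (regularized_shift m b Hb) as [S1 [S2 S3]].
destruct (sumZ_sigmoid_minus a _ Ha S1) as [T1 [T2 T3]].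
rewrite S2 in T2. rewrite S3 in T3. unfold conv, damp.
split.
- replace (regSum a - regSum b + IZR m) with (regSum a - (regSum b - IZR m)) by ring.
  rewrite <- T2, Rmult_comm, <- sumZ_scal.
  apply sumZ_ext. intros j. rewrite <- (weight_split x tau j n).
  transitivity (a j * b (n - j)%Z * (weight x tau j * weight x tau (n - j))); [ring|].
  rewrite H. ring.
- rewrite <- T3.
  rewrite (Rmult_comm (sumZ _)), Rmult_assoc, (Rmult_comm (sumZ _)), <- Rmult_assoc,
    <- sumZ_scal.
  apply sumZ_ext. intros j. rewrite <- (weight_split x tau j n).
  transitivity (a j * b (n - j)%Z * (weight x tau j * weight x tau (n - j)) * alt (n - j)); [ring|].
  rewrite H. unfold Z.sub at 3. rewrite alt_add, alt_opp. ring.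
Qed.

(** By oddness the terms k and -1 - k of the excess cancel. *)
Lemma regSum_coefN (x : R) : 0 < x -> regSum (coefN x) = 0.
Proof.
intros Hx. unfold regSum, sumZ.
rewrite (Series_ext _ (fun _ => 0 * 0)).
- rewrite Series_scal_l. ring.
- intros n. unfold fold_at. destruct (excess_coefN x n Hx) as [-> ->]. ring.
Qed.

Lemma regSum_coefD (x : R) : 0 < x -> regSum (coefD x) = 0.
Proof.
intros Hx. unfold regSum, sumZ.
rewrite (Series_ext _ (fun _ => 0 * 0)).
- rewrite Series_scal_l. ring.
- intros n. unfold fold_at. destruct (excess_coefD x n Hx) as [-> ->]. ring.
Qed.

Lemma fermi_0 (x : R) : fermi x (2 * INR 0) = / 2.
Proof. unfold fermi. simpl INR. rewrite !Rmult_0_r, exp_0. f_equal; ring. Qed.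

Lemma is_lim_seq_fermi (x : R) : 0 < x -> is_lim_seq (fun n => fermi x (2 * INR n)) 0.
Proof.
intros Hx.
apply is_lim_seq_le_le with (fun _ => 0) (fun n => exp (- (2 * x)) ^ n).
- intros n. destruct (fermi_bound x (2 * INR n)) as [H1 H2].
  rewrite exp_pow. replace (INR n * - (2 * x)) with (- (x * (2 * INR n))) by ring. lra.
- apply is_lim_seq_const.
- apply is_lim_seq_geom. destruct (exp_neg_range (2 * x)); [lra|].
  rewrite Rabs_pos_eq; lra.
Qed.

(** The end term of the telescoping sums below. *)
Lemma is_lim_seq_bounded_fermi (x : R) (t : nat -> R) :
  0 < x -> (forall n, Rabs (t n) <= 1) ->
  is_lim_seq (fun n => - (t n * fermi x (2 * INR n))) 0.
Proof.
intros Hx Ht. apply is_lim_seq_abs_0.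
apply is_lim_seq_le_le with (fun _ => 0) (fun n => fermi x (2 * INR n)).
- intros n. split; [apply Rabs_pos|]. rewrite Rabs_Ropp, Rabs_mult.
  destruct (fermi_bound x (2 * INR n)) as [H1 _].
  rewrite (Rabs_pos_eq (fermi _ _)) by lra.
  rewrite <- (Rmult_1_l (fermi x (2 * INR n))) at 2.
  apply Rmult_le_compat_r; [lra|apply Ht].
- apply is_lim_seq_const.
- now apply is_lim_seq_fermi.
Qed.

(** The excess telescopes to minus the central value 1/2. *)
Lemma regSum_coefC (x : R) : 0 < x -> regSum (coefC x) = - / 2.
Proof.
intros Hx. unfold regSum, sumZ. rewrite <- (fermi_0 x).
rewrite <- (Rmult_1_l (fermi x (2 * INR 0))).
apply is_series_unique.
apply is_series_ext with (2 := is_series_telescope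
  (fun n => - (1 * fermi x (2 * INR n)))
  (is_lim_seq_bounded_fermi x (fun _ => 1) Hx (fun _ => Req_le _ _ Rabs_R1))).
intros n. unfold fold_at. destruct (excess_coefC x n Hx) as [-> ->].
set (u := fermi _ _). set (v := fermi _ _). simpl. ring.
Qed.

(** As functions of q these are the theta products theta3(q)^2, theta4(q)^2,
    theta3(q) theta3(q^2) and theta4(q) theta3(q^2). They are also the values
    A = N(PI/2), B = D(PI/2), P = N(PI/4)/sqrt 2 and Q = D(PI/4)/sqrt 2. *)
Definition lambertA (x : R) : R :=
  1 + 4 * Series (fun n => (-1) ^ n * bose x (2 * INR n + 1)).
Definition lambertB (x : R) : R :=
  1 - 4 * Series (fun n => (-1) ^ n * fermi x (2 * INR n + 1)).
Definition lambertP (x : R) : R :=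
  1 + 2 * Series (fun n => (-1) ^ Nat.div n 2 * bose x (2 * INR n + 1)).
Definition lambertQ (x : R) : R :=
  1 - 2 * Series (fun n => (-1) ^ Nat.div n 2 * fermi x (2 * INR n + 1)).
Definition lambertS (x : R) : R :=
  Series (fun n => (-1) ^ Nat.div n 2 * (2 * INR n + 1) ^ 2 * bose x (2 * INR n + 1)).

Lemma regAlt_coefN (x : R) : 0 < x -> regAlt (coefN x) = lambertA x / 2.
Proof.
intros Hx. unfold regAlt, lambertA, sumZ.
rewrite (Series_ext _ (fun n => 2 * ((-1) ^ n * bose x (2 * INR n + 1)))).
- rewrite Series_scal_l. field.
- intros n. unfold fold_at. rewrite alt_nat, alt_neg.
  destruct (excess_coefN x n Hx) as [-> ->]. ring.
Qed.

Lemma regAlt_coefD (x : R) : 0 < x -> regAlt (coefD x) = lambertB x / 2.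
Proof.
intros Hx. unfold regAlt, lambertB, sumZ.
rewrite (Series_ext _ (fun n => -2 * ((-1) ^ n * fermi x (2 * INR n + 1)))).
- rewrite Series_scal_l. field.
- intros n. unfold fold_at. rewrite alt_nat, alt_neg.
  destruct (excess_coefD x n Hx) as [-> ->]. ring.
Qed.

Lemma regAlt_coefC (x : R) : 0 < x -> regAlt (coefC x) = 0.
Proof.
intros Hx. unfold regAlt.
assert (H : sumZ (fun k => excess (coefC x) k * alt k) = - ((-1) ^ 0 * fermi x (2 * INR 0))).
2: { rewrite H, fermi_0. simpl. ring. }
apply is_series_unique.
apply is_series_ext with (2 := is_series_telescope
  (fun n => - ((-1) ^ n * fermi x (2 * INR n)))
  (is_lim_seq_bounded_fermi x (fun n => (-1) ^ n) Hx (fun n => Req_le _ _ (pow_1_abs n)))).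
intros n. unfold fold_at. rewrite alt_nat, alt_neg.
destruct (excess_coefC x n Hx) as [-> ->].
set (u := fermi _ _). set (v := fermi _ _). simpl. ring.
Qed.

Lemma sigmoid_coefs (x : R) : 0 < x ->
  sigmoid (coefN x) /\ sigmoid (coefD x) /\ sigmoid (coefC x).
Proof.
intros Hx. repeat split; apply (sigmoid_geometric x); trivial;
[apply geometric_excess_coefN|apply geometric_excess_coefD|apply geometric_excess_coefC];
trivial.
Qed.

(** The first identity is N' = - C D in terms of coefficients. The second one is
    the product of C(z) and D(z + PI/2). *)
Lemma conv_C_D (x tau : R) (n : Z) : 0 < x ->
  conv (damp x tau (coefC x)) (damp x tau (coefD x)) n =
    (IZR n + / 2) * damp x tau (coefN x) n /\
  conv (damp x tau (coefC x)) (fun k => damp x tau (coefD x) k * alt k) n =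
    lambertB x / 2 * damp x tau (coefN x) n.
Proof.
intros Hx. destruct (sigmoid_coefs x Hx) as [HN [HD HC]].
destruct (conv_damp x tau _ _ (coefN x n) n (n + 1) HC HD
  (fun j => coefC_coefD x j n Hx)) as [-> ->].
rewrite regSum_coefC, regSum_coefD, regAlt_coefC, regAlt_coefD by trivial.
unfold damp. rewrite plus_IZR, alt_add. unfold alt at 2; simpl. split; [field|].
transitivity (lambertB x / 2 * (coefN x n * weight x tau n) * (alt n * alt n)); [ring|].
rewrite alt_sq. ring.
Qed.

Lemma conv_C_N_alt (x tau : R) (n : Z) : 0 < x ->
  conv (damp x tau (coefC x)) (fun k => damp x tau (coefN x) k * alt k) n =
    lambertA x / 2 * damp x tau (coefD x) n.
Proof.
intros Hx. destruct (sigmoid_coefs x Hx) as [HN [HD HC]].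
destruct (conv_damp x tau _ _ (coefD x n) n (n + 1) HC HN
  (fun j => coefC_coefN x j n Hx)) as [_ ->].
rewrite regAlt_coefC, regAlt_coefN by trivial.
unfold damp. rewrite alt_add. unfold alt at 2; simpl.
transitivity (lambertA x / 2 * (coefD x n * weight x tau n) * (alt n * alt n)); [ring|].
rewrite alt_sq. ring.
Qed.

Lemma conv_N_D (x tau : R) (n : Z) : 0 < x ->
  conv (damp x tau (coefN x)) (damp x tau (coefD x)) n =
    IZR (n + 1) * (coefC x (n + 1) * weight x tau n).
Proof.
intros Hx. destruct (sigmoid_coefs x Hx) as [HN [HD HC]].
destruct (conv_damp x tau _ _ (coefC x (n + 1)) n (n + 1) HN HD
  (fun j => coefN_coefD x j n Hx)) as [-> _].
rewrite regSum_coefN, regSum_coefD by trivial. ring.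
Qed.

Lemma conv_N_C (x tau : R) (n : Z) : 0 < x ->
  conv (damp x tau (coefN x)) (damp x tau (coefC x)) n =
    (IZR n + / 2) * damp x tau (coefD x) n.
Proof.
intros Hx. destruct (sigmoid_coefs x Hx) as [HN [HD HC]].
destruct (conv_damp x tau _ _ (coefD x n) n n HN HC
  (fun j => coefN_coefC x j n Hx)) as [-> _].
rewrite regSum_coefN, regSum_coefC by trivial. unfold damp. ring.
Qed.

Lemma weight_nat (x tau : R) (n : nat) : weight x tau (Z.of_nat n) = exp (- (x * tau)) ^ n.
Proof. unfold weight. rewrite exp_pow, <- INR_IZR_INZ. f_equal. ring. Qed.

Lemma weight_neg (x tau : R) (n : nat) :
  weight x tau (-1 - Z.of_nat n) = exp (x * tau) * exp (x * tau) ^ n.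
Proof.
unfold weight. rewrite exp_pow, IZR_minus_one_minus, <- exp_plus. f_equal. ring.
Qed.

Lemma exp_nondecreasing (y z : R) : y <= z -> exp y <= exp z.
Proof. intros [H | ->]; [left; now apply exp_increasing|apply Rle_refl]. Qed.

(** The excess decays like q^(2|k|) whereas the damping grows at most like q^(-|k|)
    at -oo. The bound is uniform in tau, as dominated convergence requires. *)
Lemma damp_excess_bound (x : R) (s : Z -> R) : 0 < x ->
  geometric (exp (- (2 * x))) s ->
  exists M, 0 <= M /\ forall tau n, 0 <= tau <= 1 ->
    Rabs (damp x tau s (Z.of_nat n)) <= M * exp (- x) ^ n /\
    Rabs (damp x tau s (-1 - Z.of_nat n)) <= M * exp (- x) ^ n.
Proof.
intros Hx [M HM].
assert (HM0 : 0 <= M).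
{ destruct (HM O) as [H _]. simpl in H. generalize (Rabs_pos (s 0%Z)). lra. }
assert (Hex : 1 < exp x) by now apply exp_gt_1.
exists (M * exp x). split; [nra|].
intros tau n Ht. destruct (HM n) as [H1 H2]. unfold damp.
assert (Hr : 0 <= exp (- (2 * x)) ^ n) by (apply pow_le; left; apply exp_pos).
assert (He : exp (- (2 * x)) ^ n = exp (- x) ^ n * exp (- x) ^ n).
{ rewrite <- Rpow_mult_distr, <- exp_plus. do 2 f_equal. ring. }
assert (Hle : 0 <= exp (- x) ^ n <= 1).
{ destruct (exp_neg_range x Hx). split; [now apply pow_le|].
  rewrite <- (pow1 n). apply pow_incr. lra. }
rewrite !Rabs_mult, !(Rabs_pos_eq (weight _ _ _)) by (left; apply exp_pos).
assert (Hxt : 0 <= x * tau <= x) by nra.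
split.
- assert (Hw : 0 <= weight x tau (Z.of_nat n) <= 1).
  { split; [left; apply exp_pos|]. rewrite weight_nat.
    rewrite <- (pow1 n). apply pow_incr. split; [left; apply exp_pos|].
    rewrite <- exp_0. apply exp_nondecreasing. lra. }
  apply Rle_trans with (M * exp (- (2 * x)) ^ n * 1).
  + apply Rmult_le_compat; trivial; try apply Rabs_pos; apply Hw.
  + rewrite He. set (u := exp (- x) ^ n) in *.
    assert (u * u <= u) by nra.
    assert (M * (u * u) <= M * u) by (apply Rmult_le_compat_l; lra).
    assert (0 <= M * u) by (apply Rmult_le_pos; lra). nra.
- assert (Hw : 0 <= weight x tau (-1 - Z.of_nat n) <= exp x * exp x ^ n).
  { split; [left; apply exp_pos|]. rewrite weight_neg.
    assert (K : 0 <= exp (x * tau) <= exp x)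
      by (split; [left; apply exp_pos|apply exp_nondecreasing; lra]).
    apply Rmult_le_compat; try apply K; [apply pow_le, K|apply pow_incr, K]. }
  apply Rle_trans with (M * exp (- (2 * x)) ^ n * (exp x * exp x ^ n)).
  + apply Rmult_le_compat; trivial; try apply Rabs_pos; apply Hw.
  + rewrite He.
    assert (E1 : exp (- x) ^ n * exp x ^ n = 1).
    { rewrite <- Rpow_mult_distr, <- exp_plus.
      replace (- x + x) with 0 by ring. rewrite exp_0. apply pow1. }
    apply Req_le.
    transitivity (M * exp x * exp (- x) ^ n * (exp (- x) ^ n * exp x ^ n)); [ring|].
    rewrite E1. ring.
Qed.

Lemma geometric_damp (x tau : R) (b : Z -> R) : 0 < x -> 0 < tau <= 1 ->
  geometric (exp (- (2 * x))) (excess b) ->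
  geometric (exp (- (x * tau))) (damp x tau b).
Proof.
intros Hx Ht Hb. destruct (damp_excess_bound x _ Hx Hb) as [M [HM0 HM]].
assert (Hc : forall n, 0 <= exp (- x) ^ n <= exp (- (x * tau)) ^ n).
{ intros n. split; [apply pow_le; left; apply exp_pos|].
  apply pow_incr. split; [left; apply exp_pos|]. apply exp_nondecreasing. nra. }
apply geometric_intro with (1 + M); intros n; destruct (HM tau n) as [H1 H2];
  [lra| |lra|]; specialize (Hc n).
- replace (damp x tau b (Z.of_nat n)) with
    (damp x tau (excess b) (Z.of_nat n) + exp (- (x * tau)) ^ n).
  2: { unfold damp, excess. rewrite step_nat, weight_nat. ring. }
  eapply Rle_trans; [apply Rabs_triang|].
  rewrite (Rabs_pos_eq (_ ^ _)) by lra. nra.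
- replace (damp x tau b (-1 - Z.of_nat n)) with
    (damp x tau (excess b) (-1 - Z.of_nat n)).
  2: { unfold damp, excess. rewrite step_neg. ring. }
  nra.
Qed.

(** * Product formulas inside the annulus *)

Lemma damp_geometric_coefs (x tau : R) : 0 < x -> 0 < tau <= 1 ->
  geometric (exp (- (x * tau))) (damp x tau (coefN x)) /\
  geometric (exp (- (x * tau))) (damp x tau (coefD x)) /\
  geometric (exp (- (x * tau))) (damp x tau (coefC x)).
Proof.
intros Hx Ht. repeat split; apply geometric_damp; trivial;
[apply geometric_excess_coefN|apply geometric_excess_coefD|apply geometric_excess_coefC];
trivial.
Qed.

Lemma geometric_summable_weights (r : R) (a : Z -> R) : 0 <= r < 1 -> geometric r a ->
  summableZ a /\ summableZ (fun k => IZR k * a k) /\ summableZ (fun k => (IZR k + / 2) * a k).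
Proof.
intros Hr Ha. split; [|split].
- now apply (summableZ_geometric r).
- exact (summableZ_weighted_geometric r _ a Hr subquadratic_index Ha).
- exact (summableZ_weighted_geometric r _ a Hr subquadratic_half_index Ha).
Qed.

Definition reN x tau := reSum (damp x tau (coefN x)).
Definition imN x tau := imSum (damp x tau (coefN x)).
Definition reD x tau := reSum (damp x tau (coefD x)).
Definition imD x tau := imSum (damp x tau (coefD x)).
Definition reC x tau := reSum (damp x tau (coefC x)).
Definition imC x tau := imSum (damp x tau (coefC x)).

(** C(z) N(z + PI/2) = A D(z) and C(z) D(z + PI/2) = B N(z) near z = PI/4; the
    shift by PI/2 shows as a conjugation, by [reSum_alt]. *)
Lemma phiC_conj_phi (x tau : R) : 0 < x -> 0 < tau <= 1 ->
  reC x tau * reN x tau + imC x tau * imN x tau = lambertA x / 2 * reD x tau /\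
  reC x tau * reD x tau + imC x tau * imD x tau = lambertB x / 2 * reN x tau.
Proof.
intros Hx Ht. destruct (damp_geometric_coefs x tau Hx Ht) as [GN [GD GC]].
assert (Hr : 0 <= exp (- (x * tau)) < 1) by (apply exp_neg_range; nra).
destruct (geometric_summable_weights _ _ Hr GN) as [SN _].
destruct (geometric_summable_weights _ _ Hr GD) as [SD _].
destruct (geometric_summable_weights _ _ Hr GC) as [SC _].
unfold reC, imC, reN, imN, reD, imD. split.
- rewrite <- (reSum_scal (lambertA x / 2)), <- (reSum_ext _ _ (fun n => conv_C_N_alt x tau n Hx)).
  rewrite reSum_conv, reSum_alt, imSum_alt by (trivial; now apply summableZ_alt). ring.
- rewrite <- (reSum_scal (lambertB x / 2)),
    <- (reSum_ext _ _ (fun n => proj2 (conv_C_D x tau n Hx))).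
  rewrite reSum_conv, reSum_alt, imSum_alt by (trivial; now apply summableZ_alt). ring.
Qed.

(** The real part of N'' = N (C^2 + D^2), near z = PI/4. In the variable
    Y = y^2 = i rho it reads
    sum (k + 1/2)^2 coefN k Y^k = PhiN (Y PhiD^2 + PhiC^2). *)
Lemma second_moment_phiN (x tau : R) : 0 < x -> 0 < tau <= 1 ->
  reSum (fun k => (IZR k + / 2) ^ 2 * damp x tau (coefN x) k) =
  - weight x tau 1 *
    ((reN x tau * imD x tau + imN x tau * reD x tau) * reD x tau +
     (reN x tau * reD x tau - imN x tau * imD x tau) * imD x tau) +
  reC x tau * (reN x tau * reC x tau - imN x tau * imC x tau) -
  imC x tau * (reN x tau * imC x tau + imN x tau * reC x tau).
Proof.
intros Hx Ht. destruct (damp_geometric_coefs x tau Hx Ht) as [GN [GD GC]].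
assert (Hr : 0 <= exp (- (x * tau)) < 1) by (apply exp_neg_range; nra).
destruct (geometric_summable_weights _ _ Hr GN) as [SN _].
destruct (geometric_summable_weights _ _ Hr GD) as [SD [_ ShD]].
destruct (geometric_summable_weights _ _ Hr GC) as [SC [SkC _]].
(* the weight k + 1/2 is a derivation for the convolution of C and D *)
assert (L : forall n, (IZR n + / 2) ^ 2 * damp x tau (coefN x) n =
  conv (fun k => IZR k * damp x tau (coefC x) k) (damp x tau (coefD x)) n +
  conv (damp x tau (coefC x)) (fun k => (IZR k + / 2) * damp x tau (coefD x) k) n).
{ intros n.
  transitivity ((IZR n + / 2) * conv (damp x tau (coefC x)) (damp x tau (coefD x)) n).
  { destruct (conv_C_D x tau n Hx) as [-> _]. ring. }
  unfold conv. rewrite <- sumZ_plus.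
  - rewrite <- sumZ_scal. apply sumZ_ext. intros j. rewrite minus_IZR. ring.
  - exact (summableZ_conv_term _ _ n SkC SD).
  - exact (summableZ_conv_term _ _ n SC ShD). }
rewrite (reSum_ext _ _ L), reSum_plus by now apply summableZ_conv.
rewrite !reSum_conv by trivial.
(* C' and D' are again products; the shift of index in C' = - N D costs a
   factor Y *)
pose proof (summableZ_conv _ _ SN SD) as SND.
assert (EC : forall k, IZR k * damp x tau (coefC x) k =
  weight x tau 1 * conv (damp x tau (coefN x)) (damp x tau (coefD x)) (k - 1)).
{ intros k. rewrite conv_N_D by trivial. replace (k - 1 + 1)%Z with k by lia.
  unfold damp. replace (weight x tau k) with (weight x tau (k - 1) * weight x tau 1).
  - ring.
  - rewrite <- weight_add. f_equal. lia. }
rewrite (reSum_ext _ _ EC), (imSum_ext _ _ EC), reSum_scal, imSum_scal.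
rewrite reSum_pred, imSum_pred, reSum_conv, imSum_conv by trivial.
assert (ED : forall k, (IZR k + / 2) * damp x tau (coefD x) k =
  conv (damp x tau (coefN x)) (damp x tau (coefC x)) k)
  by (intros k; now rewrite conv_N_C).
rewrite (reSum_ext _ _ ED), (imSum_ext _ _ ED), reSum_conv, imSum_conv by trivial.
unfold reC, imC, reN, imN, reD, imD. ring.
Qed.

(** * Abel limits at the boundary of the annulus *)

Definition tau_seq (i : nat) : R := / (INR i + 1).

Lemma tau_range (i : nat) : 0 < tau_seq i <= 1.
Proof.
unfold tau_seq. assert (H := pos_INR i). split; [apply Rinv_0_lt_compat; lra|].
rewrite <- Rinv_1. apply Rinv_le_contravar; lra.
Qed.

Lemma is_lim_seq_tau : is_lim_seq tau_seq 0.
Proof.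
apply is_lim_seq_ext with (fun i => / INR (S i)).
- intros i. unfold tau_seq. now rewrite S_INR.
- apply (is_lim_seq_incr_1 (fun i => / INR i)).
  apply (is_lim_seq_inv _ p_infty); [apply is_lim_seq_INR|discriminate].
Qed.

Lemma is_lim_seq_weight (x : R) (k : Z) : is_lim_seq (fun i => weight x (tau_seq i) k) 1.
Proof.
unfold weight. rewrite <- exp_0.
apply (is_lim_seq_continuous exp).
- apply derivable_continuous_pt, derivable_pt_exp.
- apply is_lim_seq_ext with (fun i => (- (x * IZR k)) * tau_seq i); [intros; ring|].
  replace (Finite 0) with (Rbar_mult (- (x * IZR k)) 0) by (simpl; f_equal; ring).
  apply is_lim_seq_scal_l, is_lim_seq_tau.
Qed.

Lemma is_lim_seq_damped_sum (x : R) (w s t : Z -> R) : 0 < x -> subquadratic w ->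
  (forall k, Rabs (t k) <= 1) -> geometric (exp (- (2 * x))) s ->
  is_lim_seq (fun i => sumZ (fun k => w k * damp x (tau_seq i) s k * t k))
    (sumZ (fun k => w k * s k * t k)).
Proof.
intros Hx Hw Ht Hs. destruct (damp_excess_bound x s Hx Hs) as [M [HM0 HM]].
unfold sumZ.
apply is_lim_seq_Series_dominated with
  (fun n => 2 * M * ((INR n + 1) ^ 2 * exp (- x) ^ n)).
- assert (HP : forall u v y n, Rabs u <= (INR n + 1) ^ 2 -> Rabs v <= M * exp (- x) ^ n ->
    Rabs y <= 1 -> Rabs (u * v * y) <= M * ((INR n + 1) ^ 2 * exp (- x) ^ n)).
  { intros u v y n Hu Hv Hy. rewrite !Rabs_mult.
    replace (M * _) with ((INR n + 1) ^ 2 * (M * exp (- x) ^ n) * 1) by ring.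
    repeat apply Rmult_le_compat; trivial; try apply Rabs_pos.
    apply Rmult_le_pos; apply Rabs_pos. }
  intros i n. unfold fold_at. destruct (Hw n) as [W1 W2].
  destruct (HM (tau_seq i) n) as [B1 B2]; [generalize (tau_range i); lra|].
  eapply Rle_trans; [apply Rabs_triang|].
  generalize (HP _ _ _ n W1 B1 (Ht (Z.of_nat n))) (HP _ _ _ n W2 B2 (Ht (-1 - Z.of_nat n)%Z)).
  lra.
- apply ex_series_Rmult, ex_series_quadratic_geometric. now apply exp_neg_range.
- assert (HL : forall k, is_lim_seq (fun i => w k * damp x (tau_seq i) s k * t k)
    (w k * s k * t k)).
  { intros k. apply is_lim_seq_ext with (fun i => (w k * s k * t k) * weight x (tau_seq i) k).
    - intros i. unfold damp. ring.
    - replace (Finite (w k * s k * t k)) with (Rbar_mult (w k * s k * t k) 1)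
        by (simpl; f_equal; ring).
      apply is_lim_seq_scal_l, is_lim_seq_weight. }
  intros n. apply is_lim_seq_plus'; apply HL.
Qed.

Lemma re4_nat_S (n : nat) : re4 (Z.of_nat (S n)) = - im4 (Z.of_nat n).
Proof. rewrite <- re4_succ. f_equal. lia. Qed.

Lemma im4_nat_S (n : nat) : im4 (Z.of_nat (S n)) = re4 (Z.of_nat n).
Proof. rewrite <- im4_succ. f_equal. lia. Qed.

Lemma ex_series_moment (r : R) (w t : nat -> R) : 0 <= r < 1 ->
  (forall n, Rabs (w n) <= (INR n + 1) ^ 2) -> (forall n, Rabs (t n) <= 1) ->
  ex_series (fun n => w n * r ^ n * t n).
Proof.
intros Hr Hw Ht. apply ex_series_dominated with (2 := ex_series_quadratic_geometric r Hr).
intros n. rewrite !Rabs_mult, <- (Rmult_1_r ((INR n + 1) ^ 2 * r ^ n)).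
assert (0 <= r ^ n) by (apply pow_le; lra). rewrite (Rabs_pos_eq (r ^ n)) by trivial.
repeat apply Rmult_le_compat; trivial; try apply Rabs_pos; try lra.
apply Rmult_le_pos; [apply Rabs_pos|trivial].
Qed.

(** The series of (i r)^n and of its moments: each is tied to the lower ones by
    separating the term n = 0 and shifting the index, since i^(n+1) = i i^n. *)
Lemma twisted_geometric_moments (r : R) : 0 <= r < 1 ->
  Series (fun n => 1 * r ^ n * re4 (Z.of_nat n)) = / (1 + r ^ 2) /\
  Series (fun n => 1 * r ^ n * im4 (Z.of_nat n)) = r / (1 + r ^ 2) /\
  Series (fun n => (INR n + / 2) ^ 2 * r ^ n * re4 (Z.of_nat n)) =
    - 4 * r ^ 2 * (1 - r ^ 2) / (1 + r ^ 2) ^ 3 - 2 * r ^ 2 / (1 + r ^ 2) ^ 2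
    + / (1 + r ^ 2) / 4.
Proof.
intros Hr.
pose (c := fun n => re4 (Z.of_nat n)). pose (s := fun n => im4 (Z.of_nat n)).
assert (Hc : forall n, Rabs (c n) <= 1) by (intros; apply re4_bounded).
assert (Hs : forall n, Rabs (s n) <= 1) by (intros; apply im4_bounded).
assert (W0 : forall n : nat, Rabs 1 <= (INR n + 1) ^ 2).
{ intros n. rewrite Rabs_R1. generalize (pos_INR n). nra. }
assert (W1 : forall n : nat, Rabs (INR n) <= (INR n + 1) ^ 2).
{ intros n. generalize (pos_INR n). intros H. rewrite Rabs_pos_eq; nra. }
assert (W2 : forall n : nat, Rabs (INR n ^ 2) <= (INR n + 1) ^ 2).
{ intros n. generalize (pos_INR n). intros H. rewrite Rabs_pos_eq; nra. }
pose proof (ex_series_moment r _ c Hr W0 Hc) as Ec0.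
pose proof (ex_series_moment r _ s Hr W0 Hs) as Es0.
pose proof (ex_series_moment r _ c Hr W1 Hc) as Ec1.
pose proof (ex_series_moment r _ s Hr W1 Hs) as Es1.
pose proof (ex_series_moment r _ c Hr W2 Hc) as Ec2.
pose proof (ex_series_moment r _ s Hr W2 Hs) as Es2.
set (X0 := Series (fun n => 1 * r ^ n * c n)). set (Y0 := Series (fun n => 1 * r ^ n * s n)).
set (X1 := Series (fun n => INR n * r ^ n * c n)).
set (Y1 := Series (fun n => INR n * r ^ n * s n)).
set (X2 := Series (fun n => INR n ^ 2 * r ^ n * c n)).
set (Y2 := Series (fun n => INR n ^ 2 * r ^ n * s n)).
assert (c0 : c O = 1) by apply re4_0. assert (s0 : s O = 0) by apply im4_0.
assert (cS : forall n, c (S n) = - s n) by apply re4_nat_S.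
assert (sS : forall n, s (S n) = c n) by apply im4_nat_S.
assert (Q0 : X0 = 1 - r * Y0).
{ unfold X0 at 1. rewrite Series_incr_1, c0 by trivial.
  rewrite (Series_ext _ (fun n => - r * (1 * r ^ n * s n)))
    by (intros; rewrite cS, <- tech_pow_Rmult; ring).
  rewrite Series_scal_l. fold Y0. simpl. ring. }
assert (R0 : Y0 = r * X0).
{ unfold Y0 at 1. rewrite Series_incr_1, s0 by trivial.
  rewrite (Series_ext _ (fun n => r * (1 * r ^ n * c n)))
    by (intros; rewrite sS, <- tech_pow_Rmult; ring).
  rewrite Series_scal_l. fold X0. simpl. ring. }
assert (Q1 : X1 = - r * (Y1 + Y0)).
{ unfold X1 at 1. rewrite Series_incr_1, c0 by trivial.
  rewrite (Series_ext _ (fun n => - r * (INR n * r ^ n * s n + 1 * r ^ n * s n)))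
    by (intros; rewrite cS, <- (tech_pow_Rmult r), S_INR; ring).
  rewrite Series_scal_l, Series_plus by trivial. fold Y0 Y1. simpl. ring. }
assert (R1 : Y1 = r * (X1 + X0)).
{ unfold Y1 at 1. rewrite Series_incr_1, s0 by trivial.
  rewrite (Series_ext _ (fun n => r * (INR n * r ^ n * c n + 1 * r ^ n * c n)))
    by (intros; rewrite sS, <- (tech_pow_Rmult r), S_INR; ring).
  rewrite Series_scal_l, Series_plus by trivial. fold X0 X1. simpl. ring. }
assert (Q2 : X2 = - r * (Y2 + (2 * Y1 + Y0))).
{ unfold X2 at 1. rewrite Series_incr_1, c0 by trivial.
  rewrite (Series_ext _ (fun n => - r * (INR n ^ 2 * r ^ n * s n +
     (2 * (INR n * r ^ n * s n) + 1 * r ^ n * s n))))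
    by (intros; rewrite cS, <- (tech_pow_Rmult r), S_INR; ring).
  rewrite Series_scal_l, Series_plus, Series_plus, Series_scal_l; trivial;
  try apply ex_series_Rplus; try apply ex_series_Rmult; trivial.
  fold Y0 Y1 Y2. simpl. ring. }
assert (R2 : Y2 = r * (X2 + (2 * X1 + X0))).
{ unfold Y2 at 1. rewrite Series_incr_1, s0 by trivial.
  rewrite (Series_ext _ (fun n => r * (INR n ^ 2 * r ^ n * c n +
     (2 * (INR n * r ^ n * c n) + 1 * r ^ n * c n))))
    by (intros; rewrite sS, <- (tech_pow_Rmult r), S_INR; ring).
  rewrite Series_scal_l, Series_plus, Series_plus, Series_scal_l; trivial;
  try apply ex_series_Rplus; try apply ex_series_Rmult; trivial.
  fold X0 X1 X2. simpl. ring. }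
assert (Hd : 0 < 1 + r ^ 2) by nra.
assert (EX0 : X0 = / (1 + r ^ 2)).
{ rewrite R0 in Q0. apply Rmult_eq_reg_r with (1 + r ^ 2); [|lra].
  rewrite Rinv_l by lra. lra. }
assert (EY0 : Y0 = r / (1 + r ^ 2)) by (rewrite R0, EX0; reflexivity).
assert (EX1 : X1 = - 2 * r ^ 2 / (1 + r ^ 2) ^ 2).
{ rewrite R1, EX0, EY0 in Q1. apply Rmult_eq_reg_r with (1 + r ^ 2); [|lra].
  transitivity (X1 + r ^ 2 * X1); [ring|]. rewrite Q1 at 1. field. lra. }
assert (EX2 : X2 = - 4 * r ^ 2 * (1 - r ^ 2) / (1 + r ^ 2) ^ 3).
{ rewrite R2, R1, EX1, EX0, EY0 in Q2. apply Rmult_eq_reg_r with (1 + r ^ 2); [|lra].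
  transitivity (X2 + r ^ 2 * X2); [ring|]. rewrite Q2 at 1. field. lra. }
split; [exact EX0|split; [exact EY0|]].
rewrite (Series_ext _ (fun n => INR n ^ 2 * r ^ n * c n +
   (INR n * r ^ n * c n + / 4 * (1 * r ^ n * c n)))) by (intros; unfold c; field).
rewrite Series_plus, Series_plus, Series_scal_l; trivial;
  try apply ex_series_Rplus; try apply ex_series_Rmult; trivial.
fold X0 X1 X2. rewrite EX0, EX1, EX2. field. lra.
Qed.

Lemma sumZ_damped_step (x tau : R) (w t : Z -> R) :
  sumZ (fun k => w k * damp x tau step k * t k) =
  Series (fun n => w (Z.of_nat n) * exp (- (x * tau)) ^ n * t (Z.of_nat n)).
Proof.
apply Series_ext. intros n. unfold fold_at, damp.
rewrite step_nat, step_neg, weight_nat. ring.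
Qed.

Lemma is_lim_seq_rho (x : R) : is_lim_seq (fun i => exp (- (x * tau_seq i))) 1.
Proof.
apply is_lim_seq_ext with (2 := is_lim_seq_weight x 1).
intros i. unfold weight. f_equal. ring.
Qed.

Lemma is_lim_seq_rho_continuous (x : R) (f : R -> R) :
  (forall r, ex_derive f r) -> is_lim_seq (fun i => f (exp (- (x * tau_seq i)))) (f 1).
Proof.
intros Hf. apply (is_lim_seq_continuous f); [|apply is_lim_seq_rho].
apply continuity_pt_filterlim. apply (@ex_derive_continuous R_AbsRing R_NormedModule), Hf.
Qed.

Lemma damp_summable_parts (x tau : R) (b w t : Z -> R) : 0 < x -> 0 < tau <= 1 ->
  geometric (exp (- (2 * x))) (excess b) -> subquadratic w -> (forall k, Rabs (t k) <= 1) ->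
  sumZ (fun k => w k * damp x tau b k * t k) =
  sumZ (fun k => w k * damp x tau step k * t k) +
  sumZ (fun k => w k * damp x tau (excess b) k * t k).
Proof.
intros Hx Ht Hb Hw Htb.
assert (Hr : 0 <= exp (- (x * tau)) < 1) by (apply exp_neg_range; nra).
assert (S1 : summableZ (fun k => w k * damp x tau step k * t k)).
{ apply summableZ_bounded_mult; trivial.
  apply (summableZ_weighted_geometric _ _ _ Hr Hw). apply geometric_damp; trivial.
  apply geometric_intro with 0; intros n; unfold excess;
  rewrite Rminus_diag, Rabs_R0; lra. }
assert (S2 : summableZ (fun k => w k * damp x tau b k * t k)).
{ apply summableZ_bounded_mult; trivial.
  apply (summableZ_weighted_geometric _ _ _ Hr Hw). now apply geometric_damp. }
rewrite (sumZ_ext (fun k => w k * damp x tau (excess b) k * t k)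
  (fun k => w k * damp x tau b k * t k - w k * damp x tau step k * t k)).
- rewrite sumZ_minus by trivial. ring.
- intros k. unfold damp, excess. ring.
Qed.

(** Only the step part can lose its convergence at radius 1; the excess part
    converges by domination. *)
Lemma abel_limit (x l : R) (b w t : Z -> R) : 0 < x ->
  geometric (exp (- (2 * x))) (excess b) -> subquadratic w -> (forall k, Rabs (t k) <= 1) ->
  is_lim_seq (fun i => sumZ (fun k => w k * damp x (tau_seq i) step k * t k)) l ->
  is_lim_seq (fun i => sumZ (fun k => w k * damp x (tau_seq i) b k * t k))
    (l + sumZ (fun k => w k * excess b k * t k)).
Proof.
intros Hx Hb Hw Ht Hl.
apply is_lim_seq_ext with (fun i =>
  sumZ (fun k => w k * damp x (tau_seq i) step k * t k) +
  sumZ (fun k => w k * damp x (tau_seq i) (excess b) k * t k)).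
- intros i. symmetry. apply damp_summable_parts; trivial. apply tau_range.
- apply is_lim_seq_plus'; [exact Hl|]. now apply is_lim_seq_damped_sum.
Qed.

(** The limits are the real and imaginary parts of 1/(1 - Y) at Y = i, and the real
    part there of the rational function that the series of (k + 1/2)^2 Y^k sums to. *)
Lemma step_limits (x : R) : 0 < x ->
  is_lim_seq (fun i => sumZ (fun k => 1 * damp x (tau_seq i) step k * re4 k)) (/ 2) /\
  is_lim_seq (fun i => sumZ (fun k => 1 * damp x (tau_seq i) step k * im4 k)) (/ 2) /\
  is_lim_seq (fun i => sumZ (fun k => (IZR k + / 2) ^ 2 * damp x (tau_seq i) step k * re4 k))
    (- (3 / 8)).
Proof.
intros Hx.
assert (Hr : forall i, 0 <= exp (- (x * tau_seq i)) < 1).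
{ intros i. apply exp_neg_range. generalize (tau_range i). nra. }
split; [|split].
- replace (/ 2) with (/ (1 + 1 ^ 2)) by (f_equal; ring).
  eapply is_lim_seq_ext.
  2: apply (is_lim_seq_rho_continuous x (fun r => / (1 + r ^ 2))).
  + intros i. rewrite sumZ_damped_step.
    now destruct (twisted_geometric_moments _ (Hr i)) as [-> _].
  + intros r. auto_derive. nra.
- replace (/ 2) with (1 / (1 + 1 ^ 2)) by field.
  eapply is_lim_seq_ext.
  2: apply (is_lim_seq_rho_continuous x (fun r => r / (1 + r ^ 2))).
  + intros i. rewrite sumZ_damped_step.
    now destruct (twisted_geometric_moments _ (Hr i)) as [_ [-> _]].
  + intros r. auto_derive. nra.
- replace (- (3 / 8)) with (- 4 * 1 ^ 2 * (1 - 1 ^ 2) / (1 + 1 ^ 2) ^ 3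
    - 2 * 1 ^ 2 / (1 + 1 ^ 2) ^ 2 + / (1 + 1 ^ 2) / 4) by field.
  eapply is_lim_seq_ext.
  2: apply (is_lim_seq_rho_continuous x (fun r => - 4 * r ^ 2 * (1 - r ^ 2) / (1 + r ^ 2) ^ 3
    - 2 * r ^ 2 / (1 + r ^ 2) ^ 2 + / (1 + r ^ 2) / 4)).
  + intros i. rewrite sumZ_damped_step.
    destruct (twisted_geometric_moments _ (Hr i)) as [_ [_ <-]].
    apply Series_ext. intros n. now rewrite <- INR_IZR_INZ.
  + intros r. auto_derive. assert (0 < 1 + r ^ 2) by nra.
    repeat split; try lra; simpl in *; nra.
Qed.

Lemma abel_limits_phi (x : R) (b : Z -> R) : 0 < x ->
  geometric (exp (- (2 * x))) (excess b) ->
  is_lim_seq (fun i => reSum (damp x (tau_seq i) b)) (/ 2 + reSum (excess b)) /\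
  is_lim_seq (fun i => imSum (damp x (tau_seq i) b)) (/ 2 + imSum (excess b)).
Proof.
intros Hx Hb. destruct (step_limits x Hx) as [L1 [L2 _]].
assert (E : forall a t, sumZ (fun k => 1 * a k * t k) = sumZ (fun k => a k * t k))
  by (intros; apply sumZ_ext; intros; ring).
split.
- unfold reSum. rewrite <- E.
  eapply is_lim_seq_ext; [intros i; apply E|].
  apply (abel_limit x _ b (fun _ => 1)); trivial; [apply subquadratic_1|apply re4_bounded].
- unfold imSum. rewrite <- E.
  eapply is_lim_seq_ext; [intros i; apply E|].
  apply (abel_limit x _ b (fun _ => 1)); trivial; [apply subquadratic_1|apply im4_bounded].
Qed.

(** The terms k = n and k = -1 - n of the excess are opposite, and i^n, i^(-1-n)
    combine to the sign pattern + + - -. *)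
Lemma excess_sums_N (x : R) : 0 < x ->
  / 2 + reSum (excess (coefN x)) = lambertP x / 2 /\
  / 2 + imSum (excess (coefN x)) = lambertP x / 2.
Proof.
intros Hx. unfold lambertP.
assert (H : reSum (excess (coefN x)) =
   Series (fun n => (-1) ^ Nat.div n 2 * bose x (2 * INR n + 1)) /\
   imSum (excess (coefN x)) =
   Series (fun n => (-1) ^ Nat.div n 2 * bose x (2 * INR n + 1))).
{ split; apply Series_ext; intros n; unfold fold_at;
  rewrite <- re4_plus_im4, ?re4_neg, ?im4_neg;
  destruct (excess_coefN x n Hx) as [-> ->]; ring. }
destruct H as [-> ->]. split; field.
Qed.

Lemma excess_sums_D (x : R) : 0 < x ->
  / 2 + reSum (excess (coefD x)) = lambertQ x / 2 /\
  / 2 + imSum (excess (coefD x)) = lambertQ x / 2.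
Proof.
intros Hx. unfold lambertQ.
assert (H : reSum (excess (coefD x)) =
   Series (fun n => -1 * ((-1) ^ Nat.div n 2 * fermi x (2 * INR n + 1))) /\
   imSum (excess (coefD x)) =
   Series (fun n => -1 * ((-1) ^ Nat.div n 2 * fermi x (2 * INR n + 1)))).
{ split; apply Series_ext; intros n; unfold fold_at;
  rewrite <- re4_plus_im4, ?re4_neg, ?im4_neg;
  destruct (excess_coefD x n Hx) as [-> ->]; ring. }
destruct H as [-> ->]. rewrite Series_scal_l. split; field.
Qed.

(** The real part telescopes. In the imaginary part each term occurs twice, and
    only odd indices survive: these give the Lambert series of B at 2x. *)
Lemma excess_sums_C (x : R) : 0 < x ->
  / 2 + reSum (excess (coefC x)) = 0 /\
  / 2 + imSum (excess (coefC x)) = lambertB (2 * x) / 2.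
Proof.
intros Hx. split.
- assert (H : reSum (excess (coefC x)) = - (re4 (Z.of_nat 0) * fermi x (2 * INR 0))).
  { apply is_series_unique.
    apply is_series_ext with (2 := is_series_telescope
      (fun n => - (re4 (Z.of_nat n) * fermi x (2 * INR n)))
      (is_lim_seq_bounded_fermi x (fun n => re4 (Z.of_nat n)) Hx (fun n => re4_bounded _))).
    intros n. unfold fold_at. rewrite re4_neg, re4_nat_S.
    destruct (excess_coefC x n Hx) as [-> ->].
    set (u := fermi _ _). set (v := fermi _ _). simpl. ring. }
  rewrite H, fermi_0. simpl Z.of_nat. rewrite re4_0. lra.
- pose (V := fun n => im4 (Z.of_nat n) * fermi x (2 * INR n)).
  assert (HV0 : V O = 0) by (unfold V; simpl Z.of_nat; rewrite im4_0; ring).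
  assert (EV : ex_series V).
  { apply ex_series_dominated with (fun n => exp (- (2 * x)) ^ n).
    - intros n. unfold V. rewrite Rabs_mult.
      destruct (fermi_bound x (2 * INR n)) as [H1 H2].
      rewrite (Rabs_pos_eq (fermi _ _)) by lra. rewrite exp_pow.
      replace (INR n * - (2 * x)) with (- (x * (2 * INR n))) by ring.
      rewrite <- (Rmult_1_l (exp _)).
      apply Rmult_le_compat; try lra; [apply Rabs_pos|apply im4_bounded].
    - apply ex_series_geom. destruct (exp_neg_range (2 * x)); [lra|].
      rewrite Rabs_pos_eq; lra. }
  assert (H : imSum (excess (coefC x)) = - 2 * Series V).
  { transitivity (Series (fun n => - (V n + V (S n)))).
    - apply Series_ext. intros n. unfold fold_at, V. rewrite im4_neg, im4_nat_S.
      destruct (excess_coefC x n Hx) as [-> ->]. ring.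
    - rewrite Series_opp, Series_plus; [|trivial|now apply ex_series_incr_1 in EV].
      rewrite (Series_incr_1_aux V HV0). ring. }
  rewrite H, (Series_odd_terms V EV).
  + unfold lambertB. rewrite (Series_ext _ (fun n => (-1) ^ n * fermi (2 * x) (2 * INR n + 1))).
    * field.
    * intros n. unfold V. rewrite im4_odd. f_equal.
      unfold fermi. do 3 f_equal. rewrite plus_INR, mult_INR. simpl. ring.
  + intros n. unfold V. replace (Z.of_nat (2 * n)) with (2 * Z.of_nat n)%Z by lia.
    destruct (re4_im4_double (Z.of_nat n)) as [-> _]. ring.
Qed.

Lemma excess_second_moment_N (x : R) : 0 < x ->
  sumZ (fun k => (IZR k + / 2) ^ 2 * excess (coefN x) k * re4 k) = lambertS x / 4.
Proof.
intros Hx. unfold lambertS.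
replace (Series _ / 4) with (/ 4 * Series (fun n : nat => (-1) ^ Nat.div n 2 * (2 * INR n + 1) ^ 2 *
  bose x (2 * INR n + 1))) by (unfold Rdiv; apply Rmult_comm).
rewrite <- Series_scal_l. apply Series_ext. intros n. unfold fold_at.
rewrite IZR_minus_one_minus, <- INR_IZR_INZ, <- re4_plus_im4, re4_neg.
destruct (excess_coefN x n Hx) as [-> ->]. field.
Qed.

(** At Y = i the sums for N, D and C take the values P (1 + i)/2, Q (1 + i)/2 and
    i B(2x)/2. The three relations are the limits of the product formulas. *)
Lemma lambert_relations (x : R) : 0 < x ->
  lambertB (2 * x) * lambertP x = lambertA x * lambertQ x /\
  lambertB (2 * x) * lambertQ x = lambertB x * lambertP x /\
  3 - 2 * lambertS x = lambertP x * (2 * lambertQ x ^ 2 + lambertB (2 * x) ^ 2).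
Proof.
intros Hx.
assert (GN := geometric_excess_coefN x Hx). assert (GD := geometric_excess_coefD x Hx).
assert (GC := geometric_excess_coefC x Hx).
destruct (abel_limits_phi x _ Hx GN) as [N1 N2].
destruct (abel_limits_phi x _ Hx GD) as [D1 D2].
destruct (abel_limits_phi x _ Hx GC) as [C1 C2].
destruct (excess_sums_N x Hx) as [EN1 EN2]. rewrite EN1 in N1. rewrite EN2 in N2.
destruct (excess_sums_D x Hx) as [ED1 ED2]. rewrite ED1 in D1. rewrite ED2 in D2.
destruct (excess_sums_C x Hx) as [EC1 EC2]. rewrite EC1 in C1. rewrite EC2 in C2.
destruct (step_limits x Hx) as [_ [_ L3]].
pose proof (abel_limit x _ _ _ _ Hx GN subquadratic_half_index_sq re4_bounded L3) as W.
rewrite excess_second_moment_N in W by trivial.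
pose proof (is_lim_seq_weight x 1) as Rh.
assert (U : forall (u v : nat -> R) (l m : R), (forall i, u i = v i) ->
  is_lim_seq u l -> is_lim_seq v m -> l = m).
{ intros u v l m E Hu Hv. apply is_lim_seq_ext with (1 := E) in Hu.
  apply is_lim_seq_unique in Hu. apply is_lim_seq_unique in Hv.
  rewrite Hu in Hv. now injection Hv. }
split; [|split].
- assert (K : 0 * (lambertP x / 2) + lambertB (2 * x) / 2 * (lambertP x / 2) =
    lambertA x / 2 * (lambertQ x / 2)); [|lra].
  eapply U.
  + intros i. exact (proj1 (phiC_conj_phi x (tau_seq i) Hx (tau_range i))).
  + apply is_lim_seq_plus'; apply is_lim_seq_mult'; assumption.
  + apply is_lim_seq_mult'; [apply is_lim_seq_const|assumption].
- assert (K : 0 * (lambertQ x / 2) + lambertB (2 * x) / 2 * (lambertQ x / 2) =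
    lambertB x / 2 * (lambertP x / 2)); [|lra].
  eapply U.
  + intros i. exact (proj2 (phiC_conj_phi x (tau_seq i) Hx (tau_range i))).
  + apply is_lim_seq_plus'; apply is_lim_seq_mult'; assumption.
  + apply is_lim_seq_mult'; [apply is_lim_seq_const|assumption].
- set (P := lambertP x) in *. set (Q := lambertQ x) in *. set (B := lambertB (2 * x)) in *.
  assert (K : - (3 / 8) + lambertS x / 4 =
    - (1) * ((P / 2 * (Q / 2) + P / 2 * (Q / 2)) * (Q / 2) +
     (P / 2 * (Q / 2) - P / 2 * (Q / 2)) * (Q / 2)) +
    0 * (P / 2 * 0 - P / 2 * (B / 2)) -
    B / 2 * (P / 2 * (B / 2) + P / 2 * 0)); [|lra].
  eapply U.
  + intros i. exact (second_moment_phiN x (tau_seq i) Hx (tau_range i)).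
  + exact W.
  + repeat first [ assumption | apply is_lim_seq_plus' | apply is_lim_seq_minus'
      | apply is_lim_seq_mult'
      | match goal with |- is_lim_seq _ (Finite (- ?c)) => apply (is_lim_seq_opp _ c) end ].
Qed.

(** * Doubling x *)

Lemma lambert_exp_odd (x : R) (n : nat) : 0 < x ->
  exp x <= exp (x * (2 * INR n + 1)) /\
  exp (x * (2 * INR n + 1)) < exp (x * (2 * INR (S n) + 1)).
Proof.
intros Hx. rewrite S_INR. assert (H := pos_INR n). split.
- apply exp_nondecreasing. nra.
- apply exp_increasing. nra.
Qed.

Lemma ex_series_bose (x : R) : 0 < x -> ex_series (fun n => bose x (2 * INR n + 1)).
Proof.
intros Hx.
apply ex_series_dominated with (fun n => / (exp x - 1) * exp (- (2 * x)) ^ n).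
- intros n. destruct (bose_bound x n Hx). rewrite Rabs_pos_eq; lra.
- apply ex_series_Rmult, ex_series_geom. destruct (exp_neg_range (2 * x)); [lra|].
  rewrite Rabs_pos_eq; lra.
Qed.

Lemma ex_series_fermi (x : R) : 0 < x -> ex_series (fun n => fermi x (2 * INR n + 1)).
Proof.
intros Hx. apply ex_series_dominated with (2 := ex_series_bose x Hx).
intros n. destruct (lambert_exp_odd x n Hx) as [H1 _]. pose proof (exp_gt_1 x Hx).
unfold fermi, bose. rewrite Rabs_pos_eq by (left; apply Rinv_0_lt_compat; lra).
apply Rinv_le_contravar; lra.
Qed.

Lemma ex_series_signed (e u : nat -> R) : (forall n, Rabs (e n) = 1) ->
  (forall n, 0 <= u n) -> ex_series u -> ex_series (fun n => e n * u n).
Proof.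
intros He Hu. apply ex_series_dominated. intros n.
rewrite Rabs_mult, He, (Rabs_pos_eq (u n)) by trivial. lra.
Qed.

Lemma bose_nonneg (x : R) (n : nat) : 0 < x -> 0 <= bose x (2 * INR n + 1).
Proof. intros Hx. left. now apply bose_bound. Qed.

Lemma fermi_nonneg (x t : R) : 0 <= fermi x t.
Proof. left. apply fermi_bound. Qed.

(** 1/(t - 1) - 1/(t + 1) = 2/(t^2 - 1) termwise: the even part of the Lambert
    series, as a series in q, is one in q^2. *)
Lemma lambert_difference (x : R) (e : nat -> R) : 0 < x -> (forall n, Rabs (e n) = 1) ->
  Series (fun n => e n * bose x (2 * INR n + 1)) -
  Series (fun n => e n * fermi x (2 * INR n + 1)) =
  2 * Series (fun n => e n * bose (2 * x) (2 * INR n + 1)).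
Proof.
intros Hx He. rewrite <- Series_minus, <- Series_scal_l.
- apply Series_ext. intros n. destruct (lambert_exp_odd x n Hx) as [H1 _].
  pose proof (exp_gt_1 x Hx). unfold bose, fermi.
  replace (2 * x * (2 * INR n + 1)) with (x * (2 * INR n + 1) + x * (2 * INR n + 1)) by ring.
  rewrite exp_plus. set (u := exp (x * (2 * INR n + 1))) in *.
  field. repeat split; nra.
- apply ex_series_signed; [trivial|intros; now apply bose_nonneg|now apply ex_series_bose].
- apply ex_series_signed; [trivial|intros; apply fermi_nonneg|now apply ex_series_fermi].
Qed.

Lemma lambertA_double (x : R) : 0 < x -> lambertA (2 * x) = (lambertA x + lambertB x) / 2.
Proof.
intros Hx. pose proof (lambert_difference x (fun n => (-1) ^ n) Hx pow_1_abs).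
unfold lambertA, lambertB in *. lra.
Qed.

Lemma lambertP_double (x : R) : 0 < x -> lambertP (2 * x) = (lambertP x + lambertQ x) / 2.
Proof.
intros Hx.
pose proof (lambert_difference x (fun n => (-1) ^ Nat.div n 2) Hx (fun n => pow_1_abs _)).
unfold lambertP, lambertQ in *. lra.
Qed.

Lemma lambertA_bounds (x : R) : 0 < x -> 1 <= lambertA x <= 1 + 4 * / (exp x - 1).
Proof.
intros Hx. pose proof (exp_gt_1 x Hx) as He.
assert (Hd : forall n, bose x (2 * INR (S n) + 1) <= bose x (2 * INR n + 1)).
{ intros n. destruct (lambert_exp_odd x n Hx) as [H1 H2]. unfold bose.
  apply Rinv_le_contravar; lra. }
pose proof (Series_alternating_bounds (fun n => bose x (2 * INR n + 1)) Hd (ex_series_bose x Hx))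
  as [H1 H2].
pose proof (Hd O) as H3. cbv beta in H1, H2.
assert (E : bose x (2 * INR 0 + 1) = / (exp x - 1)).
{ unfold bose. simpl INR. rewrite Rmult_0_r, Rplus_0_l, Rmult_1_r. reflexivity. }
rewrite E in *. unfold lambertA. lra.
Qed.

Lemma lambertB_bounds (x : R) : 0 < x -> 1 - 4 * / (exp x - 1) <= lambertB x <= 1.
Proof.
intros Hx. pose proof (exp_gt_1 x Hx) as He.
assert (Hd : forall n, fermi x (2 * INR (S n) + 1) <= fermi x (2 * INR n + 1)).
{ intros n. destruct (lambert_exp_odd x n Hx) as [H1 H2]. unfold fermi.
  apply Rinv_le_contravar; lra. }
pose proof (Series_alternating_bounds (fun n => fermi x (2 * INR n + 1)) Hd (ex_series_fermi x Hx))
  as [H1 H2].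
pose proof (Hd O) as H3. cbv beta in H1, H2.
assert (E : fermi x (2 * INR 0 + 1) <= / (exp x - 1)).
{ unfold fermi. simpl INR. rewrite Rmult_0_r, Rplus_0_l, Rmult_1_r.
  apply Rinv_le_contravar; lra. }
unfold lambertB. lra.
Qed.

(** The leading term 8 q determines the size of the modulus as x grows. *)
Lemma lambertA_minus_lambertB (x : R) : 0 < x ->
  exp (- x) < lambertA x - lambertB x <= 8 * / (exp x - 1).
Proof.
intros Hx. pose proof (exp_gt_1 x Hx) as He.
pose (U := fun n : nat => bose x (2 * INR n + 1) + fermi x (2 * INR n + 1)).
assert (Hd : forall n, U (S n) <= U n).
{ intros n. destruct (lambert_exp_odd x n Hx) as [H1 H2]. unfold U, bose, fermi.
  apply Rplus_le_compat; apply Rinv_le_contravar; lra. }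
assert (HU : ex_series U)
  by (apply ex_series_Rplus; [now apply ex_series_bose|now apply ex_series_fermi]).
pose proof (Series_alternating_bounds U Hd HU) as [H1 H2].
assert (E : lambertA x - lambertB x = 4 * Series (fun n => (-1) ^ n * U n)).
{ unfold lambertA, lambertB, U.
  rewrite (Series_ext (fun n => (-1) ^ n * (bose x (2 * INR n + 1) + fermi x (2 * INR n + 1)))
    (fun n => (-1) ^ n * bose x (2 * INR n + 1) + (-1) ^ n * fermi x (2 * INR n + 1)))
    by (intros; ring).
  rewrite Series_plus; [ring| |];
  (apply ex_series_signed; [apply pow_1_abs| |]);
  [intros; now apply bose_nonneg|now apply ex_series_bose
  |intros; apply fermi_nonneg|now apply ex_series_fermi]. }
assert (E0 : U O = / (exp x - 1) + / (exp x + 1)).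
{ unfold U, bose, fermi. simpl INR. now rewrite Rmult_0_r, Rplus_0_l, Rmult_1_r. }
assert (E1 : U 1%nat = / (exp x ^ 3 - 1) + / (exp x ^ 3 + 1)).
{ unfold U, bose, fermi. rewrite exp_pow. replace (x * (2 * INR 1 + 1)) with (INR 3 * x)
    by (simpl; ring). reflexivity. }
rewrite E, exp_Ropp. set (e := exp x) in *. split.
- apply Rlt_le_trans with (4 * (U O - U 1%nat)); [|lra].
  rewrite E0, E1.
  assert (He2 : 1 < e ^ 2) by nra. assert (He3 : 1 < e ^ 3) by (simpl; nra).
  (* the second term of the alternating series is at most a third of the first *)
  assert (K : / (e ^ 3 - 1) + / (e ^ 3 + 1) <= / 3 * (/ (e - 1) + / (e + 1))).
  { replace (/ (e ^ 3 - 1) + / (e ^ 3 + 1)) with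
      (e ^ 2 * / (e ^ 4 + e ^ 2 + 1) * (/ (e - 1) + / (e + 1))).
    2: { field. repeat split; try lra; simpl in *; nra. }
    apply Rmult_le_compat_r.
    - apply Rplus_le_le_0_compat; left; apply Rinv_0_lt_compat; lra.
    - apply Rmult_le_reg_r with (e ^ 4 + e ^ 2 + 1); [simpl; nra|].
      rewrite Rmult_assoc, Rinv_l by (simpl; nra). simpl. nra. }
  assert (/ e < / (e - 1)) by (apply Rinv_lt_contravar; nra).
  assert (0 < / (e + 1)) by (apply Rinv_0_lt_compat; lra). lra.
- assert (/ (e + 1) <= / (e - 1)) by (apply Rinv_le_contravar; lra). lra.
Qed.

Lemma inv_exp_minus_1 (y : R) : 0 < y -> 0 < / (exp y - 1) <= / y.
Proof.
intros Hy. pose proof (exp_ineq1 y ltac:(lra)). split.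
- apply Rinv_0_lt_compat; lra.
- apply Rinv_le_contravar; lra.
Qed.

Lemma lambertP_near_1 (y : R) : 1 <= y -> Rabs (lambertP y - 1) <= 4 / y.
Proof.
intros Hy. unfold lambertP.
replace (1 + 2 * _ - 1) with
  (2 * Series (fun n => (-1) ^ Nat.div n 2 * bose y (2 * INR n + 1))) by ring.
rewrite Rabs_mult, (Rabs_pos_eq 2) by lra.
assert (Hy0 : 0 < y) by lra.
assert (H1 : exp (- (2 * y)) <= / 3).
{ rewrite exp_Ropp. apply Rinv_le_contravar; [lra|].
  pose proof (exp_ineq1 (2 * y) ltac:(lra)). lra. }
pose proof (exp_pos (- (2 * y))).
assert (HS : Rabs (Series (fun n => (-1) ^ Nat.div n 2 * bose y (2 * INR n + 1))) <=
  Series (fun n => / (exp y - 1) * exp (- (2 * y)) ^ n)).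
{ assert (E : forall n, Rabs ((-1) ^ Nat.div n 2 * bose y (2 * INR n + 1)) =
    bose y (2 * INR n + 1)).
  { intros n. rewrite Rabs_mult, pow_1_abs, Rmult_1_l.
    apply Rabs_pos_eq. now apply bose_nonneg. }
  eapply Rle_trans; [apply Series_Rabs|].
  - apply ex_series_Rext with (2 := ex_series_bose y Hy0). intros n. now rewrite E.
  - apply Series_le.
    + intros n. rewrite E. destruct (bose_bound y n Hy0). lra.
    + apply ex_series_Rmult, ex_series_geom. rewrite Rabs_pos_eq; lra. }
rewrite Series_scal_l, Series_geom in HS by (rewrite Rabs_pos_eq; lra).
destruct (inv_exp_minus_1 y Hy0) as [I1 I2].
assert (/ (1 - exp (- (2 * y))) <= 3 / 2).
{ replace (3 / 2) with (/ (2 / 3)) by field. apply Rinv_le_contravar; lra. }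
assert (0 < / (1 - exp (- (2 * y)))) by (apply Rinv_0_lt_compat; lra).
assert (/ (exp y - 1) * / (1 - exp (- (2 * y))) <= / y * (3 / 2))
  by (apply Rmult_le_compat; lra).
unfold Rdiv. lra.
Qed.

Lemma lambertA_near_1 (y : R) : 1 <= y -> Rabs (lambertA y - 1) <= 4 / y.
Proof.
intros Hy. destruct (lambertA_bounds y) as [H1 H2]; [lra|].
destruct (inv_exp_minus_1 y) as [I1 I2]; [lra|].
apply Rabs_le. unfold Rdiv. split; nra.
Qed.

Lemma lambertB_near_1 (y : R) : 1 <= y -> Rabs (lambertB y - 1) <= 4 / y.
Proof.
intros Hy. destruct (lambertB_bounds y) as [H1 H2]; [lra|].
destruct (inv_exp_minus_1 y) as [I1 I2]; [lra|].
apply Rabs_le. unfold Rdiv. split; nra.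
Qed.

Lemma is_lim_seq_pow2 (x : R) : 0 < x -> is_lim_seq (fun n => 2 ^ n * x) p_infty.
Proof.
intros Hx. apply is_lim_seq_ext with (fun n => x * 2 ^ n); [intros; ring|].
replace p_infty with (Rbar_mult x p_infty).
- apply is_lim_seq_scal_l. apply is_lim_seq_geom_p. lra.
- apply is_Rbar_mult_unique, is_Rbar_mult_sym. now apply is_Rbar_mult_p_infty_pos.
Qed.

Lemma is_lim_seq_doubling (f : R -> R) (x : R) : 0 < x ->
  (forall y, 1 <= y -> Rabs (f y - 1) <= 4 / y) ->
  is_lim_seq (fun n => f (2 ^ n * x)) 1.
Proof.
intros Hx Hf. pose proof (is_lim_seq_pow2 x Hx) as HP.
assert (H0 : is_lim_seq (fun n => f (2 ^ n * x) - 1) 0).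
{ apply is_lim_seq_abs_0.
  apply is_lim_seq_le_le_loc with (fun _ => 0) (fun n => 4 * / (2 ^ n * x)).
  - apply is_lim_seq_spec in HP. destruct (HP 1) as [N HN]. exists N.
    intros n Hn. split; [apply Rabs_pos|]. apply Hf. left. now apply HN.
  - apply is_lim_seq_const.
  - replace (Finite 0) with (Rbar_mult 4 0) by (simpl; f_equal; ring).
    apply is_lim_seq_scal_l. apply (is_lim_seq_inv _ p_infty); [exact HP|discriminate]. }
apply is_lim_seq_ext with (fun n => f (2 ^ n * x) - 1 + 1); [intros; ring|].
replace 1 with (0 + 1) at 1 by ring.
apply is_lim_seq_plus'; [exact H0|apply is_lim_seq_const].
Qed.

(** A quantity invariant under doubling equals its limit at +oo. The hypothesis is
    on a single value c, so that the lemma also shows that a quantity does not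
    take a value c <> 1 which would persist under doubling. *)
Lemma doubling_limit_unique (f : R -> R) (x c : R) : 0 < x ->
  (forall y, 0 < y -> f y = c -> f (2 * y) = c) ->
  is_lim_seq (fun n => f (2 ^ n * x)) 1 -> f x = c -> c = 1.
Proof.
intros Hx Hd Hl Hc.
assert (H : forall n, f (2 ^ n * x) = c).
{ induction n.
  - now rewrite pow_O, Rmult_1_l.
  - rewrite <- tech_pow_Rmult, Rmult_assoc. apply Hd; trivial.
    apply Rmult_lt_0_compat; [apply pow_lt; lra|trivial]. }
apply is_lim_seq_ext with (1 := H) in Hl. apply is_lim_seq_unique in Hl.
rewrite Lim_seq_const in Hl. now injection Hl.
Qed.

(** If P vanishes, so do Q and hence the doubled P. *)
Lemma lambertP_nonzero (x : R) : 0 < x -> lambertP x <> 0.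
Proof.
intros Hx H0. cut (0 = 1); [lra|].
apply (doubling_limit_unique lambertP x); trivial.
- intros y Hy Hz. destruct (lambert_relations y Hy) as [R1 _].
  destruct (lambertA_bounds y Hy) as [HA _]. rewrite Hz, Rmult_0_r in R1.
  rewrite lambertP_double, Hz by trivial.
  symmetry in R1. apply Rmult_integral in R1. destruct R1; lra.
- apply is_lim_seq_doubling; [trivial|apply lambertP_near_1].
Qed.

(** C(PI/4)^2 = A B, by eliminating Q between the two linear relations. *)
Lemma lambertB_double_sq (x : R) : 0 < x -> lambertB (2 * x) ^ 2 = lambertA x * lambertB x.
Proof.
intros Hx. destruct (lambert_relations x Hx) as [R1 [R2 _]].
apply Rmult_eq_reg_r with (lambertP x); [|now apply lambertP_nonzero].
transitivity (lambertB (2 * x) * (lambertB (2 * x) * lambertP x)); [ring|].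
rewrite R1. transitivity (lambertA x * (lambertB (2 * x) * lambertQ x)); [ring|].
rewrite R2. ring.
Qed.

Lemma lambertB_pos (x : R) : 0 < x -> 0 < lambertB x.
Proof.
intros Hx. pose proof (lambertB_double_sq x Hx) as E.
destruct (lambertA_bounds x Hx) as [HA _].
assert (H0 : lambertB x <> 0).
{ intros H0. cut (0 = 1); [lra|].
  apply (doubling_limit_unique lambertB x); trivial.
  - intros y Hy Hz. pose proof (lambertB_double_sq y Hy) as Ey. rewrite Hz in Ey. nra.
  - apply is_lim_seq_doubling; [trivial|apply lambertB_near_1]. }
nra.
Qed.

Lemma lambertQ_eq (x : R) : 0 < x -> lambertQ x = lambertB (2 * x) * lambertP x / lambertA x.
Proof.
intros Hx. destruct (lambert_relations x Hx) as [-> _].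
destruct (lambertA_bounds x Hx) as [HA _]. field. lra.
Qed.

Lemma double_pos (x : R) : 0 < x -> 0 < 2 * x.
Proof. lra. Qed.

Lemma lambertP_double_factor (x : R) : 0 < x ->
  lambertP (2 * x) = lambertP x * ((lambertA x + lambertB (2 * x)) / (2 * lambertA x)).
Proof.
intros Hx. rewrite lambertP_double, lambertQ_eq by trivial.
destruct (lambertA_bounds x Hx) as [HA _]. field. lra.
Qed.

(** With B(2x)^2 = A B, the quotient of the two sides does not change under
    doubling. *)
Lemma lambertP_sq (x : R) : 0 < x -> lambertP x ^ 2 = lambertA x * lambertA (2 * x).
Proof.
intros Hx.
pose (ratio := fun y => lambertP y ^ 2 / (lambertA y * lambertA (2 * y))).
assert (Ha : forall y, 0 < y -> 0 < lambertA y)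
  by (intros y Hy; destruct (lambertA_bounds y Hy); lra).
assert (K : ratio x = 1).
{ apply (doubling_limit_unique ratio x); trivial.
  - intros y Hy <-. unfold ratio.
    pose proof (double_pos y Hy) as Hy2. pose proof (double_pos _ Hy2) as Hy4.
    pose proof (Ha y Hy) as A1. pose proof (Ha _ Hy2) as A2. pose proof (Ha _ Hy4) as A4.
    pose proof (lambertB_double_sq y Hy) as EB.
    pose proof (lambertA_double y Hy) as EA. pose proof (lambertA_double _ Hy2) as EA2.
    rewrite lambertP_double_factor by trivial.
    set (a := lambertA y) in *. set (b := lambertB y) in *.
    set (a2 := lambertA (2 * y)) in *. set (b2 := lambertB (2 * y)) in *.
    set (a4 := lambertA (2 * (2 * y))) in *. set (p := lambertP y) in *.
    assert (E : (a + b2) ^ 2 = 4 * a * a4) by nra.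
    replace ((p * ((a + b2) / (2 * a))) ^ 2) with (p ^ 2 * (a + b2) ^ 2 / (4 * a ^ 2))
      by (field; lra).
    rewrite E. field. repeat split; lra.
  - unfold ratio. replace (Finite 1) with (Finite (1 * 1 / (1 * 1))) by (f_equal; field).
    pose proof (is_lim_seq_doubling _ x Hx lambertP_near_1) as LP.
    pose proof (is_lim_seq_doubling _ x Hx lambertA_near_1) as LA.
    pose proof (is_lim_seq_doubling _ _ (double_pos x Hx) lambertA_near_1) as LA2.
    apply is_lim_seq_div'; [| |lra].
    + apply is_lim_seq_ext with (fun n => lambertP (2 ^ n * x) * lambertP (2 ^ n * x));
        [intros; ring|]. now apply is_lim_seq_mult'.
    + apply is_lim_seq_mult'; [exact LA|].
      apply is_lim_seq_ext with (2 := LA2). intros n. f_equal. ring. }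
unfold ratio in K. pose proof (Ha x Hx). pose proof (Ha _ (double_pos x Hx)).
apply Rmult_eq_reg_r with (/ (lambertA x * lambertA (2 * x))).
- rewrite Rinv_r by nra. exact K.
- apply Rinv_neq_0_compat. nra.
Qed.

Lemma lambertP_pos (x : R) : 0 < x -> 0 < lambertP x.
Proof.
intros Hx. destruct (Rlt_le_dec 0 (lambertP x)) as [H|H]; [exact H|exfalso].
assert (Hn : forall n, lambertP (2 ^ n * x) <= 0).
{ induction n.
  - now rewrite pow_O, Rmult_1_l.
  - rewrite <- tech_pow_Rmult, Rmult_assoc.
    assert (Hy : 0 < 2 ^ n * x) by (apply Rmult_lt_0_compat; [apply pow_lt; lra|trivial]).
    rewrite lambertP_double_factor by trivial.
    destruct (lambertA_bounds _ Hy) as [HA _].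
    pose proof (lambertB_pos _ (double_pos _ Hy)) as HB.
    assert (0 < (lambertA (2 ^ n * x) + lambertB (2 * (2 ^ n * x))) / (2 * lambertA (2 ^ n * x)))
      by (apply Rdiv_lt_0_compat; lra). nra. }
pose proof (is_lim_seq_le _ (fun _ => 0) 1 0 Hn
  (is_lim_seq_doubling _ x Hx lambertP_near_1) (is_lim_seq_const 0)) as K.
simpl in K. lra.
Qed.

Lemma lambertS_closed_form (x : R) : 0 < x ->
  3 - 2 * lambertS x =
  sqrt (lambertA x * ((lambertA x + lambertB x) / 2)) * lambertB x *
  (2 * lambertA x + lambertB x).
Proof.
intros Hx. destruct (lambert_relations x Hx) as [_ [_ ->]].
rewrite <- (lambertA_double x Hx), <- lambertP_sq by trivial.
rewrite sqrt_pow2 by (left; now apply lambertP_pos).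
rewrite lambertQ_eq by trivial. destruct (lambertA_bounds x Hx) as [HA _].
pose proof (lambertP_sq x Hx) as EP. pose proof (lambertB_double_sq x Hx) as EB.
rewrite lambertA_double in EP by trivial.
set (a := lambertA x) in *. set (b := lambertB x) in *.
set (b2 := lambertB (2 * x)) in *. set (p := lambertP x) in *.
replace (2 * (b2 * p / a) ^ 2) with (2 * b2 ^ 2 * p ^ 2 / a ^ 2) by (field; lra).
rewrite EB, EP. field. lra.
Qed.

(** * Gauss's integral and Landen's transformation *)

(** The integrand is written with both coefficients, which makes homogeneity and
    the symmetry between K and K' visible. *)
Definition quad (a b theta : R) : R := a ^ 2 * cos theta ^ 2 + b ^ 2 * sin theta ^ 2.

Definition gaussI (a b : R) : R := RInt (fun theta => / sqrt (quad a b theta)) 0 (PI / 2).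

Lemma cos2_sin2 (t : R) : cos t ^ 2 = 1 - sin t ^ 2.
Proof. pose proof (sin2_cos2 t) as H. unfold Rsqr in H. simpl. lra. Qed.

Lemma quad_between (a b t : R) : 0 < b <= a -> b ^ 2 <= quad a b t <= a ^ 2.
Proof.
intros H. unfold quad. rewrite cos2_sin2.
pose proof (SIN_bound t). assert (0 <= sin t ^ 2 <= 1) by (simpl; nra).
assert (b ^ 2 <= a ^ 2) by (apply pow_incr; lra). split; nra.
Qed.

Lemma quad_pos (a b t : R) : 0 < a -> 0 < b -> 0 < quad a b t.
Proof.
intros Ha Hb. unfold quad. rewrite cos2_sin2.
pose proof (SIN_bound t). assert (0 <= sin t ^ 2 <= 1) by (simpl; nra).
assert (0 < a ^ 2) by (apply pow_lt; lra). assert (0 < b ^ 2) by (apply pow_lt; lra).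
destruct (Rlt_le_dec (sin t ^ 2) (/ 2)); nra.
Qed.

Lemma continuous_inv_sqrt_quad (a b t : R) : 0 < a -> 0 < b ->
  continuous (fun theta => / sqrt (quad a b theta)) t.
Proof.
intros Ha Hb. apply (@ex_derive_continuous R_AbsRing R_NormedModule).
pose proof (quad_pos a b t Ha Hb) as Hq. pose proof (sqrt_lt_R0 _ Hq) as Hs.
unfold quad in *. auto_derive. repeat split; simpl in *; lra.
Qed.

Lemma ex_RInt_quad (a b u v : R) : 0 < a -> 0 < b ->
  ex_RInt (fun theta => / sqrt (quad a b theta)) u v.
Proof.
intros Ha Hb. apply (@ex_RInt_continuous R_CompleteNormedModule).
intros z _. now apply continuous_inv_sqrt_quad.
Qed.

Lemma PI2_pos : 0 < PI / 2.
Proof. pose proof PI_RGT_0. lra. Qed.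

Lemma gaussI_bounds (a b : R) : 0 < b <= a ->
  PI / 2 * / a <= gaussI a b <= PI / 2 * / b.
Proof.
intros H. pose proof PI2_pos.
assert (C : forall c, RInt (fun _ => c) 0 (PI / 2) = PI / 2 * c).
{ intros c. rewrite RInt_const. unfold scal; simpl; unfold mult; simpl. ring. }
assert (Hs : forall t, b <= sqrt (quad a b t) <= a).
{ intros t. pose proof (quad_between a b t H) as [H1 H2].
  apply sqrt_le_1_alt in H1. apply sqrt_le_1_alt in H2.
  rewrite sqrt_pow2 in H1, H2 by lra. now split. }
rewrite <- (C (/ a)), <- (C (/ b)). unfold gaussI.
split; apply RInt_le; try lra; try apply ex_RInt_const; try (apply ex_RInt_quad; lra).
- intros t _. apply Rinv_le_contravar; destruct (Hs t); lra.
- intros t _. apply Rinv_le_contravar; destruct (Hs t); lra.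
Qed.

Lemma gaussI_scale (c a b : R) : 0 < c -> 0 < a -> 0 < b ->
  gaussI (c * a) (c * b) = gaussI a b / c.
Proof.
intros Hc Ha Hb. unfold gaussI.
transitivity (RInt (fun theta => scal (/ c) (/ sqrt (quad a b theta))) 0 (PI / 2)).
- apply RInt_ext. intros t _. pose proof (quad_pos a b t Ha Hb) as Hq.
  replace (quad (c * a) (c * b) t) with (c ^ 2 * quad a b t) by (unfold quad; ring).
  rewrite sqrt_mult, sqrt_pow2 by (try apply pow_le; lra).
  unfold scal; simpl; unfold mult; simpl. apply Rinv_mult.
- rewrite (RInt_scal (V := R_CompleteNormedModule)) by now apply ex_RInt_quad.
  unfold scal; simpl; unfold mult; simpl. unfold Rdiv. ring.
Qed.

Lemma gaussI_decreasing (a b b' : R) : 0 < a -> 0 < b < b' -> gaussI a b' < gaussI a b.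
Proof.
intros Ha Hb. pose proof PI2_pos. unfold gaussI. apply RInt_lt; trivial.
- intros; apply continuous_inv_sqrt_quad; lra.
- intros; apply continuous_inv_sqrt_quad; lra.
- intros t Ht. pose proof (quad_pos a b t Ha ltac:(lra)) as Hq.
  assert (Hs : 0 < sin t) by (apply sin_gt_0; lra).
  assert (quad a b t < quad a b' t).
  { unfold quad. assert (b ^ 2 < b' ^ 2) by (simpl; nra).
    assert (0 < sin t ^ 2) by (apply pow_lt; lra). nra. }
  apply Rinv_lt_contravar; [|now apply sqrt_lt_1_alt; lra].
  apply Rmult_lt_0_compat; apply sqrt_lt_R0; lra.
Qed.

Lemma gaussI_sym (a b : R) : 0 < a -> 0 < b -> gaussI a b = gaussI b a.
Proof.
intros Ha Hb. unfold gaussI.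
pose proof (RInt_comp_lin (V := R_CompleteNormedModule)
  (fun t => / sqrt (quad a b t)) (-1) (PI / 2) 0 (PI / 2) (ex_RInt_quad a b _ _ Ha Hb)) as E.
replace (-1 * 0 + PI / 2) with (PI / 2) in E by ring.
replace (-1 * (PI / 2) + PI / 2) with 0 in E by ring.
rewrite <- (opp_RInt_swap (V := R_CompleteNormedModule)) by now apply ex_RInt_quad.
rewrite <- E.
rewrite (RInt_ext (fun y => scal (-1) (/ sqrt (quad a b (-1 * y + PI / 2))))
  (fun y => opp (/ sqrt (quad b a y)))).
- rewrite (RInt_opp (V := R_CompleteNormedModule)) by now apply ex_RInt_quad.
  unfold opp; simpl. ring.
- intros t _. replace (-1 * t + PI / 2) with (PI / 2 - t) by ring.
  unfold quad. rewrite cos_shift, sin_shift.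
  rewrite Rplus_comm. unfold scal, opp; simpl; unfold mult; simpl. ring.
Qed.

(** Landen's substitution is tan (phi' - phi) = (b/a) tan phi. The formula for
    phi' below is an equivalent one, smooth across PI/2: the offset is the tangent
    of 2 phi - phi'. *)
Definition landen_offset (a b t : R) : R :=
  (a - b) * (sin t * cos t) / (a * cos t ^ 2 + b * sin t ^ 2).

Definition landen_angle (a b t : R) : R := 2 * t - atan (landen_offset a b t).

Lemma landen_denominator_pos (a b t : R) : 0 < a -> 0 < b ->
  0 < a * cos t ^ 2 + b * sin t ^ 2.
Proof.
intros Ha Hb. pose proof (quad_pos (sqrt a) (sqrt b) t (sqrt_lt_R0 _ Ha) (sqrt_lt_R0 _ Hb)) as H.
unfold quad in H. rewrite !pow2_sqrt in H by lra. exact H.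
Qed.

Lemma landen_offset_sq (a b t : R) : 0 < a -> 0 < b ->
  1 + landen_offset a b t ^ 2 = quad a b t / (a * cos t ^ 2 + b * sin t ^ 2) ^ 2.
Proof.
intros Ha Hb. pose proof (landen_denominator_pos a b t Ha Hb) as HM.
unfold landen_offset, quad.
transitivity (((a * cos t ^ 2 + b * sin t ^ 2) ^ 2 + (a - b) ^ 2 * (sin t ^ 2 * cos t ^ 2)) /
  (a * cos t ^ 2 + b * sin t ^ 2) ^ 2).
- field. lra.
- unfold Rdiv. f_equal. rewrite cos2_sin2. ring.
Qed.

Lemma is_derive_landen_angle (a b t : R) : 0 < a -> 0 < b ->
  is_derive (landen_angle a b) t ((quad a b t + a * b) / quad a b t).
Proof.
intros Ha Hb. pose proof (landen_denominator_pos a b t Ha Hb) as HM.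
pose proof (quad_pos a b t Ha Hb) as HQ.
set (M := a * cos t ^ 2 + b * sin t ^ 2) in *.
assert (D1 : is_derive (landen_offset a b) t ((a - b) * (a * cos t ^ 2 - b * sin t ^ 2) / M ^ 2)).
{ unfold landen_offset. auto_derive.
  - unfold M in HM; simpl in *; lra.
  - apply Rmult_eq_reg_r with (M ^ 2); [|apply pow_nonzero; lra].
    unfold M in *.
    transitivity ((a - b) * ((cos t ^ 2 - sin t ^ 2) * (a * cos t ^ 2 + b * sin t ^ 2) +
       2 * (a - b) * (sin t ^ 2 * cos t ^ 2))).
    + field. simpl in *; lra.
    + transitivity ((a - b) * (a * cos t ^ 2 - b * sin t ^ 2)).
      * rewrite cos2_sin2. ring.
      * field. simpl in *; lra. }
pose proof (is_derive_comp atan (landen_offset a b) t _ _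
  (is_derive_atan (landen_offset a b t)) D1) as D2.
assert (D3 : is_derive (fun s : R => 2 * s) t 2) by (auto_derive; [trivial|ring]).
pose proof (is_derive_minus (K := R_AbsRing) (V := R_NormedModule) _ _ t _ _ D3 D2) as D4.
unfold landen_angle.
replace ((quad a b t + a * b) / quad a b t) with
  (minus 2 (scal ((a - b) * (a * cos t ^ 2 - b * sin t ^ 2) / M ^ 2)
    (/ (1 + Rsqr (landen_offset a b t))))); [exact D4|].
rewrite Rsqr_pow2.
rewrite landen_offset_sq by trivial. fold M.
unfold minus, plus, opp, scal; simpl; unfold mult; simpl.
change (2 + - ((a - b) * (a * (cos t ^ 2) - b * (sin t ^ 2)) / M ^ 2 * / (quad a b t / M ^ 2)) =
  (quad a b t + a * b) / quad a b t).
apply Rmult_eq_reg_r with (quad a b t); [|lra].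
transitivity (2 * quad a b t - (a - b) * (a * cos t ^ 2 - b * sin t ^ 2)).
- field. split; lra.
- transitivity (quad a b t + a * b); [unfold quad; rewrite cos2_sin2; ring|field; lra].
Qed.

Lemma quad_landen_angle (a b t : R) : 0 < a -> 0 < b ->
  quad ((a + b) / 2) (sqrt (a * b)) (landen_angle a b t) =
  ((a + b) / 2 * (a * cos t ^ 2 + b * sin t ^ 2)) ^ 2 / quad a b t.
Proof.
intros Ha Hb. pose proof (landen_denominator_pos a b t Ha Hb) as HM.
pose proof (quad_pos a b t Ha Hb) as HQ.
pose proof (landen_offset_sq a b t Ha Hb) as HU.
unfold quad at 1, landen_angle.
rewrite pow2_sqrt by nra.
rewrite cos_minus, sin_minus, cos_atan, sin_atan, cos_2a, sin_2a.
unfold Rsqr. replace (landen_offset a b t * landen_offset a b t) with (landen_offset a b t ^ 2) by ring.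
assert (Hw : 0 < 1 + landen_offset a b t ^ 2) by (pose proof (pow2_ge_0 (landen_offset a b t)); lra).
set (w := sqrt (1 + landen_offset a b t ^ 2)).
assert (Hw0 : 0 < w) by now apply sqrt_lt_R0.
assert (Hw2 : w ^ 2 = quad a b t / (a * cos t ^ 2 + b * sin t ^ 2) ^ 2).
{ unfold w. rewrite pow2_sqrt by lra. exact HU. }
transitivity ((((a + b) / 2) ^ 2 *
    (cos t * cos t - sin t * sin t + 2 * sin t * cos t * landen_offset a b t) ^ 2 +
  a * b * (2 * sin t * cos t - (cos t * cos t - sin t * sin t) * landen_offset a b t) ^ 2) / w ^ 2).
{ field. lra. }
rewrite Hw2. unfold landen_offset.
assert (E1 : cos t * cos t - sin t * sin t + 2 * sin t * cos t *
  ((a - b) * (sin t * cos t) / (a * cos t ^ 2 + b * sin t ^ 2)) =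
  (a * cos t ^ 2 - b * sin t ^ 2) / (a * cos t ^ 2 + b * sin t ^ 2)).
{ apply Rmult_eq_reg_r with (a * cos t ^ 2 + b * sin t ^ 2); [|lra].
  transitivity ((cos t ^ 2 - sin t ^ 2) * (a * cos t ^ 2 + b * sin t ^ 2) +
    2 * (a - b) * (sin t ^ 2 * cos t ^ 2)); [field; lra|].
  transitivity (a * cos t ^ 2 - b * sin t ^ 2); [rewrite cos2_sin2; ring|field; lra]. }
assert (E2 : 2 * sin t * cos t - (cos t * cos t - sin t * sin t) *
  ((a - b) * (sin t * cos t) / (a * cos t ^ 2 + b * sin t ^ 2)) =
  (a + b) * (sin t * cos t) / (a * cos t ^ 2 + b * sin t ^ 2)).
{ apply Rmult_eq_reg_r with (a * cos t ^ 2 + b * sin t ^ 2); [|lra].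
  transitivity (sin t * cos t * (2 * (a * cos t ^ 2 + b * sin t ^ 2) -
    (a - b) * (cos t ^ 2 - sin t ^ 2))); [field; lra|].
  transitivity ((a + b) * (sin t * cos t)); [rewrite cos2_sin2; ring|field; lra]. }
rewrite E1, E2. field. split; lra.
Qed.

(** The substitution carries the integrand for the two means to twice the given
    one, and [0, PI/2] to [0, PI], over which the new integrand contributes two
    equal halves. *)
Lemma gaussI_landen (a b : R) : 0 < a -> 0 < b ->
  gaussI a b = gaussI ((a + b) / 2) (sqrt (a * b)).
Proof.
intros Ha Hb.
assert (Ha1 : 0 < (a + b) / 2) by lra.
assert (Hb1 : 0 < sqrt (a * b)) by (apply sqrt_lt_R0; nra).
set (a1 := (a + b) / 2) in *. set (b1 := sqrt (a * b)) in *.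
set (F := fun t => / sqrt (quad a1 b1 t)).
assert (exF : forall u v, ex_RInt F u v) by (intros; now apply ex_RInt_quad).
assert (E1 : RInt F 0 PI = 2 * gaussI a b).
{ pose proof (RInt_comp (V := R_CompleteNormedModule) F (landen_angle a b)
    (fun t => (quad a b t + a * b) / quad a b t) 0 (PI / 2)) as C.
  assert (Z0 : landen_angle a b 0 = 0).
  { unfold landen_angle, landen_offset. rewrite sin_0.
    replace ((a - b) * (0 * cos 0) / _) with 0 by (unfold Rdiv; ring).
    rewrite atan_0. ring. }
  assert (Z1 : landen_angle a b (PI / 2) = PI).
  { unfold landen_angle, landen_offset. rewrite cos_PI2.
    replace ((a - b) * (sin (PI / 2) * 0) / _) with 0 by (unfold Rdiv; ring).
    rewrite atan_0. field. }
  rewrite Z0, Z1 in C. rewrite <- C.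
  - transitivity (RInt (fun t => scal 2 (/ sqrt (quad a b t))) 0 (PI / 2)).
    + apply RInt_ext. intros t _. unfold F.
      pose proof (landen_denominator_pos a b t Ha Hb) as HM.
      pose proof (quad_pos a b t Ha Hb) as HQ.
      unfold a1, b1. rewrite quad_landen_angle by trivial.
      rewrite sqrt_div_alt by trivial. rewrite sqrt_pow2 by nra.
      pose proof (sqrt_lt_R0 _ HQ) as HS.
      assert (EM : quad a b t + a * b = (a + b) * (a * cos t ^ 2 + b * sin t ^ 2))
        by (unfold quad; rewrite cos2_sin2; ring).
      rewrite EM. unfold scal; simpl; unfold mult; simpl.
      change (a * (cos t * (cos t * 1)) + b * (sin t * (sin t * 1))) with
        (a * cos t ^ 2 + b * sin t ^ 2).
      set (M := a * cos t ^ 2 + b * sin t ^ 2) in *.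
      rewrite <- (sqrt_sqrt (quad a b t)) at 1 by lra.
      field. repeat split; lra.
    + rewrite (RInt_scal (V := R_CompleteNormedModule)) by now apply ex_RInt_quad.
      reflexivity.
  - intros t _. now apply continuous_inv_sqrt_quad.
  - intros t _. split; [now apply is_derive_landen_angle|].
    apply (@ex_derive_continuous R_AbsRing R_NormedModule).
    pose proof (quad_pos a b t Ha Hb) as HQ. unfold quad in *. auto_derive.
    simpl in *. lra. }
assert (E2 : RInt F (PI / 2) PI = RInt F 0 (PI / 2)).
{ pose proof (RInt_comp_lin (V := R_CompleteNormedModule) F (-1) PI 0 (PI / 2) (exF _ _)) as C.
  replace (-1 * 0 + PI) with PI in C by ring.
  replace (-1 * (PI / 2) + PI) with (PI / 2) in C by field.
  rewrite <- (opp_RInt_swap (V := R_CompleteNormedModule)) by apply exF.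
  rewrite <- C.
  rewrite (RInt_ext (fun y => scal (-1) (F (-1 * y + PI))) (fun y => opp (F y))).
  - rewrite (RInt_opp (V := R_CompleteNormedModule)) by apply exF.
    unfold opp; simpl. ring.
  - intros t _. unfold F. replace (-1 * t + PI) with (PI - t) by ring.
    unfold quad. rewrite sin_PI_x. rewrite cos_minus, cos_PI, sin_PI.
    replace ((-1 * cos t + 0 * sin t) ^ 2) with (cos t ^ 2) by ring.
    unfold scal, opp; simpl; unfold mult; simpl. ring. }
pose proof (RInt_Chasles (V := R_CompleteNormedModule) F 0 (PI / 2) PI (exF _ _) (exF _ _)) as E3.
unfold plus in E3; simpl in E3. rewrite E2, E1 in E3.
unfold gaussI at 2. fold F. lra.
Qed.

(** * Logarithmic growth and complete integrals *)

Lemma RInt_cos_sqrt (c k : R) : 0 < c -> 0 < k ->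
  is_RInt (fun t => cos t / sqrt (c ^ 2 * sin t ^ 2 + k ^ 2)) 0 (PI / 2)
    ((ln (c + sqrt (c ^ 2 + k ^ 2)) - ln k) / c).
Proof.
intros Hc Hk.
assert (HP : forall t, 0 < c ^ 2 * sin t ^ 2 + k ^ 2).
{ intros t. pose proof (pow2_ge_0 (sin t)). pose proof (pow2_ge_0 c).
  assert (0 < k ^ 2) by (apply pow_lt; lra). nra. }
assert (HL : forall t, 0 < c * sin t + sqrt (c ^ 2 * sin t ^ 2 + k ^ 2)).
{ intros t. assert (Rabs (c * sin t) < sqrt (c ^ 2 * sin t ^ 2 + k ^ 2)).
  { rewrite <- sqrt_Rsqr_abs. apply sqrt_lt_1_alt. split; [apply Rle_0_sqr|].
    unfold Rsqr. assert (0 < k ^ 2) by (apply pow_lt; lra). simpl in *; nra. }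
  pose proof (Rle_abs (- (c * sin t))) as H1. rewrite Rabs_Ropp in H1. lra. }
pose (G := fun t => ln (c * sin t + sqrt (c ^ 2 * sin t ^ 2 + k ^ 2)) / c).
replace ((ln (c + sqrt (c ^ 2 + k ^ 2)) - ln k) / c) with (minus (G (PI / 2)) (G 0)).
- apply (is_RInt_derive (V := R_CompleteNormedModule) G).
  + intros t _. specialize (HP t). specialize (HL t). unfold G.
    pose proof (sqrt_lt_R0 _ HP) as HS.
    auto_derive.
    * repeat split; simpl in *; lra.
    * change (sin t * (sin t * 1)) with (sin t ^ 2).
      change (c * (c * 1)) with (c ^ 2). change (k * (k * 1)) with (k ^ 2).
      set (q := sqrt (c ^ 2 * sin t ^ 2 + k ^ 2)) in *.
      field. repeat split; lra.
  + intros t _. apply (@ex_derive_continuous R_AbsRing R_NormedModule).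
    specialize (HP t). pose proof (sqrt_lt_R0 _ HP) as HS. auto_derive.
    repeat split; simpl in *; lra.
- unfold G, minus, plus, opp; simpl. rewrite sin_PI2, sin_0.
  replace (c * (c * 1) * (1 * (1 * 1)) + k * (k * 1)) with (c ^ 2 + k ^ 2) by ring.
  replace (c * (c * 1) * (0 * (0 * 1)) + k * (k * 1)) with (k ^ 2) by ring.
  rewrite sqrt_pow2 by lra. change (c * (c * 1) + k * (k * 1)) with (c ^ 2 + k ^ 2).
  rewrite Rmult_1_r, Rmult_0_r, Rplus_0_l. field. lra.
Qed.

(** After the exchange of sin and cos, the integrand 1/sqrt (sin^2 + k^2 cos^2) is
    large near 0 only, where cos is close to 1. With cos for 1 in the numerator it
    has an elementary primitive, and this changes it by at most 1. *)
Lemma gaussI_log_bounds (k : R) : 0 < k < 1 ->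
  - ln k <= gaussI 1 k <= PI / 2 + (ln 2 - ln k) / sqrt (1 - k ^ 2).
Proof.
intros Hk. pose proof PI2_pos.
assert (Hk2 : 0 < k ^ 2 < 1) by (simpl; nra).
set (c := sqrt (1 - k ^ 2)).
assert (Hc : 0 < c) by (apply sqrt_lt_R0; lra).
assert (Hc2 : c ^ 2 = 1 - k ^ 2) by (apply pow2_sqrt; lra).
assert (Hc1 : c < 1) by nra.
rewrite gaussI_sym by lra.
assert (HI : is_RInt (fun t => / sqrt (quad k 1 t)) 0 (PI / 2) (gaussI k 1)).
{ apply (RInt_correct (V := R_CompleteNormedModule)), ex_RInt_quad; lra. }
assert (Ht : forall t, 0 < t < PI / 2 -> 0 < cos t <= 1 /\ 0 < sin t <= 1).
{ intros t Ht. repeat split.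
  - apply cos_gt_0; lra.
  - apply COS_bound.
  - apply sin_gt_0; lra.
  - apply SIN_bound. }
split.
- pose proof (RInt_cos_sqrt 1 k ltac:(lra) ltac:(lra)) as HJ.
  apply Rle_trans with ((ln (1 + sqrt (1 ^ 2 + k ^ 2)) - ln k) / 1).
  + assert (0 <= ln (1 + sqrt (1 ^ 2 + k ^ 2))).
    { rewrite <- ln_1. apply ln_le; [lra|]. pose proof (sqrt_pos (1 ^ 2 + k ^ 2)). lra. }
    lra.
  + apply (is_RInt_le _ _ 0 (PI / 2) _ _ (Rlt_le _ _ H) HJ HI).
    intros t Hr. destruct (Ht t Hr) as [C S].
    pose proof (quad_pos k 1 t ltac:(lra) ltac:(lra)) as HQ.
    apply Rle_trans with (/ sqrt (1 ^ 2 * sin t ^ 2 + k ^ 2)).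
    * assert (0 < / sqrt (1 ^ 2 * sin t ^ 2 + k ^ 2)).
      { apply Rinv_0_lt_compat, sqrt_lt_R0. simpl; nra. }
      unfold Rdiv. nra.
    * apply Rinv_le_contravar; [now apply sqrt_lt_R0|].
      apply sqrt_le_1_alt. unfold quad. rewrite cos2_sin2.
      pose proof (pow2_ge_0 (sin t)). nra.
- pose proof (RInt_cos_sqrt c k Hc ltac:(lra)) as HJ.
  assert (HC : is_RInt (fun _ => 1) 0 (PI / 2) (PI / 2)).
  { pose proof (is_RInt_const (V := R_NormedModule) 0 (PI / 2) 1) as K.
    unfold scal in K; simpl in K; unfold mult in K; simpl in K.
    replace (PI / 2) with ((PI / 2 - 0) * 1) at 2 by ring. exact K. }
  apply Rle_trans with (PI / 2 + (ln (c + sqrt (c ^ 2 + k ^ 2)) - ln k) / c).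
  + pose proof (is_RInt_plus (V := R_NormedModule) _ _ _ _ _ _ HC HJ) as HS.
    apply (is_RInt_le _ _ 0 (PI / 2) _ _ (Rlt_le _ _ H) HI HS).
    intros t Hr. destruct (Ht t Hr) as [C S].
    pose proof (quad_pos k 1 t ltac:(lra) ltac:(lra)) as HQ.
    assert (EQ : quad k 1 t = c ^ 2 * sin t ^ 2 + k ^ 2)
      by (unfold quad; rewrite cos2_sin2, Hc2; ring).
    unfold plus; simpl.
    change (/ sqrt (quad k 1 t) <= 1 + cos t / sqrt (c ^ 2 * sin t ^ 2 + k ^ 2)).
    rewrite <- EQ. pose proof (sqrt_lt_R0 _ HQ) as HQs.
    assert (K : 1 - cos t <= sqrt (quad k 1 t)).
    { rewrite <- (sqrt_pow2 (1 - cos t)) by lra. apply sqrt_le_1_alt.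
      unfold quad. pose proof (cos2_sin2 t). nra. }
    apply Rmult_le_reg_r with (sqrt (quad k 1 t)); [trivial|].
    unfold Rdiv. rewrite Rinv_l by lra.
    rewrite Rmult_plus_distr_r, Rmult_assoc, Rinv_l by lra. lra.
  + apply Rplus_le_compat_l. apply Rmult_le_compat_r; [left; now apply Rinv_0_lt_compat|].
    assert (ln (c + sqrt (c ^ 2 + k ^ 2)) <= ln 2); [|lra].
    rewrite Hc2. replace (1 - k ^ 2 + k ^ 2) with 1 by ring. rewrite sqrt_1.
    apply ln_le; lra.
Qed.

Lemma ellipticK_gaussI (k : R) : k ^ 2 < 1 -> ellipticK k = gaussI 1 (sqrt (1 - k ^ 2)).
Proof.
intros Hk. unfold ellipticK, gaussI. apply RInt_ext. intros t _. do 2 f_equal.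
unfold quad. rewrite pow2_sqrt by lra. rewrite cos2_sin2. ring.
Qed.

Lemma ellipticK_complementary (k : R) : 0 < k < 1 ->
  ellipticK (complementary_modulus k) = gaussI 1 k.
Proof.
intros Hk. assert (0 < k ^ 2 < 1) by (simpl; nra).
unfold complementary_modulus. rewrite ellipticK_gaussI by (rewrite pow2_sqrt; lra).
f_equal. rewrite pow2_sqrt by lra.
replace (1 - (1 - k ^ 2)) with (k ^ 2) by ring. apply sqrt_pow2. lra.
Qed.

(** * Inversion of the modulus *)

Lemma lambertAB_order (x : R) : 0 < x ->
  0 < lambertB x < lambertA x /\ lambertB x <= 1 <= lambertA x.
Proof.
intros Hx. destruct (lambertA_bounds x Hx). destruct (lambertB_bounds x Hx).
destruct (lambertA_minus_lambertB x Hx) as [H3 _]. pose proof (exp_pos (- x)).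
pose proof (lambertB_pos x Hx). lra.
Qed.

Lemma lambertB_double (x : R) : 0 < x -> lambertB (2 * x) = sqrt (lambertA x * lambertB x).
Proof.
intros Hx. rewrite <- lambertB_double_sq by trivial.
symmetry. apply sqrt_pow2. left. apply lambertB_pos. lra.
Qed.

(** The integral is invariant under doubling, and is squeezed between PI/(2A) and
    PI/(2B). *)
Lemma gaussI_lambert (x : R) : 0 < x -> gaussI (lambertA x) (lambertB x) = PI / 2.
Proof.
intros Hx.
assert (Hn : forall n, gaussI (lambertA (2 ^ n * x)) (lambertB (2 ^ n * x)) =
  gaussI (lambertA x) (lambertB x)).
{ induction n; [now rewrite pow_O, Rmult_1_l|].
  rewrite <- tech_pow_Rmult, Rmult_assoc.
  assert (Hy : 0 < 2 ^ n * x) by (apply Rmult_lt_0_compat; [apply pow_lt; lra|trivial]).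
  destruct (lambertAB_order _ Hy).
  rewrite lambertA_double, lambertB_double, <- gaussI_landen by lra. exact IHn. }
assert (HB : forall n, PI / 2 * / lambertA (2 ^ n * x) <= gaussI (lambertA x) (lambertB x)
   <= PI / 2 * / lambertB (2 ^ n * x)).
{ intros n. rewrite <- (Hn n).
  assert (Hy : 0 < 2 ^ n * x) by (apply Rmult_lt_0_compat; [apply pow_lt; lra|trivial]).
  destruct (lambertAB_order _ Hy). apply gaussI_bounds. lra. }
assert (L : forall f, (forall y, 1 <= y -> Rabs (f y - 1) <= 4 / y) ->
  is_lim_seq (fun n => PI / 2 * / f (2 ^ n * x)) (PI / 2)).
{ intros f Hf. pose proof (is_lim_seq_doubling f x Hx Hf) as K.
  apply (is_lim_seq_inv _ 1) in K; [|injection; lra].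
  apply (is_lim_seq_scal_l _ (PI / 2)) in K. simpl in K.
  now rewrite Rinv_1, Rmult_1_r in K. }
apply Rle_antisym.
- exact (is_lim_seq_le _ _ _ _ (fun n => proj2 (HB n)) (is_lim_seq_const _)
    (L _ lambertB_near_1)).
- exact (is_lim_seq_le _ _ _ _ (fun n => proj1 (HB n)) (L _ lambertA_near_1)
    (is_lim_seq_const _)).
Qed.

(** This is theta2(q)^2. *)
Definition lambertG (x : R) : R := sqrt (lambertA x ^ 2 - lambertB x ^ 2).

Lemma lambertG_sq (x : R) : 0 < x ->
  0 < lambertG x /\ lambertG x ^ 2 = lambertA x ^ 2 - lambertB x ^ 2.
Proof.
intros Hx. destruct (lambertAB_order x Hx) as [H _].
assert (0 < lambertA x ^ 2 - lambertB x ^ 2) by (simpl; nra).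
split; [now apply sqrt_lt_R0|]. apply pow2_sqrt. lra.
Qed.

Lemma lambertG_double (x : R) : 0 < x -> lambertG (2 * x) = (lambertA x - lambertB x) / 2.
Proof.
intros Hx. destruct (lambertAB_order x Hx) as [H _].
unfold lambertG. rewrite lambertB_double_sq, lambertA_double by trivial.
replace (_ - _) with (((lambertA x - lambertB x) / 2) ^ 2) by field.
apply sqrt_pow2. lra.
Qed.

(** Landen's transformation read backwards: the means of A(2x) and G(2x) are A/2
    and G/2. *)
Lemma gaussI_complementary_double (x : R) : 0 < x ->
  gaussI (lambertA (2 * x)) (lambertG (2 * x)) = 2 * gaussI (lambertA x) (lambertG x).
Proof.
intros Hx. destruct (lambertAB_order x Hx) as [H _].
destruct (lambertG_sq x Hx) as [G1 G2].
rewrite lambertG_double, lambertA_double by trivial.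
rewrite gaussI_landen by lra.
replace (((lambertA x + lambertB x) / 2 + (lambertA x - lambertB x) / 2) / 2)
  with (/ 2 * lambertA x) by field.
replace (sqrt ((lambertA x + lambertB x) / 2 * ((lambertA x - lambertB x) / 2)))
  with (/ 2 * lambertG x).
- rewrite gaussI_scale by lra. field.
- rewrite <- (sqrt_pow2 (/ 2 * lambertG x)) by lra. f_equal.
  rewrite Rpow_mult_distr, G2. field.
Qed.

Definition lambertModulus (x : R) : R := lambertG x / lambertA x.

Lemma lambertModulus_spec (x : R) : 0 < x ->
  0 < lambertModulus x < 1 /\
  sqrt (1 - lambertModulus x ^ 2) = lambertB x / lambertA x.
Proof.
intros Hx. destruct (lambertAB_order x Hx) as [H _].
destruct (lambertG_sq x Hx) as [G1 G2]. unfold lambertModulus.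
split; [split|].
- apply Rdiv_lt_0_compat; lra.
- apply Rmult_lt_reg_r with (lambertA x); [lra|].
  unfold Rdiv. rewrite Rmult_assoc, Rinv_l by lra. nra.
- rewrite <- (sqrt_pow2 (lambertB x / lambertA x)).
  + f_equal. replace ((lambertG x / lambertA x) ^ 2) with (lambertG x ^ 2 / lambertA x ^ 2)
      by (field; lra).
    rewrite G2. field. lra.
  + left. apply Rdiv_lt_0_compat; lra.
Qed.

Lemma gaussI_lambertModulus (x : R) : 0 < x ->
  gaussI 1 (lambertModulus x) = lambertA x * gaussI (lambertA x) (lambertG x).
Proof.
intros Hx. destruct (lambertAB_order x Hx) as [H _].
destruct (lambertG_sq x Hx) as [G1 G2]. destruct (lambertModulus_spec x Hx) as [M _].
pose proof (gaussI_scale (lambertA x) 1 (lambertModulus x) ltac:(lra) ltac:(lra) ltac:(lra)) as E.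
rewrite Rmult_1_r in E.
replace (lambertA x * lambertModulus x) with (lambertG x) in E
  by (unfold lambertModulus; field; lra).
rewrite E. field. lra.
Qed.

Lemma ln_lambertModulus_bounds (y : R) : 1 <= y ->
  y - ln 32 <= - 2 * ln (lambertModulus y) <= y + ln 5.
Proof.
intros Hy. assert (Hy0 : 0 < y) by lra.
destruct (lambertAB_order y Hy0) as [H H1]. destruct (lambertG_sq y Hy0) as [G1 G2].
destruct (lambertModulus_spec y Hy0) as [M _].
destruct (lambertA_minus_lambertB y Hy0) as [D1 D2].
destruct (lambertA_bounds y Hy0) as [_ A2].
pose proof (exp_ineq1 y ltac:(lra)) as Ey.
assert (A5 : lambertA y <= 5).
{ destruct (inv_exp_minus_1 y Hy0). assert (/ y <= / 1) by (apply Rinv_le_contravar; lra).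
  rewrite Rinv_1 in *. lra. }
assert (D3 : lambertA y - lambertB y <= 16 * exp (- y)).
{ apply Rle_trans with (1 := D2). rewrite exp_Ropp.
  assert (/ (exp y - 1) <= / (exp y / 2)) by (apply Rinv_le_contravar; lra).
  replace (/ (exp y / 2)) with (2 * / exp y) in H0 by (field; lra). lra. }
(* k^2 = (A - B)(A + B)/A^2 lies between q/5 and 32 q *)
assert (E2 : lambertModulus y ^ 2 =
  (lambertA y - lambertB y) * ((lambertA y + lambertB y) / lambertA y ^ 2)).
{ unfold lambertModulus.
  replace ((lambertG y / lambertA y) ^ 2) with (lambertG y ^ 2 / lambertA y ^ 2)
    by (field; lra). rewrite G2. field. lra. }
assert (F : / 5 <= (lambertA y + lambertB y) / lambertA y ^ 2 <= 2).
{ assert (0 < lambertA y ^ 2) by (apply pow_lt; lra).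
  split; (apply Rmult_le_reg_r with (lambertA y ^ 2); [trivial|]);
  unfold Rdiv; rewrite (Rmult_assoc _ (/ _)), Rinv_l by lra; simpl; nra. }
pose proof (exp_pos (- y)) as Ep.
assert (L : ln (lambertModulus y ^ 2) = 2 * ln (lambertModulus y)).
{ simpl. rewrite Rmult_1_r, ln_mult by lra. ring. }
assert (B : / 5 * exp (- y) <= lambertModulus y ^ 2 <= 32 * exp (- y)).
{ rewrite E2. split.
  - rewrite Rmult_comm. apply Rmult_le_compat; lra.
  - replace (32 * exp (- y)) with (16 * exp (- y) * 2) by ring.
    apply Rmult_le_compat; lra. }
destruct B as [B1 B2].
apply ln_le in B1; [|lra]. apply ln_le in B2; [|apply pow_lt; lra].
rewrite ln_mult, ln_exp in B1, B2 by lra. rewrite ln_Rinv in B1 by lra. lra.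
Qed.

(** The quotient of the integral by x is invariant under doubling, and the
    logarithm of the modulus, which governs the integral, is - x/2 + O(1). *)
Lemma gaussI_complementary_lambert (x : R) : 0 < x ->
  gaussI (lambertA x) (lambertG x) = x / 2.
Proof.
intros Hx. set (J := gaussI (lambertA x) (lambertG x)).
pose (y := fun n => 2 ^ n * x).
assert (Hy : forall n, 0 < y n)
  by (intros n; apply Rmult_lt_0_compat; [apply pow_lt; lra|trivial]).
assert (HJ : forall n, gaussI (lambertA (y n)) (lambertG (y n)) = y n * (J / x)).
{ induction n.
  - unfold y. rewrite pow_O, Rmult_1_l. unfold J. field. lra.
  - unfold y in *. rewrite <- tech_pow_Rmult, Rmult_assoc.
    rewrite gaussI_complementary_double by apply Hy. rewrite IHn. ring. }
assert (LA : is_lim_seq (fun n => lambertA (y n)) 1)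
  by (apply is_lim_seq_doubling; [trivial|apply lambertA_near_1]).
assert (LB : is_lim_seq (fun n => lambertB (y n)) 1)
  by (apply is_lim_seq_doubling; [trivial|apply lambertB_near_1]).
pose proof (is_lim_seq_pow2 x Hx) as Ly. fold y in Ly.
assert (Li : is_lim_seq (fun n => / y n) 0)
  by (apply (is_lim_seq_inv _ p_infty); [exact Ly|discriminate]).
assert (Hev : exists N, forall n, (N <= n)%nat -> 1 <= y n).
{ apply is_lim_seq_spec in Ly. destruct (Ly 1) as [N HN]. exists N.
  intros n Hn. left. now apply HN. }
assert (Bd : eventually (fun n =>
  (1 - ln 32 * / y n) / 2 <= J / x * lambertA (y n) <=
  PI / 2 * / y n + (ln 2 * / y n + (1 + ln 5 * / y n) / 2) * (lambertA (y n) / lambertB (y n)))).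
{ destruct Hev as [N HN]. exists N. intros n Hn. specialize (HN n Hn).
  destruct (lambertAB_order _ (Hy n)) as [O _].
  destruct (lambertModulus_spec _ (Hy n)) as [M ME].
  pose proof (gaussI_log_bounds _ M) as [K1 K2].
  destruct (ln_lambertModulus_bounds _ HN) as [N1 N2].
  rewrite ME in K2. rewrite gaussI_lambertModulus, HJ in K1, K2 by apply Hy.
  replace ((ln 2 - ln (lambertModulus (y n))) / (lambertB (y n) / lambertA (y n))) with
    ((ln 2 - ln (lambertModulus (y n))) * (lambertA (y n) / lambertB (y n))) in K2
    by (field; lra).
  assert (Hr : 0 < lambertA (y n) / lambertB (y n)) by (apply Rdiv_lt_0_compat; lra).
  specialize (Hy n). set (v := y n) in *. set (r := lambertA v / lambertB v) in *.
  assert (Ev : v * / v = 1) by (apply Rinv_r; lra).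
  assert (Iv : 0 < / v) by now apply Rinv_0_lt_compat.
  split.
  - apply Rmult_le_reg_l with v; [trivial|].
    replace (v * ((1 - ln 32 * / v) / 2)) with ((v - ln 32 * (v * / v)) / 2) by (field; lra).
    rewrite Ev. lra.
  - apply Rmult_le_reg_l with v; [trivial|].
    replace (v * (PI / 2 * / v + (ln 2 * / v + (1 + ln 5 * / v) / 2) * r)) with
      (PI / 2 * (v * / v) + (ln 2 * (v * / v) + (v + ln 5 * (v * / v)) / 2) * r) by (field; lra).
    rewrite Ev.
    assert ((ln 2 - ln (lambertModulus v)) * r <= (ln 2 * 1 + (v + ln 5 * 1) / 2) * r)
      by (apply Rmult_le_compat_r; lra).
    lra. }
assert (LJ : is_lim_seq (fun n => J / x * lambertA (y n)) (J / x * 1))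
  by (apply is_lim_seq_mult'; [apply is_lim_seq_const|exact LA]).
assert (L1 : is_lim_seq (fun n => (1 - ln 32 * / y n) / 2) ((1 - ln 32 * 0) / 2)).
{ repeat first [apply is_lim_seq_div' | apply is_lim_seq_minus' | apply is_lim_seq_mult'
    | apply is_lim_seq_const | assumption | lra]. }
assert (L2 : is_lim_seq (fun n => PI / 2 * / y n +
    (ln 2 * / y n + (1 + ln 5 * / y n) / 2) * (lambertA (y n) / lambertB (y n)))
  (PI / 2 * 0 + (ln 2 * 0 + (1 + ln 5 * 0) / 2) * (1 / 1))).
{ repeat first [assumption | apply is_lim_seq_const | apply is_lim_seq_div'
    | apply is_lim_seq_plus' | apply is_lim_seq_mult' | lra]. }
assert (U1 : (1 - ln 32 * 0) / 2 <= J / x * 1).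
{ apply (is_lim_seq_le_loc _ _ (Finite _) (Finite _)) with (2 := L1) (3 := LJ).
  apply filter_imp with (2 := Bd). intros n [K _]. exact K. }
assert (U2 : J / x * 1 <= PI / 2 * 0 + (ln 2 * 0 + (1 + ln 5 * 0) / 2) * (1 / 1)).
{ apply (is_lim_seq_le_loc _ _ (Finite _) (Finite _)) with (2 := LJ) (3 := L2).
  apply filter_imp with (2 := Bd). intros n [_ K]. exact K. }
assert (E : J / x = / 2) by lra.
replace J with (J / x * x) by (field; lra). rewrite E. field.
Qed.

(** K increases with the modulus, and K' decreases. *)
Lemma gaussI_ratio_injective (k k0 : R) : 0 < k < 1 -> 0 < k0 < 1 ->
  gaussI 1 k / gaussI 1 (sqrt (1 - k ^ 2)) = gaussI 1 k0 / gaussI 1 (sqrt (1 - k0 ^ 2)) ->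
  k = k0.
Proof.
intros Hk Hk0 E.
assert (Hpos : forall b, 0 < b < 1 -> 0 < gaussI 1 b).
{ intros b Hb. destruct (gaussI_bounds 1 b) as [H _]; [lra|].
  pose proof PI2_pos. rewrite Rinv_1 in H. lra. }
assert (Hs : forall l, 0 < l < 1 -> 0 < sqrt (1 - l ^ 2) < 1).
{ intros l Hl. split; [apply sqrt_lt_R0; simpl; nra|].
  rewrite <- sqrt_1 at 2. apply sqrt_lt_1_alt. simpl; nra. }
assert (Hlt : forall l m, 0 < l -> l < m -> m < 1 ->
  gaussI 1 m / gaussI 1 (sqrt (1 - m ^ 2)) < gaussI 1 l / gaussI 1 (sqrt (1 - l ^ 2))).
{ intros l m H0 H1 H2.
  pose proof (Hs l ltac:(lra)). pose proof (Hs m ltac:(lra)).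
  assert (D1 : gaussI 1 m < gaussI 1 l) by (apply gaussI_decreasing; lra).
  assert (D2 : gaussI 1 (sqrt (1 - l ^ 2)) < gaussI 1 (sqrt (1 - m ^ 2))).
  { apply gaussI_decreasing; [lra|]. split; [lra|].
    apply sqrt_lt_1_alt. simpl; nra. }
  pose proof (Hpos m ltac:(lra)). pose proof (Hpos (sqrt (1 - l ^ 2)) ltac:(lra)).
  apply Rmult_gt_0_lt_compat; try lra.
  - apply Rinv_0_lt_compat; lra.
  - apply Rinv_lt_contravar; [nra|trivial]. }
destruct (Rtotal_order k k0) as [H|[H|H]]; trivial; exfalso.
- pose proof (Hlt k k0 ltac:(lra) H ltac:(lra)). lra.
- pose proof (Hlt k0 k ltac:(lra) H ltac:(lra)). lra.
Qed.

Lemma jacobi_inversion (k : R) : 0 < k < 1 ->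
  let x := PI * (gaussI 1 k / gaussI 1 (sqrt (1 - k ^ 2))) in
  0 < x /\ sqrt (1 - k ^ 2) = lambertB x / lambertA x /\
  gaussI 1 (sqrt (1 - k ^ 2)) = lambertA x * (PI / 2).
Proof.
intros Hk x. pose proof PI_RGT_0 as Hpi.
assert (Hpos : forall b, 0 < b <= 1 -> 0 < gaussI 1 b).
{ intros b Hb. destruct (gaussI_bounds 1 b) as [H _]; [lra|].
  pose proof PI2_pos. rewrite Rinv_1 in H. lra. }
assert (Hs : 0 < sqrt (1 - k ^ 2) < 1).
{ split; [apply sqrt_lt_R0; simpl; nra|].
  rewrite <- sqrt_1 at 2. apply sqrt_lt_1_alt. simpl; nra. }
assert (Hx : 0 < x).
{ unfold x. apply Rmult_lt_0_compat; [trivial|].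
  apply Rdiv_lt_0_compat; apply Hpos; lra. }
split; [exact Hx|].
destruct (lambertAB_order x Hx) as [O _].
destruct (lambertModulus_spec x Hx) as [M ME].
assert (EK : gaussI 1 (lambertB x / lambertA x) = lambertA x * (PI / 2)).
{ rewrite <- (gaussI_lambert x Hx).
  assert (0 < lambertB x / lambertA x) by (apply Rdiv_lt_0_compat; lra).
  pose proof (gaussI_scale (lambertA x) 1 (lambertB x / lambertA x)
    ltac:(lra) ltac:(lra) ltac:(lra)) as E.
  rewrite Rmult_1_r in E.
  replace (lambertA x * (lambertB x / lambertA x)) with (lambertB x) in E by (field; lra).
  rewrite E. field. lra. }
assert (Ek : k = lambertModulus x).
{ apply gaussI_ratio_injective; trivial.
  rewrite ME, EK, gaussI_lambertModulus, gaussI_complementary_lambert by trivial.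
  assert (HK : 0 < gaussI 1 (sqrt (1 - k ^ 2))) by (apply Hpos; lra).
  set (a := lambertA x) in *. clearbody a. unfold x.
  set (u := gaussI 1 k) in *. set (v := gaussI 1 (sqrt (1 - k ^ 2))) in *.
  clearbody u v. field. repeat split; lra. }
rewrite Ek at 1. rewrite ME. split; [reflexivity|].
rewrite Ek at 1. rewrite ME. exact EK.
Qed.

(** * The evaluation *)

Theorem theorem5 (k : R) (hk : 0 < k ^ 2 < 1)
    (hconv : ex_series (lambert_term k)) :
  Series (lambert_term k) =
    3 / 2 +
    4 * (k ^ 2 * (3 + complementary_modulus k)
         - 3 * (1 + complementary_modulus k)) * ellipticK k ^ 3 /
    ((sqrt (1 - k) + sqrt (1 + k)) * PI ^ 3).
Proof.
clear hconv. pose proof PI_RGT_0 as Hpi.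
assert (Hk : 0 < Rabs k < 1).
{ split.
  - apply Rabs_pos_lt. intros ->. simpl in hk; lra.
  - apply Rabs_def1; simpl in hk; nra. }
assert (Ea : Rabs k ^ 2 = k ^ 2) by apply pow2_abs.
destruct (jacobi_inversion (Rabs k) Hk) as [Hx [Ek' EK]].
rewrite Ea in Hx, Ek', EK.
set (x := PI * (gaussI 1 (Rabs k) / gaussI 1 (sqrt (1 - k ^ 2)))) in *.
assert (EKk : ellipticK k = lambertA x * (PI / 2)) by (rewrite ellipticK_gaussI by lra; exact EK).
assert (EKc : ellipticK (complementary_modulus k) = gaussI 1 (Rabs k)).
{ rewrite <- (ellipticK_complementary _ Hk). unfold complementary_modulus. now rewrite Ea. }
assert (ES : Series (lambert_term k) = lambertS x).
{ apply Series_ext. intros n. unfold lambert_term, bose.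
  rewrite plus_INR, mult_INR. simpl (INR 2). simpl (INR 1).
  rewrite EKc, ellipticK_gaussI by lra.
  unfold Rdiv at 1. f_equal. do 3 f_equal. unfold x. ring. }
rewrite ES, EKk. unfold complementary_modulus. rewrite Ek'.
destruct (lambertAB_order x Hx) as [O _].
pose proof (lambertS_closed_form x Hx) as ECF.
set (a := lambertA x) in *. set (b := lambertB x) in *.
set (T := sqrt (1 - k) + sqrt (1 + k)).
assert (Hk1 : 0 < 1 - k /\ 0 < 1 + k) by (destruct (Rabs_def2 _ _ (proj2 Hk)); lra).
assert (HT : 0 < T).
{ unfold T. pose proof (sqrt_lt_R0 _ (proj1 Hk1)). pose proof (sqrt_lt_R0 _ (proj2 Hk1)). lra. }
assert (HT2 : T ^ 2 = 2 + 2 * (b / a)).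
{ unfold T.
  replace ((sqrt (1 - k) + sqrt (1 + k)) ^ 2) with
    (sqrt (1 - k) ^ 2 + sqrt (1 + k) ^ 2 + 2 * (sqrt (1 - k) * sqrt (1 + k))) by ring.
  rewrite !pow2_sqrt, <- sqrt_mult_alt by lra.
  replace ((1 - k) * (1 + k)) with (1 - k ^ 2) by ring. rewrite Ek'. ring. }
assert (Ek2 : k ^ 2 = 1 - (b / a) ^ 2).
{ rewrite <- Ek'. rewrite pow2_sqrt by lra. ring. }
(* T^2 = 2 (1 + k') and k' = b/a, so that T replaces the square root *)
assert (Er : sqrt (a * ((a + b) / 2)) = a * T / 2).
{ rewrite <- (sqrt_pow2 (a * T / 2)) by nra. f_equal.
  replace ((a * T / 2) ^ 2) with (a ^ 2 * T ^ 2 / 4) by field. rewrite HT2. field. lra. }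
rewrite Er in ECF. rewrite Ek2.
assert (EF : 4 * ((1 - (b / a) ^ 2) * (3 + b / a) - 3 * (1 + b / a)) * (a * (PI / 2)) ^ 3 /
  (T * PI ^ 3) = - (T ^ 2 * (b * (2 * a + b) * a)) / (4 * T)).
{ rewrite HT2. field. repeat split; lra. }
rewrite EF. replace (- (T ^ 2 * (b * (2 * a + b) * a)) / (4 * T)) with
  (- (a * T / 2 * b * (2 * a + b)) / 2) by (field; lra).
lra.
Qed.
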